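(* Let $G$ be a connected claw-free $4$-regular graph of order $n$. Then $\gamma_p(G)\le \frac{n+1}{5}$, and the bound is sharp (i.e. there exist connected claw-free $4$-regular graphs $G$, with $n$ the order of $G$, for which $\gamma_p(G)=\frac{n+1}{5}$).
   Context: Graphs are finite and simple. A graph is $k$-regular if every vertex has degree $k$. A graph is claw-free if it has no induced subgraph isomorphic to $K_{1,3}$. The order of $G$ is its number of vertices. Power domination: let $S\subseteq V(G)$. Vertices become observed according to two rules. (OR 1) Initially, each vertex $v\in S$ observes itself and all its neighbors. (OR 2) Recursively, whenever an observed vertex $v$ has exactly one unobserved neighbor $u$, the vertex $u$ becomes observed. The set $S$ is a power dominating set (PDS) of $G$ if all vertices of $G$ eventually become observed. The power domination number $\gamma_p(G)$ is the minimum cardinality of a PDS of $G$. *)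

(* Defs.v *)
From HB Require Import structures.
From mathcomp Require Import all_boot all_order all_algebra.
Set Implicit Arguments.
Unset Strict Implicit.
Unset Printing Implicit Defensive.

Record sgraph := SGraph {
  vertex :> finType;
  adj : rel vertex;
  adj_sym : symmetric adj;
  adj_irrefl : irreflexive adj }.

Arguments adj {_} _ _.

Definition open_nbh (G : sgraph) (v : G) : {set G} := [set u | adj v u].

Definition closed_nbh (G : sgraph) (v : G) : {set G} := v |: open_nbh v.

Definition regular (k : nat) (G : sgraph) : Prop :=
  forall v : G, #|open_nbh v| = k.

(* A connected graph has at least one vertex. *)
Definition connected (G : sgraph) : Prop :=
  0 < #|G| /\ forall u v : G, connect adj u v.

Definition isomorphic (G H : sgraph) : Prop :=
  exists2 f : G -> H, bijective f & forall u v, adj (f u) (f v) = adj u v.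

Section Induced.
Variables (G : sgraph) (S : {set G}).

Definition induced_adj : rel {v : G | v \in S} :=
  fun u v => adj (val u) (val v).

Lemma induced_adj_sym : symmetric induced_adj.
Proof. by move=> u v; apply: adj_sym. Qed.

Lemma induced_adj_irrefl : irreflexive induced_adj.
Proof. by move=> u; apply: adj_irrefl. Qed.

Definition induced : sgraph := SGraph induced_adj_sym induced_adj_irrefl.
End Induced.

Section CompleteBipartite.
Variables m n : nat.

Definition Kmn_adj : rel ('I_m + 'I_n)%type := fun u v =>
  match u, v with
  | inl _, inr _ | inr _, inl _ => true
  | _, _ => false
  end.

Lemma Kmn_adj_sym : symmetric Kmn_adj.
Proof. by move=> [u|u] [v|v]. Qed.

Lemma Kmn_adj_irrefl : irreflexive Kmn_adj.
Proof. by move=> [u|u]. Qed.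

Definition Kmn : sgraph := SGraph Kmn_adj_sym Kmn_adj_irrefl.
End CompleteBipartite.

Definition claw_free (G : sgraph) : Prop :=
  forall S : {set G}, ~ isomorphic (induced S) (Kmn 1 3).

Section PowerDomination.
Variable G : sgraph.
Implicit Types (S O : {set G}).

Definition initially_observed S : {set G} := \bigcup_(v in S) closed_nbh v.

(* One simultaneous round of OR 2. *)
Definition propagate O : {set G} :=
  O :|: [set u | [exists v in O, open_nbh v :\: O == [set u]]].

Definition observed_after (i : nat) S : {set G} :=
  iter i propagate (initially_observed S).

(* A round that changes nothing is final and every other round adds a vertex,
   so #|G| rounds are enough; see [power_dominatingP]. *)
Definition power_dominating S : bool := observed_after #|G| S == setT.

Lemma sub_propagate O : O \subset propagate O.
Proof. exact: subsetUl. Qed.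

Lemma observed_after_stable S :
  propagate (observed_after #|G| S) = observed_after #|G| S.
Proof.
have step i : propagate (observed_after i S) = observed_after i S
    \/ i < #|observed_after i.+1 S|.
  elim: i => [|i [fix_i|lt_i]].
  - have [E|[u uP]] := set_0Vmem (observed_after 1 S); last first.
      by right; apply/card_gt0P; exists u.
    left; apply/eqP; rewrite eqEsubset sub_propagate andbT.
    by rewrite (E : propagate (observed_after 0 S) = set0) sub0set.
  - by left; rewrite /observed_after /= -/(observed_after i S) !fix_i.
  have := sub_propagate (observed_after i.+1 S).
  rewrite subEproper => /orP[/eqP <-|/proper_card lt]; first by left.
  by right; apply: leq_ltn_trans lt_i lt.
have [//|] := step #|G|.
by rewrite ltnNge max_card.
Qed.

Lemma power_dominatingP S :
  reflect (exists i, observed_after i S = setT) (power_dominating S).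
Proof.
apply: (iffP eqP) => [E|[i Ei]]; first by exists #|G|.
have [le_iG|/ltnW le_Gi] := leqP i #|G|.
  rewrite -(subnK le_iG) /observed_after iterD -/(observed_after i S) Ei.
  elim: (_ - _) => //= k ->.
  by apply/eqP; rewrite -subTset sub_propagate.
rewrite -Ei -(subnK le_Gi) /observed_after iterD -/(observed_after #|G| S).
by elim: (_ - _) => //= k <-; rewrite observed_after_stable.
Qed.

Lemma power_dominatingT : power_dominating setT.
Proof.
apply/power_dominatingP; exists 0; apply/setP=> v; rewrite inE.
by apply/bigcupP; exists v; rewrite // /closed_nbh setU11.
Qed.

Definition power_domination_number : nat :=
  #|[arg min_(S < [set: G] | power_dominating S) #|S| ]|.

Lemma power_domination_numberP :
  (exists2 S, power_dominating S & #|S| = power_domination_number) /\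
  (forall S, power_dominating S -> power_domination_number <= #|S|).
Proof.
rewrite /power_domination_number; case: arg_minnP => [|S dS minS].
  exact: power_dominatingT.
by split=> //; exists S.
Qed.
End PowerDomination.

(* Main.v *)
Require Import Defs.
From mathcomp Require Import all_boot all_order all_algebra zify.
Set Implicit Arguments.
Unset Strict Implicit.
Unset Printing Implicit Defensive.
Local Open Scope nat_scope.

(** Call a maximal clique of [G] a cell, unless it is a sun, that is, a triangle
    each of whose three edges has a common neighbour outside the triangle. If no
    single vertex dominates [G], then every vertex lies in exactly two cells, and
    these cover its closed neighbourhood ([cells_at]): the neighbourhood is
    covered by two cliques, and discarding the suns removes the surplus maximal
    cliques. The graphs where this fails are the complete graph on five
    vertices, the octahedron and the squared cycles; each is dominated by one
    vertex, and [5 <= n] settles them.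

    The vertices of [G] thus become the edges of a multigraph on the cells, a
    [web]: the degree of a cell is its size, at most four, the degrees add up to
    [2 * n], and cells that meet satisfy [|c| + |c'| = 5 + |c :&: c'|]. If the
    cells outside a set [D] of picks form a forest, then any set of vertices meeting all
    cells of [D] dominates ([picks_dominate]): among the cells that are not
    entirely observed, a leaf has a single unobserved vertex, and any other
    vertex of that leaf forces it. One vertex serves two adjacent cells, so with a
    matching [P] on [D], stored as a symmetric set of ordered pairs,
    [|D| - |P| / 2] vertices suffice. The upper bound follows from the existence
    of [D] and [P] with [10 * |D| <= 2 * n + 2 + 5 * |P|] ([web_bound]).

    Choose [D] and [P] with [2 * |D| - |P|] minimal; among those prefer large
    cliques, and then few picks next to triangles that share an edge with a
    4-clique. Exchanging cells shows that the cells of [D] are triangles and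
    4-cliques, that adjacent ones are paired, and that unpaired triangles only
    touch triangles. Counting degrees reduces the bound to
    [4 * |lone3| + 2 * |Q4| <= vol F F + 2] ([quartic_picks]), where [F] is the
    complement of [D], [lone3] the unpaired triangles and [Q4] the 4-cliques of
    [D]. The volume of the forest is shared out. Every unpaired triangle is
    attached twice to some tree of free triangles, and a tree pays four for each
    of these ([tree_bound]). A 4-clique is paid by an edge leading to an unpicked
    4-clique, or by a triangle sharing an edge with it, whose third vertex leads
    either into such a tree or to a triangle of the same kind. When a payment
    fails, the cells involved are closed under adjacency, hence all that matters
    by connectedness, and the additional two of the bound is enough.

    One configuration escapes this: a 4-clique with two such triangles whose
    third vertices lead to cells that do not meet. It is removed and the two ends
    are linked, which lowers the volume by ten and costs one pick, or two picks
    and a pair ([lift_valid]).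

    For sharpness, in the rook graph on a 3 by 3 board the closed neighbourhood
    of a vertex is stuck: each vertex has no or two neighbours outside. So one
    vertex does not dominate, while [n = 9]. *)

(** * Webs: multigraphs of cliques *)

(** Clearing the hypotheses that are not numerical keeps [lia] fast in the large
    contexts below. *)
Ltac lia_num :=
  repeat match goal with H : ?T |- _ =>
    lazymatch T with
    | is_true (leq _ _) => fail
    | @eq nat _ _ => fail
    | _ => clear H
    end end; lia.

Section Degrees.
Variables (W : finType) (m : W -> W -> nat).
Definition dg (X : {set W}) c := \sum_(x in X) m c x.
Definition deg c := dg setT c.
End Degrees.

(** A multigraph with the arithmetic of cliques that pairwise share [mult] vertices
    when each vertex lies in two of them: [deg_adj] says that two cliques meeting at
    [v] cover the five vertices of its closed neighbourhood. *)
Record web (W : finType) := Web {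
  mult :> W -> W -> nat;
  web_sym : forall x y, mult x y = mult y x;
  web_irr : forall x, mult x x = 0;
  deg_le : forall c, deg mult c <= 4;
  deg_adj : forall c x, 0 < mult c x -> deg mult c + deg mult x = 5 + mult c x }.
Arguments web_sym {W} m x y : rename.
Arguments web_irr {W} m x : rename.
Arguments deg_le {W} m c : rename.
Arguments deg_adj {W m c x} : rename.

Section Multigraph.
Variables (W : finType) (m : web W).
Implicit Types (X Y Z F A : {set W}) (c x y : W).
Local Notation dg := (dg m).
Local Notation deg := (deg m).
Let m_sym := web_sym m.
Let m_irr := web_irr m.

(** The volume of [X] in itself counts every edge inside [X] twice. *)
Definition vol X Y := \sum_(c in X) dg Y c.

Lemma dgS X Y c : X \subset Y -> dg X c <= dg Y c.
Proof.
move=> sXY; rewrite /dg [X in _ <= X](big_setID X) /=.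
by rewrite (setIidPr sXY) leq_addr.
Qed.

Lemma dg_deg X c : dg X c <= deg c.
Proof. exact/dgS/subsetT. Qed.

Lemma dgU X Y c : [disjoint X & Y] -> dg (X :|: Y) c = dg X c + dg Y c.
Proof. by move=> dXY; rewrite -bigU //; apply: eq_bigl => x; rewrite !inE. Qed.

Lemma dgD X Y c : X \subset Y -> dg Y c = dg X c + dg (Y :\: X) c.
Proof. by move=> sXY; rewrite /dg (big_setID X) /= (setIidPr sXY). Qed.

Lemma dgID X Y c : dg Y c = dg (Y :&: X) c + dg (Y :\: X) c.
Proof. by rewrite /dg (big_setID X). Qed.

Lemma dg0 c : dg set0 c = 0.
Proof. by rewrite /dg big_set0. Qed.

Lemma dg1 x c : dg [set x] c = m c x.
Proof. by rewrite /dg big_set1. Qed.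

Lemma dgD1 x X c : x \in X -> dg X c = m c x + dg (X :\ x) c.
Proof. by move=> xX; rewrite /dg (big_setD1 x). Qed.

Lemma dgU1 x X c : x \notin X -> dg (x |: X) c = m c x + dg X c.
Proof. by move=> xX; rewrite /dg big_setU1. Qed.

Lemma dg_eq0 X c : (forall x, x \in X -> m c x = 0) -> dg X c = 0.
Proof. by move=> h; rewrite /dg big1. Qed.

Lemma m_le_dg X c x : x \in X -> m c x <= dg X c.
Proof. by move=> xX; rewrite (dgD1 _ xX) leq_addr. Qed.

Lemma m2_le_dg X c x y : x \in X -> y \in X -> x != y ->
  m c x + m c y <= dg X c.
Proof.
move=> xX yX nxy; rewrite (dgD1 _ xX) leq_add2l m_le_dg //.
by rewrite !inE eq_sym nxy.
Qed.

Lemma m3_le_dg X c x y z : x \in X -> y \in X -> z \in X ->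
  x != y -> x != z -> y != z -> m c x + m c y + m c z <= dg X c.
Proof.
move=> xX yX zX nxy nxz nyz; rewrite (dgD1 _ xX) -addnA leq_add2l m2_le_dg //.
  by rewrite !inE eq_sym nxy.
by rewrite !inE eq_sym nxz.
Qed.

Lemma dg_out X c x : x \notin X -> dg X c + m c x <= deg c.
Proof.
move=> xX; rewrite addnC -(dgU1 _ xX); exact: dg_deg.
Qed.

Lemma dg_out2 X c x y : x \notin X -> y \notin X -> x != y ->
  dg X c + m c x + m c y <= deg c.
Proof.
move=> xX yX nxy.
have := @dg_out (x |: X) c y; rewrite dgU1 // !inE eq_sym (negPf nxy) /=.
by move=> /(_ yX); rewrite (addnC (m c x)).
Qed.

Lemma dg_gt0 X c : 0 < dg X c -> exists2 x, x \in X & 0 < m c x.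
Proof.
move=> h; case: (pickP [pred x in X | 0 < m c x]) => [x /andP[]|nx].
  by exists x.
move: h; rewrite dg_eq0 // => x xX; move: (nx x); rewrite /= xX /=.
by case: (m c x).
Qed.

Lemma dg_gt1 X c : (forall x, x \in X -> m c x <= 1) -> 1 < dg X c ->
  exists x y, [/\ x \in X, y \in X, x != y, m c x = 1 & m c y = 1].
Proof.
move=> le1 h; have [x xX mx] : exists2 x, x \in X & 0 < m c x.
  by apply: dg_gt0; lia.
have mx1 : m c x = 1 by have := le1 _ xX; lia.
move: h; rewrite (dgD1 _ xX) mx1 => h.
have [|y] := @dg_gt0 (X :\ x) c; first by lia.
rewrite !inE => /andP[nyx yX] my; exists x, y; split=> //; first by rewrite eq_sym.
by have := le1 _ yX; lia.
Qed.

Lemma volC X Y : vol X Y = vol Y X.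
Proof.
rewrite /vol /dg exchange_big /=; apply: eq_bigr => y _.
by apply: eq_bigr => x _.
Qed.

Lemma vol_dgD Z X Y : X \subset Y -> vol Z Y = vol Z X + vol Z (Y :\: X).
Proof.
move=> sXY; rewrite /vol -big_split /=; apply: eq_bigr => c _; exact: dgD.
Qed.

Lemma vol1 c Y : vol [set c] Y = dg Y c.
Proof. by rewrite /vol big_set1. Qed.

Lemma volU1 c X Y : c \notin X -> vol (c |: X) Y = dg Y c + vol X Y.
Proof. by move=> h; rewrite /vol big_setU1. Qed.

Lemma volUU1 c X : c \notin X ->
  vol (c |: X) (c |: X) = vol X X + dg X c + dg X c.
Proof.
move=> h; rewrite volU1 // dgU1 // m_irr (volC X) volU1 //; lia.
Qed.

Lemma volDD1 c X : c \in X -> vol X X = vol (X :\ c) (X :\ c) + 2 * dg X c.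
Proof.
move=> cX; rewrite -{1 2}(setD1K cX) volUU1 ?inE ?eqxx //.
rewrite (dgD1 c cX) m_irr add0n; lia.
Qed.

Lemma vol_ge X Y k : (forall c, c \in X -> k <= dg Y c) -> k * #|X| <= vol X Y.
Proof.
by move=> h; rewrite mulnC -sum_nat_const; apply: leq_sum => c /h.
Qed.

(** Forests, in the degenerate form: no subset of minimum degree two. *)
Definition fat X := [forall c in X, 2 <= dg X c].
Definition forest F := [forall X : {set W}, (X \subset F) ==> fat X ==> (X == set0)].

Lemma fatP X : reflect (forall c, c \in X -> 2 <= dg X c) (fat X).
Proof. exact: (iffP forall_inP). Qed.

Lemma forestP F :
  reflect (forall X c, X \subset F -> fat X -> c \in X -> False) (forest F).
Proof.
apply: (iffP forallP) => [h X c sXF fX cX|h X].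
  by have := h X; rewrite sXF fX => /eqP X0; rewrite X0 inE in cX.
apply/implyP=> sXF; apply/implyP=> fX; apply/eqP/setP=> c; rewrite inE.
by apply/negP=> cX; apply: (h X c).
Qed.

Lemma forestPn F : ~~ forest F -> exists X c, [/\ X \subset F, fat X & c \in X].
Proof.
rewrite negb_forall => /existsP[X]; rewrite !negb_imply => /and3P[sXF fX].
by case/set0Pn=> c cX; exists X, c.
Qed.

(** Removing a cell of degree at most one, which exists unless the set is fat,
    lowers the volume by at most two. *)
Lemma forest_vol F X c : forest F -> X \subset F -> c \in X ->
  vol X X + 2 <= 2 * #|X|.
Proof.
move=> fF; move: {2}#|X| (leqnn #|X|) => n; elim: n X c => [|n IH] X c leX sXF cX.
  by move: leX; rewrite leqn0 cards_eq0 => /eqP X0; rewrite X0 inE in cX.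
have [a aX da] : exists2 a, a \in X & dg X a <= 1.
  case: (boolP (fat X)) => [fX|].
    by case: (forestP F fF X c).
  by rewrite negb_forall_in => /exists_inP[a aX]; rewrite -ltnNge => h; exists a.
rewrite (volDD1 aX) (cardsD1 a X) aX.
case: (set_0Vmem (X :\ a)) => [X0|[b bX]].
  by rewrite X0 /vol big_set0 cards0; have := da; rewrite (dgD1 _ aX) X0 dg0 m_irr; lia.
have := IH (X :\ a) b; rewrite -ltnS.
have -> : #|X :\ a| < n.+1 by have := leX; rewrite (cardsD1 a X) aX; lia.
by move=> /(_ isT (subset_trans (subsetDl _ _) sXF) bX); lia.
Qed.

(** Inside a fat set, a set of forest cells sends at least two edges out. *)
Lemma fat_cut F X Y c : forest F -> fat X -> Y \subset X -> Y \subset F ->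
  c \in Y -> 2 <= vol Y (X :\: Y).
Proof.
move=> fF /fatP fX sYX sYF cY.
have h1 := forest_vol fF sYF cY.
have : 2 * #|Y| <= vol Y X by apply: vol_ge => a aY; apply/fX/(subsetP sYX).
by rewrite (vol_dgD _ sYX); lia.
Qed.

(** Components of the graph induced on [A]. *)
Definition radj A := [rel x y | [&& x \in A, y \in A & 0 < m x y]].
Definition ccomp A c := [set x | connect (radj A) c x].

Lemma radj_sym A : symmetric (radj A).
Proof. by move=> x y; rewrite /= m_sym andbCA. Qed.

Lemma conn_sym A : connect_sym (radj A).
Proof. exact/sym_connect_sym/radj_sym. Qed.

Lemma mem_comp A c : c \in ccomp A c.
Proof. by rewrite inE connect0. Qed.

Lemma comp_sub A c : c \in A -> ccomp A c \subset A.
Proof.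
move=> cA; apply/subsetP=> x; rewrite inE => /connectP[p pth ->].
by elim: p c cA pth => //= y p IH c cA /andP[/and3P[_ yA _] /IH]; apply.
Qed.

Lemma comp_closed A c x y : x \in ccomp A c -> x \in A -> y \in A -> 0 < m x y ->
  y \in ccomp A c.
Proof.
rewrite !inE => cx xA yA mxy; apply: connect_trans cx (connect1 _).
by rewrite /= xA yA.
Qed.

Lemma comp_eq A c x : x \in ccomp A c -> ccomp A x = ccomp A c.
Proof.
rewrite inE => cx; apply/setP=> y; rewrite !inE.
by rewrite (same_connect (@conn_sym A) cx).
Qed.

Lemma comp_ind A c (Y : {set W}) : c \in Y ->
  (forall x y, x \in Y -> x \in A -> y \in A -> 0 < m x y -> y \in Y) ->
  ccomp A c \subset Y.
Proof.
move=> cY h; apply/subsetP=> x; rewrite inE => /connectP[p pth ->].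
elim: p c cY pth => //= y p IH c cY /andP[/and3P[cA yA mcy] /IH]; apply.
exact: (h c).
Qed.

(** Connectedness bounds the volume below: grow the component one cell at a time. *)
Lemma comp_vol A c : 2 * #|ccomp A c| <= vol (ccomp A c) (ccomp A c) + 2.
Proof.
set Z := ccomp A c.
pose Q (B : {set W}) := [&& c \in B, B \subset Z & 2 * #|B| <= vol B B + 2].
have Q1 : Q [set c].
  by rewrite /Q set11 sub1set mem_comp cards1 vol1 /dg big_set1 m_irr.
case: (arg_maxnP (fun B : {set W} => #|B|) Q1) => B /and3P[cB sBZ vB] maxB.
suff -> : Z = B by [].
apply/eqP; rewrite eqEsubset sBZ andbT; apply: comp_ind => // x y xB xA yA mxy.
apply/negPn/negP=> nyB.
have yZ : y \in Z by apply: comp_closed mxy => //; apply: (subsetP sBZ).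
have : Q (y |: B).
  rewrite /Q !inE cB orbT subUset sub1set yZ sBZ /= cardsU1 nyB volUU1 //.
  have : 0 < dg B y by apply: leq_trans (m_le_dg y xB); rewrite m_sym.
  by lia.
by move/maxB; rewrite cardsU1 nyB /=; lia.
Qed.

Lemma comp_dg A c x : x \in ccomp A c -> x \in A -> dg A x = dg (ccomp A c) x.
Proof.
move=> xc xA; rewrite (dgID (ccomp A c) A) [X in _ + X]dg_eq0 ?addn0.
  rewrite /dg; apply: eq_bigl => y; rewrite inE; case: (boolP (y \in ccomp A c)).
    by rewrite andbT => yc; apply/idP; move/comp_eq: xc => <- in yc; apply: (subsetP (comp_sub xA)).
  by rewrite andbF.
move=> y; rewrite !inE => /andP[/negP nyc yA]; apply/eqP.
rewrite -leqn0 leqNgt; apply/negP=> mxy; apply: nyc.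
have := comp_closed xc xA yA mxy; by rewrite inE.
Qed.

End Multigraph.

(** * Selections of cells and pairs *)

Section Matching.
Variables (W : finType) (m : web W).
Let m_sym := web_sym m.
Let m_irr := web_irr m.
Implicit Types (D : {set W}) (P : {set W * W}).
Local Notation deg := (deg m).
Local Notation dg := (dg m).
Local Notation fat := (fat m).

(** The condition under which picking the cells of [D] dominates. *)
Definition acyc D := forest m (~: D).

Lemma acycP D :
  reflect (forall X c, fat X -> (forall x, x \in X -> x \notin D) -> c \in X -> False)
    (acyc D).
Proof.
apply: (iffP (forestP _ _)) => h X c.
  by move=> fX aX; apply: h fX; apply/subsetP=> x /aX; rewrite inE.
by move=> sX fX; apply: h fX _ => x /(subsetP sX); rewrite inE.
Qed.

Lemma acycPn D : ~~ acyc D ->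
  exists X c, [/\ fat X, c \in X & forall x, x \in X -> x \notin D].
Proof.
case/forestPn=> X [c [sX fX cX]]; exists X, c; split=> // x /(subsetP sX).
by rewrite inE.
Qed.

(** Pairs are stored in both orders, so [#|P|] is the number of paired cells. *)
Definition matching D P :=
  [forall p in P, [&& (p.2, p.1) \in P, p.1 \in D, p.2 \in D & 0 < m p.1 p.2]]
  && [forall p in P, forall q in P, (p.1 == q.1) ==> (p == q)].

Lemma matchingP D P : reflect
  ((forall a b, (a, b) \in P -> [/\ (b, a) \in P, a \in D, b \in D & 0 < m a b])
   /\ (forall a b c, (a, b) \in P -> (a, c) \in P -> b = c)) (matching D P).
Proof.
apply: (iffP andP) => [[/forall_inP h1 /forall_inP h2]|[h1 h2]]; split.
- by move=> a b /h1 /and4P[].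
- move=> a b c /h2 /forall_inP h /h /implyP /(_ (eqxx _)) /eqP [] //.
- by apply/forall_inP=> -[a b] /h1 /= [-> -> -> ->].
- apply/forall_inP=> -[a b] pab; apply/forall_inP=> -[c d] pcd /=.
  by apply/implyP=> /eqP ac; subst c; rewrite (h2 _ _ _ pab pcd).
Qed.

Definition lone P a := [forall b, (a, b) \notin P].

Lemma loneP P a : reflect (forall b, (a, b) \notin P) (lone P a).
Proof. exact: forallP. Qed.

Lemma lonePn P a : ~~ lone P a -> exists b, (a, b) \in P.
Proof. by rewrite negb_forall => /existsP[b]; rewrite negbK; exists b. Qed.

Lemma matching_sub D D' P : matching D P ->
  (forall a, a \in D -> a \notin D' -> lone P a) -> matching D' P.
Proof.
case/matchingP=> h1 h2 hD; apply/matchingP; split=> // a b pab.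
have [pba aD bD mab] := h1 _ _ pab; split=> //; apply/negPn/negP.
  by move=> /(hD _ aD)/loneP/(_ b); rewrite pab.
by move=> /(hD _ bD)/loneP/(_ a); rewrite pba.
Qed.

Definition addp a b P := (a, b) |: ((b, a) |: P).
Definition delp a b P := P :\ (a, b) :\ (b, a).

Lemma card_addp a b P : a != b -> lone P a -> lone P b ->
  #|addp a b P| = #|P| + 2.
Proof.
move=> nab /loneP fa /loneP fb; rewrite /addp !cardsU1 !inE xpair_eqE.
by rewrite (negPf nab) (negPf (fa b)) (negPf (fb a)) /= addnA addnC.
Qed.

Lemma matching_add D P a b : matching D P -> a \in D -> b \in D -> 0 < m a b ->
  lone P a -> lone P b -> matching D (addp a b P).
Proof.
case/matchingP=> h1 h2 aD bD mab /loneP fa /loneP fb.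
apply/matchingP; split=> [x y|x y z]; rewrite !inE !xpair_eqE.
  case/or3P=> [/andP[/eqP-> /eqP->]|/andP[/eqP-> /eqP->]|/h1[-> -> -> ->]].
  - by rewrite !eqxx orbT; split.
  - by rewrite !eqxx m_sym; split.
  - by rewrite !orbT.
have nab : a != b by apply: contraTneq mab => ->; rewrite m_irr.
case/or3P=> [/andP[/eqP-> /eqP->]|/andP[/eqP-> /eqP->]|pxy].
- rewrite eqxx (negPf nab) (negPf (fa z)) !orbF; by move/eqP.
- rewrite eqxx eq_sym (negPf nab) (negPf (fb z)) /= orbF; by move/eqP.
- case/or3P=> [/andP[/eqP xa _]|/andP[/eqP xb _]|]; last exact: h2 pxy.
    by rewrite xa (negPf (fa y)) in pxy.
  by rewrite xb (negPf (fb y)) in pxy.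
Qed.

Lemma matching_del D D' P a b : matching D P -> (a, b) \in P ->
  D :\ a \subset D' -> matching D' (delp a b P) /\ #|delp a b P| + 2 = #|P|.
Proof.
case/matchingP=> h1 h2 pab sD; have [pba aD bD mab] := h1 _ _ pab.
have nab : a != b by apply: contraTneq mab => ->; rewrite m_irr.
split; last first.
  have := cardsD1 (a, b) P; have := cardsD1 (b, a) (P :\ (a, b)).
  rewrite pab !inE pba xpair_eqE eq_sym (negPf nab) /= /delp => -> ->.
  by rewrite addnC addnA.
apply/matchingP; split=> [x y|x y z]; last first.
  by rewrite !inE => /and3P[_ _ h] /and3P[_ _ h']; apply: h2 h h'.
rewrite !inE !xpair_eqE => /and3P[n1 n2 pxy]; have [pyx xD yD mxy] := h1 _ _ pxy.
have nxa : x != a.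
  apply: contraNneq n2 => xa; subst x.
  by rewrite eqxx (h2 _ _ _ pxy pab) eqxx.
have nya : y != a.
  apply: contraNneq n1 => ya; subst y.
  by rewrite eqxx (h2 _ _ _ pyx pab) eqxx.
rewrite pyx mxy (negPf nxa) (negPf nya) !andbF /=.
by split=> //; apply: (subsetP sD); rewrite !inE ?nxa ?nya.
Qed.

Lemma card_matching D P : matching D P -> #|P| <= #|D|.
Proof.
case/matchingP=> h1 h2.
have inj : {in P &, injective (fun p : W * W => p.1)}.
  by move=> [a b] [c d] pab pcd /= ac; subst c; rewrite (h2 _ _ _ pab pcd).
rewrite -(card_in_imset inj); apply/subset_leq_card/subsetP=> a.
by case/imsetP=> -[x y] /h1[_ xD _ _] ->.
Qed.

Definition valid D P := acyc D && matching D P.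

(** Triangles that share an edge with a 4-clique; the third vertex leads to another
    triangle. *)
Definition flank h := (deg h == 3) && [exists q, (0 < m h q) && (deg q == 4)].
(** Triangles all of whose neighbours are triangles, met in one vertex each. *)
Definition core c := (deg c == 3) && ~~ flank c.
Definition weight D := \sum_(c in D) (5 - deg c).
Definition flanked D := #|[set c in D | [exists h, (0 < m c h) && flank h]]|.

(** Minimal cost [2 * #|D| - #|P|], written without subtraction, which is twice the
    number of vertices needed; among the cheapest, small [weight] favours large
    cliques. *)
Definition opt D P := valid D P /\ forall D' P', valid D' P' ->
  2 * #|D| + #|P'| <= 2 * #|D'| + #|P|
  /\ (2 * #|D| + #|P'| = 2 * #|D'| + #|P| -> weight D <= weight D').

Lemma valid_setT : valid setT set0.
Proof.
apply/andP; split.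
  by apply/acycP=> X c _ h /h; rewrite inE.
by apply/matchingP; split=> a b; rewrite ?inE // => c; rewrite inE.
Qed.

(** The three criteria are minimized lexicographically by one weighted sum. *)
Lemma opt_exists : exists D P, opt D P /\ forall D' P', opt D' P' -> flanked D <= flanked D'.
Proof.
pose B := 5 * #|W| + 1.
pose mu (x : {set W} * {set W * W}) :=
  ((2 * #|x.1| - #|x.2|) * B + weight x.1) * B + flanked x.1.
have v0 : [pred x | valid x.1 x.2] (setT, set0) by rewrite /= valid_setT.
case: (arg_minnP mu v0) => -[D P] /= vDP minDP.
have k2B D' : weight D' < B.
  have : weight D' <= \sum_(c in D') 5 by apply: leq_sum => c _; apply: leq_subr.
  rewrite sum_nat_const => h; have h2 : #|D'| <= #|W| by apply: max_card.
  by apply: leq_ltn_trans h _; rewrite /B addn1 ltnS mulnC leq_mul2l h2 orbT.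
have k3B D' : flanked D' < B.
  have h : flanked D' <= #|W| by apply: max_card.
  by apply: leq_ltn_trans h _; rewrite /B addn1 ltnS leq_pmull.
have le P' D' : valid D' P' -> #|P'| <= 2 * #|D'|.
  by case/andP=> _ /card_matching; lia.
have min' D' P' : valid D' P' -> ((2 * #|D| - #|P|) * B + weight D) * B + flanked D
    <= ((2 * #|D'| - #|P'|) * B + weight D') * B + flanked D'.
  by move=> v; apply: (minDP (D', P')).
have cmp a b c a' b' c' : b < B -> b' < B -> c < B -> c' < B ->
    (a * B + b) * B + c <= (a' * B + b') * B + c' ->
    a <= a' /\ (a = a' -> b <= b' /\ (b = b' -> c <= c')).
  move=> *; split; first by nia.
  by move=> ?; split; nia.
have ar a b c d : d <= c -> b <= a -> a - b <= c - d -> a + d <= c + b by lia.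
have ar2 a b c d : d <= c -> b <= a -> a + d = c + b -> a - b = c - d by lia.
exists D, P; split.
  split=> // D' P' v'; have := min' _ _ v'.
  case/(cmp _ _ _ _ _ _ (k2B _) (k2B _) (k3B _) (k3B _)) => h1 h2.
  have l1 := le _ _ v'; have l2 := le _ _ vDP.
  split; first exact: ar h1.
  by move=> e; case: h2 => //; apply: ar2 e.
move=> D' P' [v' o']; have [h3 h4] := o' _ _ vDP.
case/(cmp _ _ _ _ _ _ (k2B _) (k2B _) (k3B _) (k3B _)): (min' _ _ v') => h1 h2.
move: (le _ _ v') (le _ _ vDP) h1 h2 => /= l1 l2 h1 h2.
have e : 2 * #|D'| + #|P| = 2 * #|D| + #|P'|.
  by apply/eqP; rewrite eqn_leq h3; apply: ar h1.
case: h2 => [|h21 h22]; first by apply: ar2.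
by apply: h22; apply/eqP; rewrite eqn_leq h21 h4.
Qed.

End Matching.

(** * Degrees in an optimal selection *)

Section Types.
Variables (W : finType) (m : web W).
Let m_sym := web_sym m.
Let m_irr := web_irr m.
Local Notation deg := (deg m).
Local Notation dg := (dg m).
Local Notation fat := (fat m).
Local Notation flank := (flank m).
Local Notation core := (core m).
Implicit Types (D X : {set W}) (P : {set W * W}).

Lemma m_le_deg c x : m c x <= deg c.
Proof. by apply: m_le_dg; rewrite inE. Qed.

Lemma adj_neq c x : 0 < m c x -> c != x.
Proof. by apply: contraTneq => ->; rewrite m_irr. Qed.

Lemma adj4 c x : 0 < m c x -> deg c = 4 -> m c x + 1 = deg x.
Proof. by move=> /deg_adj; lia. Qed.

Lemma adj33 c x : 0 < m c x -> deg c = 3 -> deg x = 3 -> m c x = 1.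
Proof. by move=> /deg_adj; lia. Qed.

Lemma adj34 c x : 0 < m c x -> deg c = 3 -> deg x = 4 -> m c x = 2.
Proof. by move=> /deg_adj; lia. Qed.

Lemma adj3 c x : 0 < m c x -> deg c = 3 -> deg x = 3 \/ deg x = 4.
Proof.
move=> h; have := deg_adj h; have := deg_le m x; have := m_le_deg x c.
by rewrite m_sym; lia.
Qed.

Lemma adj2 c x : 0 < m c x -> deg c = 2 -> deg x = 4 /\ m c x = 1.
Proof.
move=> h; have := deg_adj h; have := deg_le m x; have := m_le_deg x c.
by rewrite m_sym; lia.
Qed.

Lemma nbrs_all2 c x y : x != y -> m c x + m c y = deg c ->
  forall z, 0 < m c z -> z = x \/ z = y.
Proof.
move=> nxy e z mz; case: (eqVneq z x) => [|nzx]; first by left.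
case: (eqVneq z y) => [|nzy]; first by right.
have := @m3_le_dg _ m setT c x y z; rewrite !inE => /(_ isT isT isT nxy).
by rewrite eq_sym nzx eq_sym nzy => /(_ isT isT); rewrite -/(deg c); lia.
Qed.

Lemma nbrs_all3 c x y w : x != y -> x != w -> y != w ->
  m c x + m c y + m c w = deg c ->
  forall z, 0 < m c z -> [\/ z = x, z = y | z = w].
Proof.
move=> nxy nxw nyw e z mz; case: (eqVneq z x) => [->|nzx]; first by constructor 1.
case: (eqVneq z y) => [->|nzy]; first by constructor 2.
case: (eqVneq z w) => [->|nzw]; first by constructor 3.
suff : m c x + m c y + m c w + m c z <= deg c by lia.
rewrite /deg (dgD1 _ _ (in_setT x)) -!addnA leq_add2l addnA.
by apply: m3_le_dg; rewrite ?inE ?andbT 1?eq_sym ?nxy ?nxw ?nyw ?nzx ?nzy ?nzw // eq_sym.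
Qed.

Lemma nbr_more c x : m c x < deg c -> exists2 y, y != x & 0 < m c y.
Proof.
rewrite /deg (dgD1 _ _ (in_setT x)) -{1}[m c x]addn0 ltn_add2l.
by case/dg_gt0=> y; rewrite !inE andbT; exists y.
Qed.

(** The degrees of adjacent cells leave no choice: a 4-clique met twice and a
    triangle met once. *)
Lemma flankP h : flank h -> exists q s,
  [/\ deg q = 4, deg s = 3, m h q = 2, m h s = 1 &
      forall z, 0 < m h z -> z = q \/ z = s].
Proof.
case/andP=> /eqP d3 /existsP[q /andP[mq /eqP dq]].
have m2 := adj34 mq d3 dq.
have [s nsq ms] : exists2 s, s != q & 0 < m h s by apply: nbr_more; rewrite m2 d3.
have m1 : m h s = 1.
  have := @m2_le_dg _ m setT h q s; rewrite !inE eq_sym nsq -/(deg h).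
  by move=> /(_ isT isT isT); lia.
have ds : deg s = 3 by have := deg_adj ms; lia.
exists q, s; split=> //; apply: nbrs_all2; first by rewrite eq_sym.
by rewrite m2 m1 d3.
Qed.

Lemma flankI h q : deg h = 3 -> deg q = 4 -> 0 < m h q -> flank h.
Proof.
by move=> d3 d4 mq; rewrite /flank d3 eqxx; apply/existsP; exists q; rewrite mq d4 eqxx.
Qed.

Lemma flank_deg h : flank h -> deg h = 3.
Proof. by case/andP=> /eqP. Qed.

Lemma core_deg c : core c -> deg c = 3.
Proof. by case/andP=> /eqP. Qed.

Lemma core_nbr c x : core c -> 0 < m c x -> deg x = 3 /\ m c x = 1.
Proof.
case/andP=> /eqP d3 nh mx; case: (adj3 mx d3) => dx.
  by rewrite (adj33 mx d3 dx).
by case/negP: nh; apply: flankI dx mx.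
Qed.

Lemma core_le1 c x : core c -> m c x <= 1.
Proof.
by move=> cc; case: (posnP (m c x)) => [->//|/(core_nbr cc)[_ ->]].
Qed.

Lemma core_nbr_flank c x : core c -> 0 < m c x -> ~~ core x -> flank x.
Proof. by move=> cc /(core_nbr cc)[d3 _]; rewrite /core d3 eqxx negbK. Qed.

(** A cell of a fat set needs two of its edges inside, so it keeps any neighbour that
    holds all but one of them. *)
Lemma fat_drop X c x : fat X -> c \in X -> deg c <= m c x + 1 -> x \in X.
Proof.
move=> /fatP fX cX le; apply/negPn/negP=> nx.
by have := fX _ cX; have := dg_out m c nx; rewrite -/(deg c); lia.
Qed.

Lemma fat_flank X h q : fat X -> h \in X -> deg h = 3 -> deg q = 4 -> 0 < m h q ->
  q \in X.
Proof.
by move=> fX hX d3 d4 mq; apply: fat_drop fX hX _; rewrite (adj34 mq) // d3.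
Qed.

Lemma fat_drop2 X c x y : fat X -> c \in X -> x != y ->
  deg c <= m c x + m c y + 1 -> x \in X \/ y \in X.
Proof.
move=> /fatP fX cX nxy le; case: (boolP (x \in X)); first by left.
case: (boolP (y \in X)); first by right.
move=> ny nx; have := fX _ cX; have := dg_out2 m c nx ny nxy.
by rewrite -/(deg c); lia.
Qed.

Section Optimal.
Variables (D : {set W}) (P : {set W * W}).
Hypothesis oDP : opt m D P.

Lemma opt_acyc : acyc m D. Proof. by case: oDP => /andP[]. Qed.
Lemma opt_match : matching m D P. Proof. by case: oDP => /andP[]. Qed.
Let mtP := @elimT _ _ (matchingP m D P) opt_match.

Lemma pair_facts a b : (a, b) \in P ->
  [/\ (b, a) \in P, a \in D, b \in D & 0 < m a b].
Proof. exact: (mtP.1). Qed.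

Lemma opt_no_better D' P' : valid m D' P' -> 2 * #|D'| + #|P| < 2 * #|D| + #|P'| -> False.
Proof. by move=> v lt; have [le _] := oDP.2 _ _ v; rewrite leqNgt lt in le. Qed.

Lemma opt_no_lighter D' P' : valid m D' P' ->
  2 * #|D'| + #|P| = 2 * #|D| + #|P'| -> weight m D' < weight m D -> False.
Proof.
move=> v e lt; have [_ /(_ (esym e)) le] := oDP.2 _ _ v.
by rewrite leqNgt lt in le.
Qed.

Lemma weightD1 d : d \in D -> weight m D = (5 - deg d) + weight m (D :\ d).
Proof. by move=> dD; rewrite /weight (big_setD1 d). Qed.

Lemma weightU1 (A : {set W}) d : d \notin A -> weight m (d |: A) = (5 - deg d) + weight m A.
Proof. by move=> dA; rewrite /weight big_setU1. Qed.

(** Dropping [d] from [D] must create a cycle, since it would lower the cost, or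
    lower the weight when [d] is paired. *)
Lemma opt_witness d : d \in D -> exists X,
  [/\ fat X, d \in X & forall x, x \in X -> x != d -> x \notin D].
Proof.
move=> dD; case: (boolP (acyc m (D :\ d))) => [ac|]; last first.
  case/acycPn=> X [c [fX cX aX]]; exists X; split=> //; last first.
    by move=> x /aX; rewrite !inE negb_and negbK => /orP[->|].
  apply/negPn/negP=> dX; apply: (elimT (acycP m D) opt_acyc X c) => // x xX.
  by move: (aX _ xX); rewrite !inE; case: eqP => //= xd; rewrite -xd xX in dX.
have cD := cardsD1 d D; rewrite dD in cD.
case: (boolP (lone P d)) => [fd|/lonePn[b pdb]].
  case: (@opt_no_better (D :\ d) P); last by move: cD; lia.
  apply/andP; split=> //; apply: matching_sub opt_match _ => a aD.
  by rewrite !inE aD andbT negbK => /eqP->.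
have [md cP] := matching_del opt_match pdb (subxx (D :\ d)).
case: (@opt_no_lighter (D :\ d) (delp d b P)); first by apply/andP.
  by move: cD cP; lia.
by rewrite [X in _ < X](weightD1 dD); have := deg_le m d; lia.
Qed.

(** A picked neighbour [c] of a quartic [d] has all edges but one towards [d], so it
    lies on no cycle that avoids [d]. *)
Lemma adj4_notinD d c : d \in D -> deg d = 4 -> 0 < m d c -> c \notin D.
Proof.
move=> dD d4 mdc; apply/negP=> cD.
have [X [fX cX aX]] := opt_witness cD.
have dX : d \in X by apply: fat_drop fX cX _; rewrite m_sym (adj4 mdc).
by move: (aX _ dX (adj_neq mdc)); rewrite dD.
Qed.

Lemma opt_deg_gt1 d : d \in D -> 2 <= deg d.
Proof.
move=> /opt_witness[X [/fatP fX dX _]]; apply: leq_trans (fX _ dX) _; exact: dg_deg.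
Qed.

Lemma card_exch d c : d \in D -> c \notin D -> #|c |: D :\ d| = #|D|.
Proof. by move=> dD cD; rewrite cardsU1 !inE (negPf cD) andbF (cardsD1 d D) dD. Qed.

Lemma weight_exch d c : d \in D -> c \notin D ->
  weight m (c |: D :\ d) + (5 - deg d) = weight m D + (5 - deg c).
Proof.
by move=> dD cD; rewrite weightU1 ?inE ?(negPf cD) ?andbF // (weightD1 dD); lia.
Qed.

Lemma match_exch d c D' : lone P d -> D :\ d \subset D' -> matching m (c |: D') P.
Proof.
move=> fd sD; apply: matching_sub opt_match _ => a aD; rewrite !inE negb_or.
case/andP=> _ aD'; case: (eqVneq a d) => [->//|nad].
by case/negP: aD'; apply: (subsetP sD); rewrite !inE nad.
Qed.

(** A cycle through [d] would have to use [c]. *)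
Lemma acyc_exch d c : d \in D -> deg d <= m d c + 1 -> acyc m (c |: D :\ d).
Proof.
move=> dD le; apply/acycP=> X x fX aX xX.
have dX : d \notin X.
  apply/negP=> dX; have /aX : c \in X by apply: fat_drop fX dX le.
  by rewrite !inE eqxx.
apply: (elimT (acycP m D) opt_acyc X x) => // y yX; move: (aX _ yX).
by rewrite !inE; case: (eqVneq y d) => [yd|_ /norP[]//]; rewrite -yd yX in dX.
Qed.

(** A cell of size two meets 4-cliques only, and picking one of these instead is
    lighter. *)
Lemma optD_deg_neq2 d : d \in D -> deg d != 2.
Proof.
move=> dD; apply/eqP=> d2; have [X [fX dX aX]] := opt_witness dD.
have [q _ mq] : exists2 q, q \in X & 0 < m d q.
  by apply: dg_gt0; move/fatP: fX => /(_ _ dX); lia.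
have [q4 mq1] := adj2 mq d2.
have fd : lone P d.
  apply/loneP=> b; apply/negP=> /pair_facts[_ _ bD mb].
  have [_ mb1] := adj2 mb d2; have bX : b \in X by apply: fat_drop fX dX _; rewrite d2 mb1.
  by move: (aX _ bX); rewrite bD eq_sym (adj_neq mb) => /(_ isT).
have qD : q \notin D.
  apply: aX; first by apply: fat_drop fX dX _; rewrite d2 mq1.
  by rewrite eq_sym adj_neq.
case: (@opt_no_lighter (q |: D :\ d) P).
- apply/andP; split; first by apply: acyc_exch; rewrite // d2 mq1.
  exact: (@match_exch d).
- by rewrite card_exch.
- by have := weight_exch dD qD; rewrite d2 q4; lia.
Qed.

Lemma optD_deg d : d \in D -> deg d = 3 \/ deg d = 4.
Proof.
by move=> dD; have := opt_deg_gt1 dD; have := optD_deg_neq2 dD; have := deg_le m d; lia.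
Qed.

Lemma pair_deg a b : (a, b) \in P -> deg a = 3.
Proof.
case/pair_facts=> _ aD bD mab; case: (optD_deg aD) => // d4.
by move: (adj4_notinD aD d4 mab); rewrite bD.
Qed.

(** If one of them were paired elsewhere, two of its three edges would lead into [D]
    and no cycle would need it; otherwise pairing them lowers the cost. *)
Lemma adjD_paired a b : a \in D -> b \in D -> 0 < m a b -> (a, b) \in P.
Proof.
have key x y : x \in D -> y \in D -> 0 < m x y -> (x, y) \notin P -> lone P x.
  move=> xD yD mxy npxy; apply/loneP=> z; apply/negP=> pxz.
  have [_ _ zD mxz] := pair_facts pxz; have d3 := pair_deg pxz.
  have [X [fX xX aX]] := opt_witness xD.
  have nyz : y != z by apply: contraNneq npxy => ->.
  case: (@fat_drop2 X x y z fX xX nyz) => [||].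
  - by rewrite d3; lia.
  - by move=> yX; move: (aX _ yX); rewrite yD eq_sym (adj_neq mxy) => /(_ isT).
  - by move=> zX; move: (aX _ zX); rewrite zD eq_sym (adj_neq mxz) => /(_ isT).
move=> aD bD mab; apply/negPn/negP=> npab.
have npba : (b, a) \notin P by apply: contra npab => /pair_facts[].
have fa := key _ _ aD bD mab npab.
have fb : lone P b by apply: key npba; rewrite // m_sym.
case: (@opt_no_better D (addp a b P)).
  by apply/andP; split; [exact: opt_acyc | apply: matching_add => //; exact: opt_match].
by rewrite card_addp ?(adj_neq mab) //; lia.
Qed.

(** The 4-clique next to an unpaired flank would be a lighter pick. *)
Lemma lone_flank h : h \in D -> flank h -> ~~ lone P h.
Proof.
move=> hD hh; apply/negP=> fh; have d3 := flank_deg hh.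
case/flankP: hh => q [s [q4 _ mq _ _]].
have mq0 : 0 < m h q by rewrite mq.
have qD : q \notin D.
  apply/negP=> qD; move: (@adj4_notinD q h qD q4); rewrite hD m_sym mq.
  by move/(_ isT).
case: (@opt_no_lighter (q |: D :\ h) P).
- apply/andP; split; first by apply: acyc_exch; rewrite // d3 mq.
  exact: (@match_exch h).
- by rewrite card_exch.
- by have := weight_exch hD qD; rewrite d3 q4; lia.
Qed.

Lemma lone_core u : u \in D -> lone P u -> deg u = 3 -> core u.
Proof.
move=> uD fu u3; rewrite /core u3 eqxx /=; apply/negP=> /(lone_flank uD).
by rewrite fu.
Qed.

(** A flank and its 4-clique share two vertices, which is a cycle of length two. *)
Lemma flank_q h q : h \notin D -> deg h = 3 -> deg q = 4 -> 0 < m h q -> q \in D.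
Proof.
move=> hD d3 q4 mq; apply/negPn/negP=> qD; have m2 := adj34 mq d3 q4.
apply: (elimT (acycP m D) opt_acyc [set h; q] h).
- apply/fatP=> c; rewrite !inE => /orP[] /eqP ->.
    by rewrite -m2; apply: m_le_dg; rewrite !inE eqxx orbT.
  by rewrite -m2 m_sym; apply: m_le_dg; rewrite !inE eqxx.
- by move=> c; rewrite !inE => /orP[] /eqP ->.
- by rewrite !inE eqxx.
Qed.

(** A picked flank is paired with the only triangle next to it, which is [c]. *)
Lemma core_flank_notD c h : c \notin D -> core c -> flank h -> 0 < m c h -> h \notin D.
Proof.
move=> cD cc hh mch; apply/negP=> hD; have := lone_flank hD hh.
case/lonePn=> b phb; have [_ _ bD mb] := pair_facts phb.
have [q [s [q4 s3 mq ms hall]]] := flankP hh.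
have ec : c = s.
  have mhc : 0 < m h c by rewrite m_sym.
  case: (hall _ mhc) => // cq; by move: (core_deg cc); rewrite cq q4.
have eb : b = s.
  case: (hall _ mb) => // bq.
  have [pbh _ _ _] := pair_facts phb.
  by move: (pair_deg pbh); rewrite bq q4.
by rewrite ec -eb bD in cD.
Qed.

End Optimal.
End Types.

(** * Exchanges that keep a selection optimal *)

Section Exchange.
Variables (W : finType) (m : web W).
Let m_sym := web_sym m.
Let m_irr := web_irr m.
Local Notation deg := (deg m).
Local Notation dg := (dg m).
Local Notation fat := (fat m).
Local Notation flank := (flank m).
Local Notation core := (core m).
Implicit Types (D X : {set W}) (P : {set W * W}) (a c d e h q s u x y z : W).

Definition freecore D := [set c | (c \notin D) && core c].
Definition tree D (c : W) := ccomp m (freecore D) c.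
Definition flanks := [set h : W | flank h].
(** Two adjacent 4-cliques share three vertices. *)
Definition twinned d := (deg d == 4) && [exists e, (0 < m d e) && (deg e == 4)].
(** A two-element clique [x] at [d] leads to an unpicked 4-clique [q]; the edge
    between [x] and [q] will pay for [d]. *)
Definition spare D d := [exists x, exists q,
  [&& deg x == 2, 0 < m d x, 0 < m x q, q != d, q \notin D & ~~ twinned q]].
(** Picks for which no edge from a two-element clique to an unpicked 4-clique
    is at hand. *)
Definition tight D d := [&& d \in D, deg d == 4, ~~ twinned d & ~~ spare D d].

Lemma twinnedI d e : deg d = 4 -> deg e = 4 -> 0 < m d e -> twinned d.
Proof. by move=> d4 e4 mde; rewrite /twinned d4 eqxx; apply/existsP; exists e; rewrite mde e4. Qed.

Lemma freecoreP D c : reflect (c \notin D /\ core c) (c \in freecore D).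
Proof. by rewrite inE; apply: andP. Qed.

Section Opt.
Variables (D : {set W}) (P : {set W * W}).
Hypothesis oDP : opt m D P.

(** A flank next to a free core cell is free as well, so the three edges are split
    without overlap. *)
Lemma core_split c : c \in freecore D -> dg (freecore D) c + dg D c + dg flanks c = 3.
Proof.
case/freecoreP=> cD cc; rewrite -(core_deg cc) /deg (dgD m c (subsetT D)).
rewrite addnAC [in RHS]addnC; congr (_ + _).
rewrite setTD (@dgD _ m (freecore D) (~: D)) //; last first.
  by apply/subsetP=> x; rewrite !inE => /andP[].
congr (_ + _); rewrite /dg big_mkcond [in RHS]big_mkcond.
apply: eq_bigr => x _; rewrite !inE; case: (posnP (m c x)) => [->|mx].
  by case: ifP; case: ifP.
case: (boolP (core x)) => [cx|ncx].
  by case/andP: cx => _ /negPf->; rewrite andbT; case: (x \in D).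
have hx := core_nbr_flank cc mx ncx.
by rewrite hx (core_flank_notD oDP cD cc hx mx).
Qed.

Lemma tree_dg c x : x \in tree D c -> x \in freecore D -> dg (tree D c) x = dg (freecore D) x.
Proof. by move=> xt xF; rewrite /tree (comp_dg xt xF). Qed.

(** A free flank would bring in its 4-clique, which is picked by [flank_q]. *)
Lemma fat_core_nbr X y x : fat X -> (forall z, z \in X -> z \in D -> deg z != 4) ->
  core y -> x \in X -> x \notin D -> 0 < m y x -> x \in freecore D.
Proof.
move=> fX nX cy xX xD myx; apply/freecoreP; split=> //.
apply: contraT => /(core_nbr_flank cy myx) hx.
have x3 := flank_deg hx; case: (flankP hx) => q [s [q4 _ mq _ _]].
have mq0 : 0 < m x q by rewrite mq.
have qX := fat_flank fX xX x3 q4 mq0.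
have qD := flank_q oDP xD x3 q4 mq0.
by move: (nX _ qX qD); rewrite q4.
Qed.

(** Inside such a fat set a tree can be left through picks only, and a part of a
    forest sends two edges out. *)
Lemma comp_cut X c : fat X -> (forall z, z \in X -> z \in D -> deg z != 4) ->
  c \in freecore D -> c \in X -> 2 <= vol m (X :&: D) (X :&: tree D c).
Proof.
move=> fX nX cF cX; set Y := X :&: tree D c.
have sYF : Y \subset freecore D.
  by apply: subset_trans (subsetIr _ _) (comp_sub m cF).
have cY : c \in Y by rewrite inE cX mem_comp.
have sYD : Y \subset ~: D.
  by apply: subset_trans sYF _; apply/subsetP=> x; rewrite !inE => /andP[].
apply: leq_trans (fat_cut (opt_acyc oDP) fX (subsetIl X _) sYD cY) _.
rewrite (volC m (X :&: D)); apply: leq_sum => y yY.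
rewrite (@dgD _ m (X :&: D) (X :\: Y)); last first.
  apply/subsetP=> z /setIP[zX zD]; rewrite in_setD zX andbT.
  by apply/negP=> /(subsetP sYD); rewrite inE zD.
rewrite [X in _ + X <= _]dg_eq0 ?addn0 // => x.
case/setDP=> /setDP[xX h2]; rewrite in_setI xX /= => h1.
apply/eqP; rewrite -leqn0 leqNgt; apply/negP=> myx; case/negP: h2.
have yF := subsetP sYF _ yY; have [yD yc] := freecoreP _ _ yF.
have xF := fat_core_nbr fX nX yc xX h1 myx.
move: (subsetP (subsetIr _ _) _ yY) => yt.
by rewrite in_setI xX; apply: comp_closed yt yF xF myx.
Qed.

(** The cycle that needs [u] passes through a single tree, entering and leaving it
    at [u]. *)
Lemma lone_tree u : u \in D -> lone P u -> deg u = 3 ->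
  exists2 c, c \in freecore D & 2 <= dg (tree D c) u.
Proof.
move=> uD fu u3; have cu := lone_core oDP uD fu u3.
have [X [fX uX aX]] := opt_witness oDP uD.
have XD z : z \in X -> z \in D -> z = u.
  by move=> zX zD; apply/eqP; apply: contraTT zD; apply: aX.
have nX z : z \in X -> z \in D -> deg z != 4 by move=> zX /(XD _ zX) ->; rewrite u3.
have [c cX muc] : exists2 c, c \in X & 0 < m u c.
  by apply: dg_gt0; move/fatP: fX => /(_ _ uX); lia.
have cD : c \notin D.
  by apply: aX cX _; rewrite eq_sym (adj_neq muc).
have cF := fat_core_nbr fX nX cu cX cD muc; exists c => //.
apply: leq_trans (comp_cut fX nX cF cX) _.
have -> : X :&: D = [set u].
  apply/setP=> z; rewrite !inE; apply/andP/eqP=> [[zX zD]|->]; first exact: XD.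
  by rewrite uX uD.
by rewrite vol1; apply/dgS/subsetIr.
Qed.

(** Avoiding [c], the set meets the tree at one edge of [u] at most, which is not
    enough to close a cycle there; and only one edge of [u] leaves the tree. *)
Lemma bridge_fat u a c X : u \in D -> deg u = 3 -> a \in freecore D ->
  dg (tree D a) u = 2 -> c \in tree D a -> 0 < m u c ->
  fat X -> (forall x, x \in X -> x \in D -> x = u) -> c \notin X -> u \notin X.
Proof.
move=> uD u3 aF du ct muc fX XD cX; apply/negP=> uX.
have nX z : z \in X -> z \in D -> deg z != 4 by move=> zX /(XD _ zX) ->; rewrite u3.
have XDu : X :&: D = [set u].
  apply/setP=> z; rewrite !inE; apply/andP/eqP=> [[zX zD]|->]; first exact: XD.
  by rewrite uX uD.
have m1 : m u c = 1.
  apply: (adj33 muc u3); move/freecoreP: (subsetP (comp_sub m aF) _ ct).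
  by case=> _ /core_deg.
have le1 : dg (X :&: tree D a) u <= 1.
  move: du; rewrite (dgD1 m u ct) m1 => -[<-]; apply: dgS.
  apply/subsetP=> y; rewrite !inE => /andP[yX ->]; rewrite andbT.
  by apply: contraNneq cX => <-.
case: (set_0Vmem (X :&: tree D a)) => [Y0|[y yY]].
  have := dgID m (tree D a) X u; rewrite Y0 dg0 add0n => e.
  have : dg (X :\: tree D a) u <= dg (setT :\: tree D a) u by apply/dgS/setSD/subsetT.
  have := dgD m u (subsetT (tree D a)); rewrite -/(deg u) u3 du -e.
  by move/fatP: fX => /(_ _ uX); lia.
have [yX yt] : y \in X /\ y \in tree D a by move: yY; rewrite inE => /andP[].
have yF := subsetP (comp_sub m aF) _ yt.
have := comp_cut fX nX yF yX; rewrite XDu vol1 /tree (comp_eq yt).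
by rewrite leqNgt ltnS le1.
Qed.

Lemma opt_same D' P' : valid m D' P' -> #|D'| = #|D| -> #|P'| = #|P| -> weight m D' = weight m D ->
  opt m D' P'.
Proof.
move=> v cD cP e2; split=> // D2 P2 v2; have [h1 h2] := oDP.2 _ _ v2.
by rewrite cD cP e2; split.
Qed.

(** All cycles through [u] that meet no other pick use both edges between [u] and its
    tree, so the pick can move to the end of either. A pick [u] with exactly two
    edges to a tree is called movable below. *)
Lemma opt_exch u a c : u \in D -> lone P u -> deg u = 3 -> a \in freecore D ->
  dg (tree D a) u = 2 -> c \in tree D a -> 0 < m u c -> opt m (c |: D :\ u) P.
Proof.
move=> uD fu u3 aF du ct muc; have cF := subsetP (comp_sub m aF) _ ct.
have [cD cc] := freecoreP _ _ cF; have c3 := core_deg cc.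
apply: opt_same => //; last first.
- by have := weight_exch m uD cD; rewrite u3 c3; lia.
- exact: card_exch.
apply/andP; split; last exact: (match_exch oDP c fu (subxx _)).
apply/acycP=> X x fX aX xX.
have XD z : z \in X -> z \in D -> z = u.
  by move=> /aX; rewrite !inE => /norP[_]; rewrite negb_and negbK => /orP[/eqP|/negP].
have cX : c \notin X by apply/negP=> /aX; rewrite !inE eqxx.
have uX := bridge_fat uD u3 aF du ct muc fX XD cX.
apply: (elimT (acycP m D) (opt_acyc oDP) X x) => // y yX; apply/negP=> yD.
by move: uX; rewrite -(XD _ yX yD) yX.
Qed.

(** Moving the pick to [c] would make a new pair. *)
Lemma bridge_alone u a c d : u \in D -> lone P u -> deg u = 3 -> a \in freecore D ->
  dg (tree D a) u = 2 -> c \in tree D a -> 0 < m u c -> d \in D -> 0 < m c d -> d = u.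
Proof.
move=> uD fu u3 aF du ct muc dD mcd; apply/eqP; apply/negPn/negP=> ndu.
have oD' := opt_exch uD fu u3 aF du ct muc.
have : (c, d) \in P.
  apply: (adjD_paired oD') => //; rewrite !inE ?eqxx //.
  by rewrite ndu dD orbT.
case/(pair_facts oDP) => _ cD _ _.
by case/freecoreP: (subsetP (comp_sub m aF) _ ct); rewrite cD.
Qed.

Lemma tightP d : tight D d -> [/\ d \in D, deg d = 4, ~~ twinned d & ~~ spare D d].
Proof. by case/and4P=> ? /eqP ? ? ?. Qed.

(** The cycle leaves [x] through its second neighbour, which is a 4-clique. If it
    were free, it would be twinned, and its twin would form a 2-cycle with it. *)
Lemma tight_dual d x X : tight D d -> deg x = 2 -> 0 < m d x -> fat X -> x \in X ->
  (forall z, z \in X -> z \in D -> ~~ twinned z) ->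
  exists q, [/\ q \in X, q \in D, q != d, 0 < m x q & deg q = 4].
Proof.
case/tightP=> dD d4 nk ns x2 mdx fX xX hX.
have mxd : 0 < m x d by rewrite m_sym.
have [_ mxd1] := adj2 mxd x2.
have [q nqd mxq] : exists2 q, q != d & 0 < m x q by apply: nbr_more; rewrite mxd1 x2.
have [q4 mxq1] := adj2 mxq x2.
have qX : q \in X by apply: fat_drop fX xX _; rewrite x2 mxq1.
exists q; split=> //; apply/negPn/negP=> qD.
have kq : twinned q.
  apply: contraR ns => nkq; apply/existsP; exists x; apply/existsP; exists q.
  by rewrite x2 mdx mxq nqd qD nkq.
case/andP: (kq) => _ /existsP[e /andP[mqe /eqP e4]].
have m3 : m q e = 3 by have := adj4 mqe q4; rewrite e4; lia.
have eX : e \in X by apply: fat_drop fX qX _; rewrite q4 m3.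
have eD : e \notin D.
  by apply/negP=> /(hX _ eX); rewrite (@twinnedI e q) // web_sym.
apply: (elimT (acycP m D) (opt_acyc oDP) [set q; e] q).
- apply/fatP=> c; rewrite !inE => /orP[] /eqP ->.
    by apply: leq_trans (_ : m q e <= _); [rewrite m3 | rewrite m_le_dg ?set22].
  by apply: leq_trans (_ : m e q <= _); [rewrite web_sym m3 | rewrite m_le_dg ?set21].
- by move=> c; rewrite !inE => /orP[] /eqP ->.
- exact: set21.
Qed.

Lemma adj4_type d x : deg d = 4 -> ~~ twinned d -> 0 < m d x -> flank x \/ deg x = 2 /\ m d x = 1.
Proof.
move=> d4 nk mdx; have e := adj4 mdx d4.
have x4 : deg x != 4 by apply: contra nk => /eqP x4; apply: (@twinnedI d x).
have le := deg_le m x; case: (eqVneq (deg x) 3) => [x3|x3].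
  by left; apply: (flankI x3 d4); rewrite m_sym.
by right; split; lia.
Qed.

(** A cycle that needs [d] and leaves it through a two-element clique would meet
    another pick. *)
Lemma tight_flank d : tight D d -> exists2 h, flank h & 0 < m d h.
Proof.
move=> td; have [dD d4 nk ns] := tightP td.
have [X [fX dX aX]] := opt_witness oDP dD.
have [x xX mdx] : exists2 x, x \in X & 0 < m d x.
  by apply: dg_gt0; move/fatP: fX => /(_ _ dX); lia.
case: (adj4_type d4 nk mdx) => [hx|[x2 _]]; first by exists x.
have [|q [qX qD nqd _ _]] := tight_dual td x2 mdx fX xX.
  by move=> z zX zD; case: (eqVneq z d) => [->//|/(aX _ zX)]; rewrite zD.
by move: (aX _ qX nqd); rewrite qD.
Qed.

(** The flank is then unavoidable on the cycles that need [d]. *)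
Definition oneflank d h :=
  [/\ tight D d, flank h, 0 < m d h & forall x, flank x -> 0 < m d x -> x = h].

Lemma oneflank_in d h X : oneflank d h -> fat X -> d \in X -> h \notin X ->
  exists x y, [/\ x \in X, y \in X, x != y, deg x = 2 /\ m d x = 1 & deg y = 2 /\ m d y = 1].
Proof.
case=> td hh mdh uh fX dX hX; have [dD d4 nk ns] := tightP td.
have tp z : z \in X -> 0 < m d z -> deg z = 2 /\ m d z = 1.
  move=> zX mdz; case: (adj4_type d4 nk mdz) => // hz.
  by rewrite -(uh _ hz mdz) zX in hX.
have [|x [y [xX yX nxy mx my]]] := @dg_gt1 _ m X d _ (elimT (fatP m X) fX _ dX).
  by move=> z zX; case: (posnP (m d z)) => [->//|/(tp _ zX)[_ ->]].
by exists x, y; split=> //; apply: tp => //; rewrite ?mx ?my.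
Qed.

Lemma oneflank_out d h X : oneflank d h -> fat X -> h \notin X ->
  (forall z, z \in X -> z \in D -> z = d \/ deg z = 3) -> d \notin X.
Proof.
move=> tp fX hX XD; apply/negP=> dX; have [td _ _ _] := tp.
have [x [y [xX yX nxy [x2 mx] _]]] := oneflank_in tp fX dX hX.
have [dD d4 nk ns] := tightP td.
have mx0 : 0 < m d x by rewrite mx.
have [|q [qX qD nqd _ q4]] := tight_dual td x2 mx0 fX xX.
  move=> z zX zD; case: (XD _ zX zD) => [->//|z3].
  by rewrite /twinned z3.
by case: (XD _ qX qD) => [qd|]; [rewrite qd eqxx in nqd | rewrite q4].
Qed.

Lemma tight_lone d : tight D d -> lone P d.
Proof.
case/tightP=> dD d4 _ _; apply/loneP=> b; apply/negP=> pdb.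
by move: (pair_deg oDP pdb); rewrite d4.
Qed.

(** If [s] were paired, it would keep two edges outside [D], one of which leads to
    the flank of another pick, so no cycle would need [s]. *)
Lemma flank_lone_nbr d h s : d \in D -> deg d = 4 -> deg h = 3 -> 0 < m h d ->
  s \in D -> deg s = 3 -> 0 < m h s -> lone P s.
Proof.
move=> dD d4 h3 mhd sD s3 mhs; apply/loneP=> b; apply/negP=> psb.
have [_ _ bD msb] := pair_facts oDP psb.
have [X [fX sX aX]] := opt_witness oDP sD.
have mdh : 0 < m d h by rewrite m_sym.
have hD := adj4_notinD oDP dD d4 mdh.
have nhb : h != b by apply: contraNneq hD => ->.
case: (fat_drop2 fX sX nhb) => [||bX].
- by rewrite s3 m_sym; lia.
- move=> hX; have dX := fat_flank fX hX h3 d4 mhd.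
  have : d != s by apply/eqP=> ds; rewrite ds s3 in d4.
  by move/(aX _ dX); rewrite dD.
- by move: (aX _ bX); rewrite bD eq_sym (adj_neq msb) => /(_ isT).
Qed.

(** Otherwise the flank, which lies between [d] and [s], could replace [d] as a pick
    and be paired with [s]. *)
Lemma oneflank_end d h s : oneflank d h -> deg s = 3 -> 0 < m h s -> s \in D -> False.
Proof.
move=> tp s3 mhs sD; have [td hh mdh uh] := tp; have [dD d4 nk ns] := tightP td.
have h3 := flank_deg hh; have mhd : 0 < m h d by rewrite m_sym.
have hD := adj4_notinD oDP dD d4 mdh.
have ls := flank_lone_nbr dD d4 h3 mhd sD s3 mhs.
have nhs := adj_neq mhs.
have lh : lone P h by apply/loneP=> b; apply/negP=> /(pair_facts oDP)[_]; rewrite (negPf hD).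
have nsd : s != d by apply/eqP=> sd; rewrite sd d4 in s3.
case: (opt_no_better oDP (D' := h |: D :\ d) (P' := addp h s P)); last first.
  by rewrite card_exch // card_addp //; lia.
apply/andP; split; last first.
  apply: matching_add => //.
  - exact: (match_exch oDP h (tight_lone td) (subxx _)).
  - by rewrite !inE eqxx.
  - by rewrite !inE nsd sD orbT.
apply/acycP=> X x fX aX xX.
have XD z : z \in X -> z \in D -> z = d.
  by move=> /aX; rewrite !inE => /norP[_]; rewrite negb_and negbK => /orP[/eqP|/negP].
have hX : h \notin X by apply/negP=> /aX; rewrite !inE eqxx.
have dX : d \notin X by apply: oneflank_out tp fX hX _ => z zX /(XD _ zX); left.
apply: (elimT (acycP m D) (opt_acyc oDP) X x) => // y yX; apply/negP=> yD.
by move: dX; rewrite -(XD _ yX yD) yX.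
Qed.

End Opt.

Lemma spare_exch D u c d : deg u = 3 -> deg c = 3 ->
  spare (c |: D :\ u) d = spare D d.
Proof.
move=> u3 c3; apply: eq_existsb => x; apply: eq_existsb => q.
case: (eqVneq (deg x) 2) => //= x2; case: (posnP (m d x)) => //= mdx.
case: (posnP (m x q)) => //= mxq.
have [q4 _] := adj2 mxq x2.
have nqu : q != u by apply/eqP=> e; rewrite e u3 in q4.
have nqc : q != c by apply/eqP=> e; rewrite e c3 in q4.
by rewrite !inE (negPf nqu) (negPf nqc).
Qed.

(** Exchanging triangles does not affect the notions about 4-cliques. *)
Lemma tight_exch D u c d : deg u = 3 -> deg c = 3 -> tight D d ->
  tight (c |: D :\ u) d.
Proof.
move=> u3 c3 /tightP[dD d4 nk ns]; rewrite /tight spare_exch // nk ns d4 !inE dD.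
have -> : d != u by apply/eqP=> e; rewrite e u3 in d4.
by rewrite orbT.
Qed.

Section Opt2.
Variables (D : {set W}) (P : {set W * W}).
Hypothesis oDP : opt m D P.

(** Otherwise the pick could move to [c], the far end of the flank. *)
Lemma bridge_oneflank u a c d h : u \in D -> lone P u -> deg u = 3 -> a \in freecore D ->
  dg (tree D a) u = 2 -> c \in tree D a -> 0 < m u c ->
  oneflank D d h -> 0 < m h c -> False.
Proof.
move=> uD fu u3 aF du ct muc [td hh mdh uh] mhc.
have [cD cc] := freecoreP _ _ (subsetP (comp_sub m aF) _ ct); have c3 := core_deg cc.
have oD' := opt_exch oDP uD fu u3 aF du ct muc.
apply: (oneflank_end oD' (d := d) (h := h) (s := c)) => //; last by rewrite !inE eqxx.
by split=> //; apply: tight_exch.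
Qed.

End Opt2.
End Exchange.

(** * Trees of free core cells *)

Section Trees.
Variables (W : finType) (m : web W).
Let m_sym := web_sym m.
Let m_irr := web_irr m.
Local Notation deg := (deg m).
Local Notation dg := (dg m).
Local Notation fat := (fat m).
Local Notation vol := (vol m).
Local Notation flank := (flank m).
Local Notation core := (core m).
Local Notation freecore := (freecore m).
Local Notation tree := (tree m).
Local Notation flanks := (flanks m).
Local Notation tight := (tight m).
Local Notation oneflank := (oneflank m).
Implicit Types (D X : {set W}) (P : {set W * W}) (a c d e h q s u x y z : W).

Section Link.
Variables (D : {set W}) (P : {set W * W}).
Hypothesis oDP : opt m D P.

Lemma tree_sub a : a \in freecore D -> tree D a \subset freecore D.
Proof. exact: comp_sub. Qed.

Lemma tree_core a c : a \in freecore D -> c \in tree D a -> c \notin D /\ core c.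
Proof. by move=> aF ct; apply/freecoreP/(subsetP (tree_sub aF)). Qed.

(** Otherwise the two flanks could replace the two 4-cliques as picks and be paired.
    The obstacle is a cycle through both 4-cliques, which uses two two-element cliques
    at each. *)
Lemma oneflank_link d h d1 h1 : oneflank D d h -> oneflank D d1 h1 -> d != d1 -> 0 < m h h1 ->
  exists x y, [/\ x != y, deg x = 2, deg y = 2, m d x = 1 /\ m d y = 1 &
    m d1 x = 1 /\ m d1 y = 1].
Proof.
move=> tp tp1 ndd mhh; have [td hh mdh uh] := tp; have [td1 hh1 mdh1 uh1] := tp1.
have [dD d4 nk ns] := tightP td; have [d1D d14 nk1 ns1] := tightP td1.
have hD := adj4_notinD oDP dD d4 mdh; have h1D := adj4_notinD oDP d1D d14 mdh1.
have nhh := adj_neq mhh.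
have lh : lone P h by apply/loneP=> b; apply/negP=> /(pair_facts oDP)[_]; rewrite (negPf hD).
have lh1 : lone P h1 by apply/loneP=> b; apply/negP=> /(pair_facts oDP)[_]; rewrite (negPf h1D).
pose D' := h |: (h1 |: D :\ d :\ d1).
have cD' : #|D'| = #|D|.
  rewrite !cardsU1 !inE (negPf hD) (negPf h1D) !andbF (negPf nhh) /=.
  by rewrite (cardsD1 d D) dD (cardsD1 d1 (D :\ d)) !inE eq_sym ndd d1D.
case: (boolP (acyc m D')) => [ac|].
  case: (opt_no_better oDP (D' := D') (P' := addp h h1 P)); last first.
    by rewrite cD' (card_addp nhh lh lh1) ltn_add2l addn2.
  apply/andP; split=> //; apply: matching_add => //; try by rewrite !inE eqxx ?orbT.
  apply: matching_sub (opt_match oDP) _ => c cD; rewrite !inE cD andbT !negb_or.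
  case/and3P=> _ _; rewrite negb_and !negbK => /orP[] /eqP ->.
    exact: (tight_lone oDP td1).
  exact: (tight_lone oDP td).
case/acycPn=> X [c [fX cX aX]].
have XD z : z \in X -> z \in D -> z = d \/ z = d1.
  move=> /aX + zD; rewrite !inE zD andbT !negb_or => /and3P[_ _].
  by rewrite negb_and !negbK => /orP[/eqP|/eqP]; [right|left].
have hX : h \notin X by apply/negP=> /aX; rewrite !inE eqxx.
have h1X : h1 \notin X by apply/negP=> /aX; rewrite !inE eqxx orbT.
have nkX z : z \in X -> z \in D -> ~~ twinned m z by move=> zX zD; case: (XD _ zX zD) => ->.
have key e h0 f : oneflank D e h0 -> (forall z, z \in X -> z \in D -> z = e \/ z = f) ->
    e \in X -> h0 \notin X ->
    exists x y, [/\ x != y, deg x = 2, deg y = 2, m e x = 1 /\ m e y = 1 &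
      m f x = 1 /\ m f y = 1].
  move=> tpe XDe eX h0X; have [te _ _ _] := tpe.
  have [x [y [xX yX nxy [x2 mx] [y2 my]]]] := oneflank_in tpe fX eX h0X.
  have tw z : z \in X -> deg z = 2 -> m e z = 1 -> m f z = 1.
    move=> zX z2 mz; have mz0 : 0 < m e z by rewrite mz.
    have [q [qX qD nqe mzq q4]] := tight_dual oDP te z2 mz0 fX zX nkX.
    case: (XDe _ qX qD) => [qe|qf]; first by rewrite qe eqxx in nqe.
    by have [_] := adj2 mzq z2; rewrite qf m_sym.
  by exists x, y; split=> //; split; apply: tw.
case: (boolP (d \in X)) => [dX|ndX]; first exact: key tp XD dX hX.
case: (boolP (d1 \in X)) => [d1X|nd1X].
  have [z zX zD|x [y [nxy x2 y2 [mx my] [mx1 my1]]]] := key _ _ d tp1 _ d1X h1X.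
    by case: (XD _ zX zD); [right|left].
  by exists x, y; split.
exfalso; apply: (elimT (acycP m D) (opt_acyc oDP) X c) => // z zX; apply/negP=> zD.
by case: (XD _ zX zD) => e; rewrite e in zX; rewrite zX in ndX nd1X.
Qed.

Lemma tree_vol a : a \in freecore D -> vol (tree D a) (tree D a) + 2 = 2 * #|tree D a|.
Proof.
move=> aF; apply/eqP; rewrite eqn_leq comp_vol andbT.
apply: (@forest_vol _ m (~: D) _ a (opt_acyc oDP)); last exact: mem_comp.
by apply/subsetP=> x /(tree_core aF)[xD _]; rewrite inE.
Qed.

Lemma tree_split a c : a \in freecore D -> c \in tree D a ->
  dg (tree D a) c + dg D c + dg flanks c = 3.
Proof.
move=> aF ct; have cF := subsetP (tree_sub aF) _ ct.
by rewrite (tree_dg ct cF); apply: core_split oDP _ cF.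
Qed.

Lemma flank_dg_le1 a h : a \in freecore D -> flank h -> dg (tree D a) h <= 1.
Proof.
move=> aF hh; case/flankP: (hh) => q [s [q4 _ mq _ _]].
have qt : q \notin tree D a.
  by apply/negP=> /(tree_core aF)[_ /core_deg]; rewrite q4.
by have := dg_out m h qt; rewrite -/(deg h) (flank_deg hh) mq; lia.
Qed.

End Link.
End Trees.

(** * Dividing a tree *)

Section TreeBound.
Variables (W : finType) (m : web W).
Let m_sym := web_sym m.
Let m_irr := web_irr m.
Local Notation deg := (deg m).
Local Notation dg := (dg m).
Local Notation fat := (fat m).
Local Notation vol := (vol m).
Local Notation flank := (flank m).
Local Notation core := (core m).
Local Notation freecore := (freecore m).
Local Notation tree := (tree m).
Local Notation flanks := (flanks m).
Local Notation tight := (tight m).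
Local Notation oneflank := (oneflank m).
Implicit Types (D X : {set W}) (P : {set W * W}) (a c d e h q s u x y z : W).

Section Opt.
Variables (D : {set W}) (P : {set W * W}).
Hypothesis oDP : opt m D P.

Section Tree.
Variable a : W.
Hypothesis aF : a \in freecore D.
Local Notation T := (tree D a).

Lemma tree_dg_gt0 c : 1 < #|T| -> c \in T -> 0 < dg T c.
Proof.
move=> t1 ct; rewrite lt0n; apply/negP=> /eqP d0.
have : T \subset [set c].
  rewrite /tree -(comp_eq ct); apply: comp_ind; rewrite ?inE // => x y.
  rewrite inE => /eqP-> cF yF mcy; have yt := comp_closed ct cF yF mcy.
  by have := m_le_dg m c yt; rewrite -/(tree D a) d0 leqNgt mcy.
by move/subset_leq_card; rewrite cards1 leqNgt t1.
Qed.

(** Average degree below two and no isolated cell. *)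
Lemma two_leaves : 1 < #|T| -> exists c1 c2,
  [/\ c1 \in T, c2 \in T, c1 != c2, dg T c1 <= 1 & dg T c2 <= 1].
Proof.
move=> t1; pose L := [set c in T | dg T c <= 1].
case: (ltnP 1 #|L|) => [|le1].
  by case/card_gt1P=> c1 [c2 [/setIdP[t1' l1] /setIdP[t2 l2] n12]]; exists c1, c2; split.
have : \sum_(c in T) (2 - (c \in L)) <= vol T T.
  apply: leq_sum => c ct; have h := tree_dg_gt0 t1 ct.
  by rewrite in_set ct /=; case: (leqP (dg T c) 1) => h1; rewrite ?subn1 ?subn0.
have e : \sum_(c in T) (2 - (c \in L)) + #|L| = 2 * #|T|.
  have -> : #|L| = \sum_(c in T) (c \in L).
    rewrite -sum1_card [RHS]big_mkcond [LHS]big_mkcond; apply: eq_bigr => c _.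
    by rewrite in_set; case: (c \in T); case: (dg T c <= 1).
  rewrite -big_split /= mulnC -sum_nat_const; apply: eq_bigr => c _.
  by case: (c \in L).
have := tree_vol oDP aF; lia_num.
Qed.

Lemma core_no_loop x c : c \in T -> m x c <= 1.
Proof. by move=> /(tree_core aF)[_ cc]; rewrite m_sym core_le1. Qed.

(** Moving the pick [u] to [p] splits the tree. Then [a1] becomes movable to the leaf
    it meets in one of the pieces, where [a2] is a second pick, against
    [bridge_alone]. *)
Lemma tree_divide u p a1 a2 :
  (forall c, c \in T -> dg flanks c = 0) ->
  u \in D -> lone P u -> deg u = 3 -> dg T u = 2 -> p \in T -> 0 < m u p ->
  a1 \in D -> lone P a1 -> deg a1 = 3 -> dg T a1 = 3 ->
  a2 \in D -> dg T a2 = 3 -> a1 != a2 ->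
  (forall c, c \in T -> dg T c <= 1 -> 0 < m a1 c /\ 0 < m a2 c) -> False.
Proof.
move=> port0 uD lu u3 du pt mup a1D la1 a13 da1 a2D da2 naa leaves.
have [pD pc] := tree_core aF pt; have p3 := core_deg pc.
have uc := lone_core oDP uD lu u3.
have mup1 : m u p = 1 by apply: adj33.
have oD1 := opt_exch oDP uD lu u3 aF du pt mup.
have alone d : d \in D -> 0 < m p d -> d = u.
  exact: (bridge_alone oDP uD lu u3 aF du pt mup).
have na1u : a1 != u by apply/eqP=> e; rewrite e du in da1.
have na2u : a2 != u by apply/eqP=> e; rewrite e du in da2.
pose D1 := p |: D :\ u; rewrite -/D1 in oD1.
have dDp : dg D p = 1.
  rewrite (dgD1 m p uD) m_sym mup1 dg_eq0 // => x; rewrite !inE => /andP[nxu xD].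
  by case: (posnP (m p x)) => // /(alone _ xD) e; rewrite e eqxx in nxu.
have dTp : dg T p = 2.
  by have := tree_split oDP aF pt; rewrite (port0 _ pt) dDp addn0 addn1 => -[].
have [|g1 [g2 [g1t g2t ng mg1 mg2]]] := @dg_gt1 _ m T p _ (eq_leq (esym dTp)).
  by move=> x xt; rewrite m_sym; apply: core_no_loop.
pose T' := T :\ p.
have gT' g : g \in T -> m p g = 1 -> g \in T'.
  by move=> gt mg; rewrite in_setD1 gt andbT; apply/eqP=> e; rewrite e m_irr in mg.
have T'D x : x \in T' -> x \notin D.
  by rewrite inE => /andP[_ /(tree_core aF)[]].
(* each piece contains a leaf of the whole tree *)
have leaf g g' : g \in T -> m p g = 1 -> g' \in T -> m p g' = 1 ->
    g' \notin ccomp m T' g -> exists2 c, c \in ccomp m T' g & dg T c <= 1.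
  move=> gt mg gt' mg' ng'; set Y := ccomp m T' g in ng' *.
  have sYT' : Y \subset T' := comp_sub m (gT' _ gt mg).
  have pY : p \notin Y by apply/negP=> /(subsetP sYT'); rewrite in_setD1 eqxx.
  case: (boolP [exists c in Y, dg T c <= 1]) => [/exists_inP[c cY lc]|].
    by exists c.
  rewrite negb_exists_in => /forall_inP h; exfalso.
  have v1 : 2 * #|Y| <= vol Y T by apply: vol_ge => y /h; rewrite -ltnNge.
  have v2 : vol Y T <= vol Y Y + dg Y p.
    have -> : dg Y p = \sum_(y in Y) m y p by apply: eq_bigr => y _; rewrite m_sym.
    rewrite /vol -big_split; apply: leq_sum => y yY /=.
    have yT' := subsetP sYT' _ yY.
    rewrite (dgD1 m y pt) addnC leq_add2r -/T' (dgID m Y T' y).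
    rewrite [X in _ + X]dg_eq0 ?addn0; first by apply/dgS/subsetIr.
    move=> x /setDP[xT' xY]; case: (posnP (m y x)) => // myx.
    by case/negP: xY; apply: comp_closed yY yT' xT' myx.
  have v3 : dg Y p <= 1.
    have : dg (g' |: Y) p <= dg T p.
      apply: dgS; rewrite subUset sub1set gt' /=; apply: subset_trans sYT' _.
      exact: subsetDl.
    by rewrite dgU1 // mg' dTp; lia_num.
  have : vol Y Y + 2 <= 2 * #|Y|.
    apply: (@forest_vol _ m (~: D) _ g (opt_acyc oDP)); last exact: mem_comp.
    by apply/subsetP=> x /(subsetP sYT')/T'D; rewrite inE.
  by move: v1 v2 v3; lia_num.
have sep : g2 \notin ccomp m T' g1.
  apply/negP=> g2Y; set Y := ccomp m T' g1 in g2Y.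
  have sYT' : Y \subset T' := comp_sub m (gT' _ g1t mg1).
  have pY : p \notin Y by apply/negP=> /(subsetP sYT'); rewrite in_setD1 eqxx.
  have v1 := comp_vol m T' g1; rewrite -/Y in v1.
  have v2 : vol (p |: Y) (p |: Y) + 2 <= 2 * #|p |: Y|.
    apply: (@forest_vol _ m (~: D) _ p (opt_acyc oDP)); last by rewrite setU11.
    apply/subsetP=> x /setU1P[->|xY]; rewrite in_setC //.
    exact: T'D (subsetP sYT' _ xY).
  have v3 : 2 <= dg Y p.
    have := m2_le_dg m p (mem_comp m T' g1) g2Y ng; by rewrite mg1 mg2.
  by move: v2; rewrite volUU1 // cardsU1 pY; move: v1 v3; lia_num.
have sep' : g1 \notin ccomp m T' g2.
  by apply: contra sep => g1Y; rewrite (comp_eq g1Y) mem_comp.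
(* the piece not containing the other neighbour of [u] becomes a component *)
have core_fin g g' : g \in T -> m p g = 1 -> g' \in T -> m p g' = 1 ->
    g' \notin ccomp m T' g -> g \notin ccomp m T' g' -> dg (ccomp m T' g) u = 0 -> False.
  move=> gt mg gt' mg' ng1 ng2 du0; set Y := ccomp m T' g in ng1 du0.
  have sYT' : Y \subset T' := comp_sub m (gT' _ gt mg).
  have [l1 l1Y l1le] := leaf _ _ gt mg gt' mg' ng1.
  have [l2 l2Y' l2le] := leaf _ _ gt' mg' gt mg ng2.
  have sY'T' : ccomp m T' g' \subset T' := comp_sub m (gT' _ gt' mg').
  have l1T' := subsetP sYT' _ l1Y; have l2T' := subsetP sY'T' _ l2Y'.
  have l1t : l1 \in T by move: l1T'; rewrite inE => /andP[].
  have l2t : l2 \in T by move: l2T'; rewrite inE => /andP[].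
  have l2Y : l2 \notin Y.
    by apply: contra ng1 => l2Y; rewrite /Y -(comp_eq l2Y) (comp_eq l2Y') mem_comp.
  have nl : l1 != l2 by apply: contraNneq l2Y => <-.
  have [m11 m21] := leaves _ l1t l1le; have [m12 m22] := leaves _ l2t l2le.
  have closed x : x \in Y -> ccomp m (freecore D1) x \subset Y.
    move=> xY; apply: comp_ind => // y z yY yF zF myz.
    have yT' := subsetP sYT' _ yY.
    have nzu : z != u.
      apply/eqP=> zu; subst z; move: myz; rewrite m_sym.
      by have := m_le_dg m u yY; rewrite du0 leqn0 => /eqP->.
    have [zD1 zc] := freecoreP _ _ _ zF.
    have zF' : z \in freecore D.
      by apply/freecoreP; split=> //; move: zD1; rewrite !inE nzu negb_or => /andP[].
    have yt : y \in T by move: yT'; rewrite inE => /andP[].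
    have yF' := subsetP (tree_sub aF) _ yt.
    have zt : z \in T by apply: comp_closed yt yF' zF' myz.
    apply: (comp_closed yY yT' _ myz); rewrite in_setD1 zt andbT.
    by move: zD1; rewrite in_setU1 negb_or => /andP[].
  have a1D1 : a1 \in D1 by rewrite !inE na1u a1D orbT.
  have a2D1 : a2 \in D1 by rewrite !inE na2u a2D orbT.
  have [c' c'F dc'] := lone_tree oD1 a1D1 la1 a13.
  set Z := tree D1 c' in dc'.
  have adj1 l : l \in T -> 0 < m a1 l -> m a1 l = 1.
    by move=> lt ml; apply: adj33 ml a13 _; case: (tree_core aF lt) => _ /core_deg.
  have one : l1 \in Z \/ l2 \in Z.
    case: (boolP (l1 \in Z)); first by left.
    case: (boolP (l2 \in Z)); first by right.
    move=> n2 n1; have := dg_out2 m a1 n1 n2 nl.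
    by rewrite -/(deg a1) a13 (adj1 _ l1t m11) (adj1 _ l2t m12); lia_num.
  have notboth : ~ (l1 \in Z /\ l2 \in Z).
    case=> z1 z2; case/negP: l2Y; apply: (subsetP (closed _ l1Y)).
    by rewrite /Z in z1 z2; rewrite (comp_eq z1).
  have dZ : dg Z a1 = 2.
    apply/eqP; rewrite eqn_leq dc' andbT.
    case: one => z1.
      have z2 : l2 \notin Z by apply/negP=> z2; apply: notboth.
      by have := dg_out m a1 z2; rewrite -/(deg a1) a13 (adj1 _ l2t m12); lia_num.
    have z2 : l1 \notin Z by apply/negP=> z2; apply: notboth.
    by have := dg_out m a1 z2; rewrite -/(deg a1) a13 (adj1 _ l1t m11); lia_num.
  case: one => z.
    have e := bridge_alone oD1 a1D1 la1 a13 c'F dZ z m11 a2D1.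
    by move: naa; rewrite e ?eqxx // m_sym.
  have e := bridge_alone oD1 a1D1 la1 a13 c'F dZ z m12 a2D1.
  by move: naa; rewrite e ?eqxx // m_sym.
have dT'u : dg T' u = 1.
  by move: du; rewrite (dgD1 m u pt) mup1 => -[].
case: (posnP (dg (ccomp m T' g1) u)) => [d0|d1].
  exact: (core_fin g1 g2).
case: (posnP (dg (ccomp m T' g2) u)) => [d0|d2].
  exact: (core_fin g2 g1).
have : dg (ccomp m T' g1 :|: ccomp m T' g2) u <= dg T' u.
  by apply: dgS; rewrite subUset !comp_sub ?gT'.
rewrite dgU ?dT'u; first by move: d1 d2; lia_num.
rewrite -setI_eq0; apply/eqP/setP=> x; rewrite in_setI in_set0.
apply/negP=> /andP[x1 x2]; case/negP: sep.
by rewrite -(comp_eq x1) (comp_eq x2) mem_comp.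
Qed.

End Tree.
End Opt.
End TreeBound.

(** * The balance of one tree *)

Section Excess.
Variables (W : finType) (m : web W).
Let m_sym := web_sym m.
Let m_irr := web_irr m.
Local Notation deg := (deg m).
Local Notation dg := (dg m).
Local Notation vol := (vol m).
Local Notation flank := (flank m).
Local Notation core := (core m).
Local Notation freecore := (freecore m).
Local Notation tree := (tree m).
Local Notation flanks := (flanks m).
Local Notation tight := (tight m).
Local Notation oneflank := (oneflank m).
Implicit Types (D X : {set W}) (P : {set W * W}) (a c d e h q s u x y z : W).

(** The configurations that [reduced] removes are absent: [d] is a 4-clique with two
    flanks, and [s], [s'] are the far ends of these. *)
Definition irreducible := forall d h h' s s', deg d = 4 -> flank h -> flank h' -> h != h' ->
  0 < m d h -> 0 < m d h' -> s != d -> s' != d -> 0 < m h s -> 0 < m h' s' ->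
  [\/ s = s', 0 < m s s' | s = h'].

Definition lone3 D P := [set u in D | lone P u && (deg u == 3)].
(** Flanks next to the tree of [a]; each of them can pay for one 4-clique. *)
Definition ports D a := [set h | flank h && (0 < dg (tree D a) h)].
Definition paid D a := [set d | tight D d && [exists h in ports D a, 0 < m d h]].
(** Unpaired triangles for which the tree of [a] pays: by [lone_tree] each of them
    is served by some tree. *)
Definition served D P a := [set u in lone3 D P | 2 <= dg (tree D a) u].

Lemma flank_quartic h d e : flank h -> deg d = 4 -> 0 < m d h -> deg e = 4 -> 0 < m e h -> d = e.
Proof.
case/flankP=> q [s [q4 s3 _ _ hall]] d4 mdh e4 meh.
have key z : deg z = 4 -> 0 < m z h -> z = q.
  by move=> z4; rewrite m_sym => /hall[//|zs]; rewrite zs s3 in z4.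
by rewrite (key d) // (key e).
Qed.

Lemma flank_far h q x y : flank h -> deg q = 4 -> 0 < m q h -> 0 < m h x -> x != q ->
  0 < m h y -> y != q -> x = y.
Proof.
move=> hh q4 mqh mx nx my ny; case: (flankP hh) => q' [s [q'4 _ mq' _ hall]].
have e : q = q' by apply: flank_quartic hh q4 mqh q'4 _; rewrite m_sym mq'.
rewrite -e in hall.
by case: (hall _ mx) => ex; case: (hall _ my) => ey; rewrite ex ey // in nx ny *;
  rewrite eqxx in nx ny.
Qed.

Section Opt.
Variables (D : {set W}) (P : {set W * W}).
Hypothesis oDP : opt m D P.
Hypothesis minflanked : forall D' P', opt m D' P' -> flanked m D <= flanked m D'.
Hypothesis irr : irreducible.

Lemma lone3P u : u \in lone3 D P -> [/\ u \in D, lone P u & deg u = 3].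
Proof. by rewrite in_set => /and3P[? ? /eqP]. Qed.

Section Tree.
Variable a : W.
Hypothesis aF : a \in freecore D.
Local Notation T := (tree D a).

Lemma servedP u : u \in served D P a -> [/\ u \in D, lone P u, deg u = 3 & 2 <= dg T u].
Proof. by case/setIdP=> /lone3P[]. Qed.

Lemma ports_card : vol T flanks = #|ports D a|.
Proof.
rewrite volC -sum1_card [RHS]big_mkcond [LHS]big_mkcond; apply: eq_bigr => h _.
rewrite !in_set; case: (boolP (flank h)) => //= hh.
by have := flank_dg_le1 aF hh; case: (dg T h) => [|[]].
Qed.

Lemma pay_ports : #|paid D a| <= #|ports D a|.
Proof.
pose qn h := odflt h [pick q | (deg q == 4) && (0 < m q h)].
apply: leq_trans (leq_imset_card qn _); apply/subset_leq_card/subsetP=> d.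
case/setIdP=> /tightP[_ d4 _ _] /exists_inP[h hH mdh].
apply/imsetP; exists h => //; rewrite /qn; case: pickP => [q /andP[/eqP q4 mqh]|/(_ d)].
  by case/setIdP: (hH) => hh _; apply: flank_quartic hh d4 mdh q4 mqh.
by rewrite d4 eqxx mdh.
Qed.

(** Incidences with the tree beyond the two accounted for when [d] is served. *)
Let excess d := dg T d - 2 * (d \in served D P a).

Lemma inc_split : vol T D = 2 * #|served D P a| + \sum_(d in D) excess d.
Proof.
have -> : 2 * #|served D P a| = \sum_(d in D) 2 * (d \in served D P a).
  rewrite -big_distrr /= -sum1_card; congr (_ * _).
  rewrite big_mkcond [RHS]big_mkcond; apply: eq_bigr => d _.
  case: (boolP (d \in served D P a)) => [/servedP[->]//|]; by case: (d \in D).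
rewrite volC -big_split; apply: eq_bigr => d dD /=; rewrite /excess subnKC //.
by case: (boolP (d \in _)) => // /servedP[_ _ _]; rewrite muln1.
Qed.

Lemma size_split : 3 * #|T| = vol T T + vol T D + #|ports D a|.
Proof.
rewrite -ports_card mulnC -sum_nat_const /vol -!big_split; apply: eq_bigr => c ct /=.
by rewrite (tree_split oDP aF ct).
Qed.

Lemma excess_unserved d : ~~ (d \in served D P a) -> excess d = dg T d.
Proof. by rewrite /excess => /negPf->; rewrite subn0. Qed.

Lemma excess_eq0 d : 0 < dg T d -> excess d = 0 -> d \in served D P a /\ dg T d = 2.
Proof.
rewrite /excess; case: (boolP (d \in _)) => [/servedP[_ _ _]|_]; last by rewrite subn0; lia_num.
by move=> h1 h2; split=> //; lia_num.
Qed.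

(** Counting the edges of the tree shows that a failure leaves a total excess of at
    most two. A leaf without a port meets two picks of positive excess, since movable
    picks are alone on their cells. So either two picks meet every leaf and no other
    pick touches the tree, which closes the web, or two leaves carry a port and a
    movable pick each. In the last case irreducibility joins the second
    flank of the paid 4-clique to the movable pick, and moving this pick inside the
    tree lowers the number of picks next to flanks. *)
Lemma tree_bound :
  2 * (2 * #|served D P a| + #|paid D a|) <= vol T T + 2 * #|ports D a|
  \/ exists a1 a2, [/\ deg a1 = 3, deg a2 = 3, 6 <= vol T T &
       forall c x, c \in a1 |: (a2 |: T) -> 0 < m c x -> x \in a1 |: (a2 |: T)].
Proof.
have [|lt] := leqP (2 * (2 * #|served D P a| + #|paid D a|)) (vol T T + 2 * #|ports D a|).
  by left.
right; have e1 := tree_vol oDP aF; have e2 := size_split; have e3 := inc_split.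
have le1 := pay_ports.
set F := \sum_(d in D) excess d in e3.
have FH : F + 2 * #|ports D a| <= #|paid D a| + 2 by move: lt e1 e2 e3; lia_num.
have F1 d : d \in D -> excess d <= F by move=> dD; rewrite /F (big_setD1 d) // leq_addr.
have F2 d e : d \in D -> e \in D -> d != e -> excess d + excess e <= F.
  move=> dD eD nde; rewrite /F (big_setD1 d) //= (big_setD1 e) /=.
    by rewrite addnA leq_addr.
  by rewrite in_setD1 eq_sym nde.
have inF c d : c \in T -> 0 < m c d -> 0 < dg T d.
  by move=> ct mcd; apply: leq_trans (m_le_dg m d ct); rewrite m_sym.
have le1m c d : c \in T -> m c d <= 1.
  by move=> ct; rewrite m_sym; apply: core_no_loop ct.
(* a movable pick is alone *)
have movable_alone c d : c \in T -> d \in D -> 0 < m c d -> excess d = 0 ->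
    [/\ lone P d, deg d = 3, dg T d = 2 & forall e, e \in D -> 0 < m c e -> e = d].
  move=> ct dD mcd /(excess_eq0 (inF _ _ ct mcd))[/servedP[_ ld d3 _] d2]; split=> // e eD mce.
  by apply: (bridge_alone oDP dD ld d3 aF d2 ct) => //; rewrite m_sym.
have movable_dg c d : c \in T -> d \in D -> 0 < m c d -> excess d = 0 -> dg D c = 1.
  move=> ct dD mcd /(movable_alone _ _ ct dD mcd)[_ _ _ al].
  rewrite (dgD1 m c dD) dg_eq0; first by have := le1m c d ct; lia_num.
  move=> x /setD1P[nxd xD]; case: (posnP (m c x)) => // /(al _ xD) e.
  by rewrite e eqxx in nxd.
case: (leqP #|T| 1) => [t1|t1].
  (* a tree with a single cell *)
  have Ta : T = [set a].
    apply/eqP; rewrite eq_sym eqEcard sub1set mem_comp cards1 //.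
  have s := tree_split oDP aF (mem_comp m (freecore D) a).
  rewrite -/(tree D a) in s; rewrite {1}Ta dg1 m_irr in s.
  have : dg D a <= F.
    apply: leq_sum => d dD; case: (boolP (d \in served D P a)) => [/servedP[_ _ _]|nd].
      by rewrite Ta dg1 => h; have := le1m a d (mem_comp _ _ _); rewrite m_sym; lia_num.
    by rewrite excess_unserved // Ta dg1 m_sym.
  have : dg flanks a = #|ports D a| by rewrite -ports_card Ta vol1.
  by move: s FH le1; lia_num.
have [c1 [c2 [ct1 ct2 nc lf1 lf2]]] := two_leaves oDP aF t1.
have leafD c : c \in T -> dg T c <= 1 -> dg flanks c = 0 ->
    exists d d', [/\ d \in D, d' \in D, d != d', 0 < m c d /\ 0 < m c d' &
      0 < excess d /\ 0 < excess d'].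
  move=> ct lf p0; have := tree_split oDP aF ct; rewrite p0 => s.
  have [|d [d' [dD d'D ndd mcd mcd']]] := @dg_gt1 _ m D c (fun x _ => le1m c x ct).
    by move: s lf; lia_num.
  have m0 : 0 < m c d by rewrite mcd.
  have m0' : 0 < m c d' by rewrite mcd'.
  exists d, d'; split=> //; split; rewrite lt0n; apply/negP=> /eqP f0.
    by have := movable_dg _ _ ct dD m0 f0; move: s lf; lia_num.
  by have := movable_dg _ _ ct d'D m0' f0; move: s lf; lia_num.
have portsE : \sum_(c in T) dg flanks c = #|ports D a| by rewrite -ports_card.
have ports1 c : c \in T -> dg flanks c <= #|ports D a|.
  by move=> ct; rewrite -portsE (big_setD1 c) // leq_addr.
have ports2 c c' : c \in T -> c' \in T -> c != c' -> dg flanks c + dg flanks c' <= #|ports D a|.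
  move=> ct ct' ncc; rewrite -portsE (big_setD1 c) //= (big_setD1 c') /=.
    by rewrite addnA leq_addr.
  by rewrite in_setD1 eq_sym ncc.
case: (posnP #|ports D a|) => [H0|Hgt].
  (* no port: two picks are adjacent to all leaves *)
  have port0 c : c \in T -> dg flanks c = 0.
    by move=> /ports1; rewrite H0 leqn0 => /eqP.
  have F2le : F <= 2 by move: FH le1; rewrite H0; lia_num.
  have [d [d' [dD d'D ndd [m1 m1'] [f1 f1']]]] := leafD _ ct1 lf1 (port0 _ ct1).
  have fd : excess d = 1 by have := F2 _ _ dD d'D ndd; lia_num.
  have fd' : excess d' = 1 by have := F2 _ _ dD d'D ndd; lia_num.
  have only e : e \in D -> 0 < excess e -> e = d \/ e = d'.
    move=> eD fe; case: (eqVneq e d) => [|ned]; first by left.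
    case: (eqVneq e d') => [|ned']; first by right.
    have : excess d + (excess d' + excess e) <= F.
      rewrite /F (big_setD1 d) //= leq_add2l (big_setD1 d') ?in_setD1 1?eq_sym ?ndd //=.
      rewrite leq_add2l (big_setD1 e) ?in_setD1 ?ned ?ned' ?eD // leq_addr //.
    by lia_num.
  have leaves c : c \in T -> dg T c <= 1 -> 0 < m d c /\ 0 < m d' c.
    move=> ct lf; have [e [e' [eD e'D nee [me me'] [fe fe']]]] := leafD _ ct lf (port0 _ ct).
    rewrite !(m_sym _ c).
    by case: (only _ eD fe) nee me => ->; case: (only _ e'D fe') me' => -> m2 n m3; rewrite ?eqxx // in n *.
  have dT3 e : e \in D -> excess e = 1 -> 0 < m e c1 -> 0 < m e c2 ->
      e \in served D P a /\ dg T e = 3.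
    move=> eD fe me1 me2.
    have : m e c1 + m e c2 <= dg T e by apply: m2_le_dg.
    move: fe; rewrite /excess; case: (boolP (e \in _)) => [h|_]; last by lia_num.
    by rewrite muln1; split=> //; lia_num.
  have [Qd d3] : d \in served D P a /\ dg T d = 3.
    by apply: dT3 => //; [case: (leaves _ ct1 lf1) | case: (leaves _ ct2 lf2)].
  have [Qd' d'3] : d' \in served D P a /\ dg T d' = 3.
    by apply: dT3 => //; [case: (leaves _ ct1 lf1) | case: (leaves _ ct2 lf2)].
  have [_ ld dd3 _] := servedP Qd; have [_ ld' dd'3 _] := servedP Qd'.
  (* no other pick touches the tree *)
  have closed c e : c \in T -> e \in D -> 0 < m c e -> e = d \/ e = d'.
    move=> ct eD mce; case: (posnP (excess e)) => [fe|]; last exact: only.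
    have [le e3' e2' _] := movable_alone _ _ ct eD mce fe.
    case: (tree_divide oDP aF (u := e) (p := c) (a1 := d) (a2 := d')) => //.
    by rewrite m_sym.
  exists d, d'; split=> //.
    have QP : served D P a \subset [set d; d'].
      apply/subsetP=> e /servedP[eD _ _ e2']; rewrite !in_set2.
      have [|c ct mec] := @dg_gt0 _ m T e; first by lia_num.
      by rewrite m_sym in mec; case: (closed _ _ ct eD mec) => ->; rewrite eqxx ?orbT.
    have : 2 <= #|served D P a|.
      have : #|[set d; d']| <= #|served D P a|.
        by apply: subset_leq_card; rewrite subUset !sub1set Qd Qd'.
      by rewrite cards2 ndd.
    have : excess d + excess d' <= F by apply: F2.
    by move: e1 e2 e3 fd fd'; rewrite H0; lia_num.
  move=> c x; rewrite !in_setU1 => /or3P[/eqP->|/eqP->|ct] mcx.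
  - rewrite orbA orbC; suff -> : x \in T by [].
    apply/negPn/negP=> xT; have := dg_out m d xT; rewrite -/(deg d) dd3 d3; lia_num.
  - rewrite orbA orbC; suff -> : x \in T by [].
    apply/negPn/negP=> xT; have := dg_out m d' xT; rewrite -/(deg d') dd'3 d'3; lia_num.
  case: (boolP (x \in D)) => [xD|xD].
    by case: (closed _ _ ct xD mcx) => ->; rewrite eqxx ?orbT.
  have [cD cc] := tree_core aF ct.
  case: (boolP (core x)) => [cx|ncx].
    have xF : x \in freecore D by apply/freecoreP.
    by rewrite (comp_closed ct (subsetP (tree_sub aF) _ ct) xF mcx) ?orbT.
  have hx := core_nbr_flank cc mcx ncx.
  have : m c x <= dg flanks c by apply: m_le_dg; rewrite in_set.
  by rewrite port0 //; lia_num.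
(* otherwise the ports are few and sit at the leaves *)
exfalso; have nb c : c \in T -> dg T c <= 1 -> dg flanks c = 0 -> 2 <= F.
  move=> ct lf p0; have [d [d' [dD d'D ndd _ [f1 f1']]]] := leafD _ ct lf p0.
  by have := F2 _ _ dD d'D ndd; lia_num.
have p12 := ports2 _ _ ct1 ct2 nc.
have P1 : 0 < dg flanks c1.
  rewrite lt0n; apply/negP=> /eqP p0; have := nb _ ct1 lf1 p0; lia_num.
have P2 : 0 < dg flanks c2.
  rewrite lt0n; apply/negP=> /eqP p0; have := nb _ ct2 lf2 p0; lia_num.
have [F0 H2 Pay2] : [/\ F = 0, #|ports D a| = 2 & 2 <= #|paid D a|].
  by split; move: FH le1 p12 P1 P2; lia_num.
have f0 d : d \in D -> excess d = 0 by move=> /F1; rewrite F0; lia_num.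
have p1 : dg flanks c1 = 1 by lia_num.
have p2 : dg flanks c2 = 1 by lia_num.
have pelse c : c \in T -> c != c1 -> c != c2 -> dg flanks c = 0.
  move=> ct n1 n2; have : dg flanks c1 + (dg flanks c2 + dg flanks c) <= #|ports D a|.
    rewrite -portsE (big_setD1 c1) //= leq_add2l (big_setD1 c2) ?in_setD1 1?eq_sym ?nc //=.
    by rewrite leq_add2l (big_setD1 c) ?in_setD1 ?n1 ?n2 ?ct // leq_addr.
  by lia_num.
have [h1 h1HS mch1] : exists2 h, h \in flanks & 0 < m c1 h by apply: dg_gt0.
have [h2 h2HS mch2] : exists2 h, h \in flanks & 0 < m c2 h by apply: dg_gt0.
have hh1 : flank h1 by rewrite in_set in h1HS.
have hh2 : flank h2 by rewrite in_set in h2HS.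
have nhh : h1 != h2.
  apply/eqP=> e; rewrite -e in mch2; have le := flank_dg_le1 aF hh1.
  by have := m2_le_dg m h1 ct1 ct2 nc; rewrite !(m_sym h1); lia_num.
have HtE : ports D a = [set h1; h2].
  apply/esym/eqP; rewrite eqEcard cards2 nhh H2 andbT subUset !sub1set !in_set hh1 hh2 /=.
  by rewrite !(inF _ _ ct1 mch1, inF _ _ ct2 mch2).
have payP d : d \in paid D a -> tight D d /\ (0 < m d h1 \/ 0 < m d h2).
  case/setIdP=> td /exists_inP[h]; rewrite HtE => /set2P[] ->; split=> //; [left|right] => //.
have [d1 [d2 [td1 td2 md1 md2 nd]]] : exists d1 d2,
    [/\ tight D d1, tight D d2, 0 < m d1 h1, 0 < m d2 h2 & d1 != d2].
  case/card_gt1P: Pay2 => e1' [e2' [/payP[t1' o1] /payP[t2' o2] ne]].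
  have [_ q1 _ _] := tightP t1'; have [_ q2 _ _] := tightP t2'.
  case: o1 o2 => o1 [] o2.
  - by rewrite (flank_quartic hh1 q1 o1 q2 o2) eqxx in ne.
  - by exists e1', e2'.
  - by exists e2', e1'; rewrite eq_sym.
  - by rewrite (flank_quartic hh2 q1 o1 q2 o2) eqxx in ne.
(* the movable picks at both leaves *)
have pick c : c \in T -> dg T c <= 1 -> dg flanks c = 1 ->
    exists u, [/\ u \in D, 0 < m c u, lone P u, deg u = 3 /\ dg T u = 2 &
      forall e, e \in D -> 0 < m c e -> e = u].
  move=> ct lf pc; have s := tree_split oDP aF ct.
  have [|u uD mcu] := @dg_gt0 _ m D c; first by move: s lf pc; lia_num.
  by have [? ? ? ?] := movable_alone _ _ ct uD mcu (f0 _ uD); exists u.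
have [u1 [u1D mu1 lu1 [u13 du1] al1]] := pick _ ct1 lf1 p1.
have [u2 [u2D mu2 lu2 [u23 du2] al2]] := pick _ ct2 lf2 p2.
(* the 4-clique at such a leaf has a second flank, which ends at the movable pick *)
have dbl c h d u h' d' : c \in T -> dg T c <= 1 -> dg flanks c = 1 -> flank h -> 0 < m c h ->
    tight D d -> 0 < m d h -> u \in D -> 0 < m c u -> lone P u -> deg u = 3 ->
    dg T u = 2 -> (forall e, e \in D -> 0 < m c e -> e = u) ->
    ports D a = [set h; h'] -> tight D d' -> 0 < m d' h' -> d != d' ->
    exists k, [/\ flank k, 0 < m d k & 0 < m k u].
  move=> ct lf pc hh mch td mdh uD mcu lu u3 du al HE td' md' ndd.
  have [_ d4 nkd _] := tightP td; have [_ d'4 _ _] := tightP td'.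
  have [k [hk mdk nkh]] : exists k, [/\ flank k, 0 < m d k & k != h].
    case: (pickP [pred k | [&& flank k, 0 < m d k & k != h]]) => [k /and3P[? ? ?]|np].
      by exists k.
    exfalso; apply: (bridge_oneflank oDP uD lu u3 aF du ct (d := d) (h := h)).
    - by rewrite m_sym.
    - split=> // x hx mdx; apply/eqP/negPn/negP=> nx.
      by have := np x; rewrite /= hx mdx nx.
    - by rewrite m_sym.
  case: (flankP hk) => q [s [q4 s3 mq ms hall]].
  have eq : d = q by apply: flank_quartic hk d4 mdk q4 _; rewrite m_sym mq.
  have nsd : s != d by apply/eqP=> e; rewrite e d4 in s3.
  have [cD cc] := tree_core aF ct; have c3 := core_deg cc.
  have ncd : c != d by apply/eqP=> e; rewrite e d4 in c3.
  have ms0 : 0 < m k s by rewrite ms.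
  have mhc : 0 < m h c by rewrite m_sym.
  (* [k] is not at the tree *)
  have nport x : x \in T -> 0 < m x k -> False.
    move=> xt mxk; have : k \in ports D a by rewrite in_set hk (inF x).
    rewrite HE => /set2P[kh|kh]; first by rewrite kh eqxx in nkh.
    subst k; by rewrite (flank_quartic hk d4 mdk d'4 md') eqxx in ndd.
  have mdh' : 0 < m h d by rewrite m_sym.
  have nhk : h != k by rewrite eq_sym.
  exists k; split=> //; case: (irr d4 hh hk nhk mdh mdk ncd nsd mhc ms0) => [cs|mcs|ck].
  - by case: (nport c ct); rewrite cs m_sym.
  - case: (boolP (s \in D)) => [sD|sD]; first by rewrite -(al _ sD mcs).
    case: (boolP (core s)) => [cs|ncs].
      case: (nport s); last by rewrite m_sym.
      by apply: comp_closed ct (subsetP (tree_sub aF) _ ct) _ mcs; apply/freecoreP.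
    have hsx := core_nbr_flank cc mcs ncs.
    have sh : s = h.
      apply/eqP/negPn/negP=> nsh; have := @m2_le_dg _ m flanks c s h.
      by rewrite !in_set pc hsx hh nsh => /(_ isT isT isT); lia_num.
    have mhk : 0 < m h k by rewrite m_sym -sh ms.
    have nkd1 : k != d by apply/eqP=> e; move: (flank_deg hk); rewrite e d4.
    have kc : k = c by apply: flank_far hh d4 mdh mhk nkd1 mhc ncd.
    by move: cc; rewrite -kc /core hk andbF.
  - by move: cc; rewrite ck /core hk andbF.
have [k1 [hk1 mdk1 mku1]] := dbl _ _ _ _ h2 d2 ct1 lf1 p1 hh1 mch1 td1 md1 u1D mu1 lu1
  u13 du1 al1 HtE td2 md2 nd.
have nd' : d2 != d1 by rewrite eq_sym.
have HtE' : ports D a = [set h2; h1] by rewrite HtE setUC.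
have [k2' [hk2 mdk2 mku2]] := dbl _ _ _ _ h1 d1 ct2 lf2 p2 hh2 mch2 td2 md2 u2D mu2 lu2
  u23 du2 al2 HtE' td1 md1 nd'.
have [_ d14 _ _] := tightP td1; have [_ d24 _ _] := tightP td2.
have nkk : k1 != k2'.
  apply/eqP=> e; subst k2'; by rewrite (flank_quartic hk1 d14 mdk1 d24 mdk2) eqxx in nd.
have notT k : flank k -> k \notin T.
  by move=> hk; apply/negP=> /(tree_core aF)[_]; rewrite /core hk andbF.
(* the other tree neighbour of [u1] *)
have mu1c1 : m u1 c1 = 1.
  by have := le1m c1 u1 ct1; rewrite m_sym in mu1; rewrite m_sym; lia_num.
have [v /setD1P[nvc vt] muv] : exists2 v, v \in T :\ c1 & 0 < m u1 v.
  by apply: dg_gt0; move: du1; rewrite (dgD1 m u1 ct1) mu1c1 add1n => -[->].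
have nvc2 : v != c2.
  apply/eqP=> vc; subst v.
  have e : u1 = u2 by apply: al2 => //; rewrite m_sym.
  subst u2.
  have : dg T u1 + m u1 k1 + m u1 k2' <= deg u1 by apply: dg_out2; rewrite ?notT.
  by rewrite !(m_sym u1 _) du1 u13; lia_num.
have v0 := pelse _ vt nvc nvc2.
have oD' := opt_exch oDP u1D lu1 u13 aF du1 vt muv.
have := minflanked oD'; rewrite leqNgt => /negP; apply; rewrite /flanked.
apply: proper_card; apply/properP; split.
  apply/subsetP=> c /setIdP[]; rewrite in_setU1 in_setD1 => /orP[/eqP->|/andP[_ cD]] ex.
    case/existsP: ex => h /andP[mvh hh]; have hHS : h \in flanks by rewrite in_set.
    by have := m_le_dg m v hHS; rewrite v0; lia_num.
  by rewrite in_set cD.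
exists u1.
  by rewrite in_set u1D; apply/existsP; exists k1; rewrite m_sym mku1.
apply/negP=> /setIdP[]; rewrite in_setU1 in_setD1 eqxx orbF => /eqP e.
by move: (tree_core aF vt) => []; rewrite -e u1D.
Qed.

End Tree.
End Opt.
End Excess.

(** * The count for irreducible webs *)

Lemma card_le_sum (T I : finType) (A : {set T}) (J : {set I}) (B : I -> {set T}) :
  (forall x, x \in A -> exists2 i, i \in J & x \in B i) ->
  #|A| <= \sum_(i in J) #|B i|.
Proof.
move=> h; apply: leq_trans (_ : #|\bigcup_(i in J) B i| <= _).
  by apply/subset_leq_card/subsetP=> x /h[i iJ xB]; apply/bigcupP; exists i.
elim/big_rec2: _ => [|i n X _ le]; first by rewrite cards0.
by apply: leq_trans (leq_card_setU _ _) _; rewrite leq_add2l.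
Qed.

Section Total.
Variables (W : finType) (m : web W).
Let m_sym := web_sym m.
Let m_irr := web_irr m.
Local Notation deg := (deg m).
Local Notation dg := (dg m).
Local Notation vol := (vol m).
Local Notation flank := (flank m).
Local Notation core := (core m).
Local Notation freecore := (freecore m).
Local Notation tree := (tree m).
Local Notation flanks := (flanks m).
Local Notation tight := (tight m).
Local Notation oneflank := (oneflank m).
Implicit Types (D X A B : {set W}) (P : {set W * W}) (a c d e h q s u x y z : W).

(** Connectedness, for cells that are not isolated. *)
Definition linked := forall A c x, c \in A -> 0 < deg c ->
  (forall y z, y \in A -> 0 < m y z -> z \in A) -> 0 < deg x -> x \in A.

Lemma card_edges A B :
  #|[set p : W * W | [&& p.1 \in A, p.2 \in B & 0 < m p.1 p.2]]| <= vol A B.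
Proof.
rewrite -sum1_card /vol /dg pair_big_dep /= big_mkcond [leqRHS]big_mkcond.
apply: leq_sum => -[x y] _; rewrite in_set /=.
by case: (x \in A) => //; case: (y \in B) => //=; case: (m x y).
Qed.

Section Opt.
Variables (D : {set W}) (P : {set W * W}).
Hypothesis oDP : opt m D P.
Hypothesis minflanked : forall D' P', opt m D' P' -> flanked m D <= flanked m D'.
Hypothesis irr : irreducible m.
Hypothesis lnk : linked.

Local Notation F := (~: D).
Let FH := [set h | flank h && (h \notin D)].
Let F4 := [set q | (deg q == 4) && (q \notin D)].
Let F2 := [set q | (deg q == 2) && (q \notin D)].
Local Notation lone3 := (lone3 m D P).
Let Q4 := [set d in D | deg d == 4].

(** The five kinds of free cells involved occupy disjoint sets of edges of the
    forest. *)
Lemma vol_parts :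
  vol (freecore D) (freecore D) + 2 * vol (freecore D) flanks + vol FH FH + 2 * vol F4 F2 <= vol F F.
Proof.
have dcH c : c \in freecore D -> dg flanks c = dg FH c.
  case/freecoreP=> cD cc; rewrite /dg big_mkcond [RHS]big_mkcond; apply: eq_bigr => h _.
  rewrite !in_set; case: (boolP (flank h)) => //= hh; case: (posnP (m c h)) => [->|mch].
    by case: ifP.
  by rewrite (core_flank_notD oDP cD cc hh mch).
have -> : vol (freecore D) flanks = vol (freecore D) FH by apply: eq_bigr => c /dcH.
rewrite 2!mul2n -2!addnn {2}(volC m (freecore D) FH) {2}(volC m F4 F2).
pose T c := (if c \in freecore D then dg (freecore D) c + dg FH c else 0)
  + ((if c \in FH then dg (freecore D) c + dg FH c else 0)
  + ((if c \in F4 then dg F2 c else 0) + (if c \in F2 then dg F4 c else 0))).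
have -> : vol (freecore D) (freecore D) + (vol (freecore D) FH + vol FH (freecore D)) + vol FH FH
    + (vol F4 F2 + vol F2 F4) = \sum_(c : W) T c.
  rewrite /T !big_split /= -!big_mkcond /= !big_split /= /vol; lia_num.
rewrite {1}/vol [leqRHS]big_mkcond; apply: leq_sum => c _.
have sub A : A \subset F -> dg A c <= dg F c by apply: dgS.
have sF4 : F4 \subset F by apply/subsetP=> x; rewrite !in_set => /andP[].
have sF2 : F2 \subset F by apply/subsetP=> x; rewrite !in_set => /andP[].
have sCH : dg (freecore D) c + dg FH c <= dg F c.
  rewrite -dgU; last first.
    by rewrite -setI_eq0; apply/eqP/setP=> x; rewrite !in_set /core; case: (flank x); rewrite !andbF.
  by apply: dgS; apply/subsetP=> x; rewrite !in_set => /orP[] /andP[].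
have h3 : flank c -> deg c = 3 by apply: flank_deg.
rewrite /T !in_set /core; case: (c \in D) => /=; first by rewrite !andbF.
rewrite !andbT; case: (boolP (flank c)) => [hc|_].
  by rewrite (h3 hc) /= ?andbF ?addn0 ?add0n.
case: (eqVneq (deg c) 3) => [->|_] /=; first by rewrite !addn0.
case: (eqVneq (deg c) 4) => [->|_] /=; first by rewrite !addn0 !add0n sub.
by case: ifP => _; rewrite !add0n ?sub.
Qed.

Let TT := [set tree D a | a in freecore D].

Lemma sum_trees (phi : W -> nat) :
  \sum_(c in freecore D) phi c = \sum_(T in TT) \sum_(c in T) phi c.
Proof.
rewrite (partition_big (tree D) (mem TT)) /=; last by move=> c cF; apply: imset_f.
apply: eq_bigr => _ /imsetP[a aF ->]; apply: eq_bigl => c.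
apply/andP/idP => [[cF /eqP<-]|ct]; first exact: mem_comp.
by split; [apply: (subsetP (tree_sub aF)) | apply/eqP/comp_eq].
Qed.

(** The notions of [tree_bound] as functions of the tree itself, so as to sum over trees. *)
Let q3 T := [set u in lone3 | 2 <= dg T u].
Let ht T := [set h | flank h && (0 < dg T h)].
Let pay T := [set d | tight D d && [exists h in ht T, 0 < m d h]].

Lemma trees_vol : vol (freecore D) (freecore D) + 2 * vol (freecore D) flanks
  = \sum_(T in TT) (vol T T + 2 * #|ht T|).
Proof.
rewrite /vol (sum_trees (dg (freecore D))) (sum_trees (dg flanks)) big_distrr -big_split /=.
apply: eq_bigr => _ /imsetP[a aF ->]; congr (_ + 2 * _).
  apply: eq_bigr => c ct; rewrite (tree_dg ct) //; exact: (subsetP (tree_sub aF)).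
by rewrite -/(vol _ _) (ports_card aF).
Qed.

Lemma all_in A c x : c \in A -> 0 < deg c ->
  (forall y z, y \in A -> 0 < m y z -> z \in A) -> x \in D -> x \in A.
Proof.
move=> cA dc cl xD; apply: lnk cA dc cl _.
by apply: leq_trans (opt_deg_gt1 oDP xD).
Qed.

Lemma lone3_core u : u \in lone3 -> core u.
Proof. by case/lone3P=> uD lu u3; exact: (lone_core oDP uD lu u3). Qed.

Lemma Q4P d : d \in Q4 -> d \in D /\ deg d = 4.
Proof. by case/setIdP=> dD /eqP. Qed.

(** If the estimate fails for one tree, then the closed set found by [tree_bound]
    contains all of [D]; its two additional cells are the only possible picks, and the volume
    of the tree is at least six. *)
Lemma trees_star : 4 * #|lone3| + 2 * #|Q4| <= vol F F + 2 \/
  4 * #|lone3| + 2 * \sum_(T in TT) #|pay T| <= vol (freecore D) (freecore D) + 2 * vol (freecore D) flanks.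
Proof.
case: (boolP [forall T in TT,
  2 * (2 * #|q3 T| + #|pay T|) <= vol T T + 2 * #|ht T|]) => [/forall_inP h|].
  right; rewrite trees_vol; apply: leq_trans (leq_sum _ h).
  rewrite -big_distrr big_split /= -big_distrr /=.
  have : #|lone3| <= \sum_(T in TT) #|q3 T|.
    apply: card_le_sum => u uQ; have [uD lu u3] := lone3P uQ.
    have [c cF dc] := lone_tree oDP uD lu u3.
    by exists (tree D c); [apply: imset_f | rewrite in_set uQ].
  by move=> le; rewrite mulnDr mulnA leq_add2r leq_mul2l.
rewrite negb_forall_in => /exists_inP[_ /imsetP[a aF ->] nle]; left.
case: (tree_bound oDP minflanked irr aF) => [le|[a1 [a2 [d1 d2 v6 cl]]]].
  by rewrite le in nle.
have aA : a \in a1 |: (a2 |: tree D a) by rewrite !in_setU1 mem_comp !orbT.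
have da : 0 < deg a by have [_ /core_deg->] := freecoreP _ _ _ aF.
have inA x := @all_in _ _ x aA da cl.
have Q40 : Q4 = set0.
  apply/setP=> d; rewrite in_set0; apply/negP=> /Q4P[dD d4]; move: (inA _ dD).
  rewrite !in_setU1 => /or3P[/eqP e|/eqP e|/(tree_core aF)[_ /core_deg]].
  - by rewrite e d1 in d4.
  - by rewrite e d2 in d4.
  - by rewrite d4.
have Q32 : #|lone3| <= 2.
  have : lone3 \subset [set a1; a2].
    apply/subsetP=> u /lone3P[uD _ _]; rewrite in_set2; move: (inA _ uD).
    by rewrite !in_setU1 orbA => /orP[//|/(tree_core aF)[]]; rewrite uD.
  by move/subset_leq_card; rewrite cards2 => /leq_trans; apply; case: (a1 != a2).
have : vol (tree D a) (tree D a) <= vol F F.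
  have s : tree D a \subset F by apply/subsetP=> x /(tree_core aF)[]; rewrite in_set.
  rewrite /vol [leqRHS](big_setID (tree D a)) /= (setIidPr s).
  by apply: leq_trans (leq_addr _ _); apply: leq_sum => c _; apply: dgS.
by rewrite Q40 cards0; lia_num.
Qed.

Let SP := [set d in Q4 | twinned m d || spare m D d].

Lemma adj4E d e k : 0 < m d e -> deg d = 4 -> deg e = k.+1 -> m d e = k.
Proof. by move=> mde d4 e4; have := adj4 mde d4; rewrite e4 addn1 => -[]. Qed.

(** Each such pick is charged to an edge between an unpicked 4-clique and a
    two-element clique: for a twinned [d], one at its twin, and otherwise the edge
    that makes it spare. The function [g] recovers [d] from the edge. *)
Lemma spare_card : #|SP| <= vol F4 F2.
Proof.
apply: leq_trans (card_edges F4 F2).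
pose g (p : W * W) := odflt p.1 [pick d |
  if twinned m p.1 then (deg d == 4) && (0 < m p.1 d) else (d != p.1) && (0 < m p.2 d)].
apply: leq_trans (leq_imset_card g _); apply/subset_leq_card/subsetP=> d.
case/setIdP=> /Q4P[dD d4]; case: (boolP (twinned m d)) => [kd _|nkd /= sd]; apply/imsetP.
  case/andP: (kd) => _ /existsP[e /andP[mde /eqP e4]].
  have eD := adj4_notinD oDP dD d4 mde.
  have mde3 := adj4E mde d4 e4.
  have med3 : m e d = 3 by rewrite m_sym.
  have [x nxd mex] : exists2 x, x != d & 0 < m e x by apply: nbr_more; rewrite med3 e4.
  have dne : d != x by rewrite eq_sym.
  have mex1 : m e x = 1.
    have := @m2_le_dg _ m setT e d x; rewrite !in_set dne -/(deg e) e4 med3.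
    by move=> /(_ isT isT isT); lia_num.
  have x2 : deg x = 2 by rewrite -(adj4 mex e4) mex1.
  have xD : x \notin D by apply/negP=> xD; have := optD_deg_neq2 oDP xD; rewrite x2.
  have ke : twinned m e by apply: (twinnedI e4 d4); rewrite m_sym.
  exists (e, x); first by rewrite !in_set /= e4 x2 eD xD mex.
  rewrite /g /= ke; case: pickP => [z /andP[/eqP z4 mez]|/(_ d)]; last by rewrite d4 m_sym mde.
  apply/eqP/negPn/negP=> ndz; have mez3 := adj4E mez e4 z4.
  have := @m2_le_dg _ m setT e d z; rewrite !in_set ndz -/(deg e) e4 med3 mez3.
  by move=> /(_ isT isT isT).
case/existsP: sd => x /existsP[q /and5P[/eqP x2 mdx mxq nqd /andP[qD nkq]]].
have [q4 mxq1] := adj2 mxq x2.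
have mxd : 0 < m x d by rewrite m_sym.
have [_ mxd1] := adj2 mxd x2.
have xD : x \notin D by apply/negP=> xD; have := optD_deg_neq2 oDP xD; rewrite x2.
exists (q, x); first by rewrite !in_set /= q4 x2 qD xD m_sym mxq.
rewrite /g /= (negPf nkq); case: pickP => [z /andP[nzq mxz]|/(_ d)]; last first.
  by rewrite eq_sym nqd mxd.
have e : m x q + m x d = deg x by rewrite mxq1 mxd1 x2.
by case: (nbrs_all2 nqd e mxz) => // zq; rewrite zq eqxx in nzq.
Qed.

(** Tight picks with a single flank, the far end of which is a flank again; [fh] and
    [f1] choose these two flanks. *)
Let fh d := odflt d [pick h | flank h && (0 < m d h)].
Let f1 d := odflt d [pick x | flank x && (0 < m (fh d) x)].
Let TL := [set d | [&& tight D d, [forall x, flank x && (0 < m d x) ==> (x == fh d)],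
  flank (fh d), 0 < m d (fh d) & flank (f1 d) && (0 < m (fh d) (f1 d))]].

Lemma TLP d : d \in TL -> [/\ oneflank D d (fh d), flank (f1 d) & 0 < m (fh d) (f1 d)].
Proof.
rewrite in_set => /and5P[td /forallP un hh mh /andP[h1 m1]]; split=> //; split=> // x hx mx.
by apply/eqP; have := un x; rewrite hx mx.
Qed.

Lemma twin_notD d h : tight D d -> 0 < m d h -> h \notin D.
Proof. by move=> /tightP[dD d4 _ _]; apply: (adj4_notinD oDP). Qed.

Lemma vol_link x y : x \notin D -> y \notin D -> 0 < m x y -> 2 <= vol F F.
Proof.
move=> xD yD mxy; have nxy : x != y by apply: adj_neq mxy.
apply: leq_trans (card_edges F F).
have <- : #|[set (x, y); (y, x)]| = 2 by rewrite cards2 xpair_eqE (negPf nxy).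
apply/subset_leq_card/subsetP=> p /set2P[]->; rewrite in_set /= !in_setC xD yD //=.
by rewrite m_sym.
Qed.

(** By [oneflank_link] the two picks also share both their two-element cliques, so
    these six cells are the whole web. *)
Lemma twin_pair d e h h1 : oneflank D d h -> oneflank D e h1 -> d != e -> 0 < m h h1 ->
  4 * #|lone3| + 2 * #|Q4| <= vol F F + 2.
Proof.
move=> td te nde mhh; have [x [y [nxy x2 y2 [mdx mdy] [mex mey]]]] := oneflank_link oDP td te nde mhh.
have [/[dup] thd /tightP[dD d4 _ _] hh mdh _] := td.
have [/[dup] the /tightP[eD e4 _ _] hh1 meh _] := te.
have h3 := flank_deg hh; have h13 := flank_deg hh1.
have mdh2 := adj4E mdh d4 h3; have meh2 := adj4E meh e4 h13.
have mhh1 := adj33 mhh h3 h13.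
have dxh z k : deg z = 3 -> deg k = 2 -> z != k.
  by move=> z3 k2; apply/eqP=> zk; rewrite zk k2 in z3.
have dxd z k : deg z = 4 -> deg k = 3 -> z != k.
  by move=> z3 k2; apply/eqP=> zk; rewrite zk k2 in z3.
pose A := [set z in [:: d; e; h; h1; x; y]].
have AP z : z \in A -> [\/ z = d \/ z = e, z = h \/ z = h1 | z = x \/ z = y].
  rewrite in_set !inE => /or4P[/eqP->|/eqP->|/eqP->|/or3P[]/eqP->];
  by [apply: Or31; auto | apply: Or32; auto | apply: Or33; auto].
have AI : [/\ d \in A /\ e \in A, h \in A /\ h1 \in A & x \in A /\ y \in A].
  by rewrite !in_set !inE !eqxx !orbT.
have [[dA eA] [hA h1A] [xA yA]] := AI.
have cl z w : z \in A -> 0 < m z w -> w \in A.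
  case/AP=> [[]->|[]->|[]->].
  - case/(@nbrs_all3 _ _ d h x y) => [||//||->|->|->] //; first exact: dxh.
      exact: dxh.
    by rewrite mdh2 mdx mdy d4.
  - case/(@nbrs_all3 _ _ e h1 x y) => [||//||->|->|->] //; first exact: dxh.
      exact: dxh.
    by rewrite meh2 mex mey e4.
  - case/(@nbrs_all2 _ _ h d h1) => [||->|->] //; first exact: dxd.
    by rewrite m_sym mdh2 mhh1 h3.
  - case/(@nbrs_all2 _ _ h1 e h) => [||->|->] //; first exact: dxd.
    by rewrite m_sym meh2 m_sym mhh1 h13.
  - by case/(@nbrs_all2 _ _ x d e) => [||->|->] //; rewrite !(m_sym x) mdx mex x2.
  - by case/(@nbrs_all2 _ _ y d e) => [||->|->] //; rewrite !(m_sym y) mdy mey y2.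
have inA z : z \in D -> z \in A by apply: (all_in dA); rewrite ?d4.
have Q30 : #|lone3| = 0.
  apply/eqP; rewrite cards_eq0; apply/eqP/setP=> u; rewrite in_set0; apply/negP=> uQ.
  have [uD _ u3] := lone3P uQ; have := lone3_core uQ; rewrite /core.
  case/AP: (inA _ uD) => [[]e'|[]e'|[]e']; rewrite e' ?hh ?hh1 ?andbF //;
  by rewrite -e' u3 // in d4 e4 x2 y2 *; move: u3; rewrite e' ?d4 ?e4 ?x2 ?y2.
have Q42 : #|Q4| <= 2.
  have : Q4 \subset [set d; e].
    apply/subsetP=> u /Q4P[uD u4].
    case/AP: (inA _ uD) => [[]e'|[]e'|[]e']; rewrite e' ?set21 ?set22 // in u4 *.
    - by rewrite h3 in u4.
    - by rewrite h13 in u4.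
    - by rewrite x2 in u4.
    - by rewrite y2 in u4.
  by move/subset_leq_card; rewrite cards2 nde.
have hD := twin_notD thd mdh; have h1D := twin_notD the meh.
have v2 := vol_link hD h1D mhh.
by rewrite Q30 muln0; apply: leq_trans (leq_mul (leqnn 2) Q42) _; rewrite -(leq_add2r 2) in v2.
Qed.

(** A pick of [TL] is charged to both orientations of the link between its flank and
    the next one; two picks claim the same link only in the case of [twin_pair]. *)
Lemma links_star : 4 * #|lone3| + 2 * #|Q4| <= vol F F + 2 \/ 2 * #|TL| <= vol FH FH.
Proof.
pose B := [set p : W * W | [&& p.1 \in FH, p.2 \in FH & 0 < m p.1 p.2]].
pose i1 d := (fh d, f1 d); pose i2 d := (f1 d, fh d).
have inFH d : d \in TL -> fh d \in FH /\ f1 d \in FH.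
  move=> dT; have [tp h1 mhh] := TLP dT; have [td hh mh un] := tp.
  have hD := twin_notD td mh; rewrite !in_set hh h1 hD; split=> //.
  by apply/negP=> xD; apply: (oneflank_end oDP tp (flank_deg h1) mhh xD).
have inj d e : d \in TL -> e \in TL -> fh d = fh e -> d = e.
  move=> /TLP[[/tightP[_ d4 _ _] hh mdh _] _ _] /TLP[[/tightP[_ e4 _ _] _ meh _] _ _] E.
  by apply: flank_quartic hh d4 mdh e4 _; rewrite E.
have sB : (i1 @: TL) :|: (i2 @: TL) \subset B.
  rewrite subUset; apply/andP; split; apply/subsetP=> _ /imsetP[d dT ->];
  have [a1 a2] := inFH d dT; have [_ _ mm] := TLP dT; rewrite in_set /= a1 a2 //.
  by rewrite m_sym mm.
have c1 : #|i1 @: TL| = #|TL| by apply: card_in_imset => d e dT eT [E _]; apply: inj E.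
have c2 : #|i2 @: TL| = #|TL| by apply: card_in_imset => d e dT eT [_ E]; apply: inj E.
case: (set_0Vmem (i1 @: TL :&: i2 @: TL)) => [E|[p]].
  right; apply: leq_trans (card_edges FH FH); apply: leq_trans (subset_leq_card sB).
  by rewrite cardsU E cards0 subn0 c1 c2 mul2n addnn.
case/setIP=> /imsetP[d dT ->] /imsetP[e eT [E1 E2]]; left.
have [td h1 mhh] := TLP dT; have [te _ _] := TLP eT.
apply: (twin_pair td te); last by rewrite -E2.
by apply/eqP=> de; subst e; rewrite E2 m_irr in mhh.
Qed.

Lemma pay_far d h s : tight D d -> flank h -> 0 < m d h -> 0 < m h s -> s \notin D ->
  core s -> exists2 c, c \in freecore D & d \in pay (tree D c).
Proof.
move=> td hh mdh mhs sD cs; have sF : s \in freecore D by apply/freecoreP.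
exists s => //; rewrite in_set td; apply/exists_inP; exists h => //; rewrite in_set hh.
by apply: leq_trans mhs _; apply: m_le_dg; apply: mem_comp.
Qed.

(** The two flanks use up all edges of [d] and the link between them uses up theirs. *)
Lemma triangle_star d h h' : tight D d -> flank h -> flank h' -> h != h' ->
  0 < m d h -> 0 < m d h' -> 0 < m h h' -> 4 * #|lone3| + 2 * #|Q4| <= vol F F + 2.
Proof.
move=> td hh hh' nhh mdh mdh' mhh; have [dD d4 _ _] := tightP td.
have h3 := flank_deg hh; have h'3 := flank_deg hh'.
have mdh2 := adj4E mdh d4 h3; have mdh'2 := adj4E mdh' d4 h'3.
have mhh1 := adj33 mhh h3 h'3.
have ndh k : deg k = 3 -> d != k by move=> k3; apply/eqP=> e; rewrite -e d4 in k3.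
pose A := [set z in [:: d; h; h']].
have AP z : z \in A -> [\/ z = d, z = h | z = h'].
  by rewrite in_set !inE => /or3P[]/eqP->; [apply: Or31|apply: Or32|apply: Or33].
have [dA hA h'A] : [/\ d \in A, h \in A & h' \in A] by rewrite !in_set !inE !eqxx !orbT.
have cl z w : z \in A -> 0 < m z w -> w \in A.
  case/AP=> ->.
  - by case/(@nbrs_all2 _ _ d h h') => [||->|->] //; rewrite mdh2 mdh'2 d4.
  - case/(@nbrs_all2 _ _ h d h') => [||->|->] //; first exact: ndh.
    by rewrite m_sym mdh2 mhh1 h3.
  - case/(@nbrs_all2 _ _ h' d h) => [||->|->] //; first exact: ndh.
    by rewrite !(m_sym h') mdh'2 mhh1 h'3.
have inA z : z \in D -> z \in A by apply: (all_in dA); rewrite ?d4.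
have Q30 : #|lone3| = 0.
  apply/eqP; rewrite cards_eq0; apply/eqP/setP=> u; rewrite in_set0; apply/negP=> uQ.
  have [uD _ u3] := lone3P uQ; have := lone3_core uQ; rewrite /core.
  case/AP: (inA _ uD) => e'; rewrite e' ?hh ?hh' ?andbF //.
  by rewrite e' d4 in u3.
have Q42 : #|Q4| <= 1.
  rewrite -(cards1 d); apply/subset_leq_card/subsetP=> u /Q4P[uD u4].
  case/AP: (inA _ uD) => e'; rewrite e' ?set11 // in u4 *.
    by rewrite h3 in u4.
  by rewrite h'3 in u4.
by rewrite Q30 muln0; apply: leq_trans (leq_mul (leqnn 2) Q42) _; rewrite leq_addl.
Qed.

(** With one flank, its far end is free by [oneflank_end]. With two, irreducibility
    makes the far ends equal or adjacent; they are then core cells, and cannot both be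
    picked, since no cycle would need such a pick. *)
Lemma tight_cover d : tight D d -> d \notin TL ->
  4 * #|lone3| + 2 * #|Q4| <= vol F F + 2 \/ exists2 c, c \in freecore D & d \in pay (tree D c).
Proof.
move=> td dTL; have [h hh mdh] := tight_flank oDP td; have [dD d4 _ _] := tightP td.
have far h0 : flank h0 -> 0 < m d h0 -> exists s, [/\ deg s = 3, m h0 s = 1 &
    forall z, 0 < m h0 z -> z = d \/ z = s].
  move=> h0h mdh0; have [q [s [q4 s3 mq ms al]]] := flankP h0h; exists s.
  have -> // : d = q by apply: flank_quartic h0h d4 mdh0 q4 _; rewrite m_sym mq.
have [s [s3 ms al]] := far h hh mdh; have ms0 : 0 < m h s by rewrite ms.
have hsc x : deg x = 3 -> ~~ flank x -> core x by move=> x3 nx; rewrite /core x3.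
case: (pickP [pred x | [&& flank x, 0 < m d x & x != h]]) => [h' /and3P[hh' mdh' nhh]|un].
  have [s' [s'3 ms' al']] := far h' hh' mdh'; have ms'0 : 0 < m h' s' by rewrite ms'.
  have nd k : deg k = 3 -> k != d by move=> k3; apply/eqP=> e; rewrite e d4 in k3.
  rewrite eq_sym in nhh.
  case: (eqVneq s h') => [sh|nsh].
    by left; rewrite sh in ms0; apply: (triangle_star td hh hh' nhh mdh mdh' ms0).
  have nsh' : s' != h.
    apply/eqP=> e; rewrite e in ms'0; rewrite m_sym in ms'0.
    case: (al _ ms'0) => e2; first by have := flank_deg hh'; rewrite e2 d4.
    by rewrite e2 eqxx in nsh.
  have ss : s = s' \/ 0 < m s s'.
    case: (irr d4 hh hh' nhh mdh mdh' (nd _ s3) (nd _ s'3) ms0 ms'0); auto.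
    by move=> e; rewrite e eqxx in nsh.
  (* two neighbours of degree three exclude a quartic neighbour *)
  have no_flank x y z : deg x = 3 -> deg y = 3 -> deg z = 3 -> y != z ->
      0 < m x y -> 0 < m x z -> core x.
    move=> x3 y3 z3 nyz mxy mxz; apply: hsc => //; apply/negP=> hx.
    have [q [t [q4 _ mq _ _]]] := flankP hx.
    have nq k : deg k = 3 -> q != k by move=> k3; apply/eqP=> e; rewrite -e q4 in k3.
    have := @m3_le_dg _ m setT x q y z; rewrite !in_setT (nq _ y3) (nq _ z3) nyz.
    move=> /(_ isT isT isT isT isT isT).
    by rewrite -/(deg x) x3 mq (adj33 mxy) // (adj33 mxz).
  have h3 := flank_deg hh; have h'3 := flank_deg hh'.
  have cs : core s.
    case: ss => [e|mss].
      by apply: (no_flank s h h') => //; rewrite m_sym // e.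
    by apply: (no_flank s h s') => //; [rewrite eq_sym | rewrite m_sym].
  have cs' : core s'.
    case: ss => [e|mss]; first by rewrite -e.
    by apply: (no_flank s' h' s) => //; [rewrite eq_sym | rewrite m_sym | rewrite m_sym].
  right; case: (boolP (s \in D)) => [sD|sD]; last exact: pay_far td hh mdh ms0 sD cs.
  case: (boolP (s' \in D)) => [s'D|s'D]; last exact: pay_far td hh' mdh' ms'0 s'D cs'.
  exfalso; have [X [fX sX XD]] := opt_witness oDP sD.
  have hX k : flank k -> 0 < m d k -> k \notin X.
    move=> hk mdk; apply/negP=> kX.
    have dX : d \in X by apply: fat_flank fX kX (flank_deg hk) d4 _; rewrite m_sym.
    by have := XD d dX; rewrite dD eq_sym (nd s) // => /(_ isT).
  have fs := elimT (fatP m X) fX s sX.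
  have [k [nk kX msk]] : exists k, [/\ h != k, k \notin X & 0 < m s k].
    case: ss => [e|mss]; first by exists h'; rewrite nhh hX // m_sym e.
    exists s'; rewrite eq_sym; split=> //; apply/negP=> s'X.
    by have := XD s' s'X; rewrite s'D (eq_sym s') (adj_neq mss) => /(_ isT).
  have := @dg_out2 _ m X s h k (hX h hh mdh) kX nk; rewrite -/(deg s) s3 m_sym ms.
  by move: fs msk; lia_num.
right; have tp : oneflank D d h.
  split=> // x hx mdx; apply/eqP/negPn/negP=> nx.
  by have := un x; rewrite /= hx mdx nx.
have sD : s \notin D by apply/negP=> sD; apply: (oneflank_end oDP tp s3 ms0 sD).
case: (boolP (flank s)) => [hss|ns]; last exact: pay_far td hh mdh ms0 sD (hsc _ s3 ns).
case/negP: dTL; rewrite in_set td /=.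
have [_ _ _ uh] := tp.
have fhd : fh d = h.
  by rewrite /fh; case: pickP => [k /andP[hk mk]|/(_ h)]; [apply: uh | rewrite hh mdh].
rewrite /f1 fhd hh mdh; apply/andP; split.
  by apply/forall_inP=> x /andP[hx mx]; apply/eqP/uh.
by case: pickP => [k /andP[hk mk]|/(_ s)]; [rewrite hk mk | rewrite hss ms0].
Qed.

Lemma quartic_picks : 4 * #|lone3| + 2 * #|Q4| <= vol F F + 2.
Proof.
pose TH := [set d | tight D d].
case: (pickP [pred d in TH | (d \notin TL) && ~~ [exists c in freecore D, d \in pay (tree D c)]]).
  move=> d /and3P[]; rewrite in_set => td dTL /exists_inP np.
  by case: (tight_cover td dTL) => // ex; case: np.
move=> cov; case: trees_star => [//|trees]; case: links_star => [//|links].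
have Q4le : #|Q4| <= #|SP| + #|TH|.
  apply: leq_trans (leq_card_setU _ _); apply/subset_leq_card/subsetP=> d /Q4P[dD d4].
  rewrite !in_set /tight dD d4 eqxx /=.
  by case: (twinned m d); case: (spare m D d).
have THle : #|TH| <= #|TL| + \sum_(T in TT) #|pay T|.
  apply: leq_trans (_ : #|TL| + #|TH :\: TL| <= _).
    by rewrite -(cardsID TL TH) leq_add2r subset_leq_card ?subsetIr.
  rewrite leq_add2l; apply: card_le_sum => d /setDP[dT dTL].
  have := cov d; rewrite /= dT dTL /= => /negbFE/exists_inP[c cF dp].
  by exists (tree D c) => //; apply: imset_f.
have parts := vol_parts; have skc := spare_card.
move: Q4le THle trees links parts skc.
move: (\sum_(T in TT) #|pay T|) #|TH| #|TL| #|SP| #|lone3| #|Q4| => *; lia_num.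
Qed.

(** The volume of the whole web exceeds that of the forest by twice the degrees of
    [D], up to the links inside [D], which are the pairs. *)
Theorem web_count : 10 * #|D| <= vol setT setT + 2 + 5 * #|P|.
Proof.
have star := quartic_picks.
have deg34 d : d \in D -> deg d = 3 \/ deg d = 4 by move=> dD; exact: (optD_deg oDP dD).
pose M := [set d in D | ~~ lone P d].
have cM : #|M| = #|P|.
  rewrite -(card_in_imset (f := fst) (D := P)); last first.
    move=> [a b] [a' b'] p1 p2 /= e; rewrite -e in p2 *.
    have [_ h] := elimT (matchingP _ _ _) (opt_match oDP).
    by rewrite (h _ _ _ p1 p2).
  apply: eq_card => d; rewrite in_set; apply/andP/imsetP => [[dD]|[[a b] ab ->]].
    by case/lonePn=> b db; exists (d, b).
  have [_ aD _ _] := pair_facts oDP ab; split=> //.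
  by apply/negP=> /loneP/(_ b); rewrite ab.
have volDD : vol D D = #|P|.
  rewrite -cM -sum1_card big_mkcond [LHS]big_mkcond; apply: eq_bigr => d _.
  rewrite in_set; case: (boolP (d \in D)) => //= dD.
  case: (boolP (lone P d)) => [/loneP ld|/lonePn[b db]] /=.
    apply: dg_eq0 => x xD; case: (posnP (m d x)) => // mdx.
    by have := adjD_paired oDP dD xD mdx; rewrite (negPf (ld x)).
  have [bd _ bD mdb] := pair_facts oDP db.
  rewrite (dgD1 m d bD) (adj33 mdb (pair_deg oDP db) (pair_deg oDP bd)).
  rewrite dg_eq0 // => x /setD1P[nxb xD]; case: (posnP (m d x)) => // mdx.
  have dx := adjD_paired oDP dD xD mdx.
  have [_ h] := elimT (matchingP _ _ _) (opt_match oDP).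
  by rewrite (h _ _ _ dx db) eqxx in nxb.
have split3 (f : W -> nat) : \sum_(d in D) f d
    = \sum_(d in M) f d + \sum_(d in lone3) f d + \sum_(d in Q4) f d.
  rewrite big_mkcond (big_mkcond (mem M)) (big_mkcond (mem lone3)) (big_mkcond (mem Q4)).
  rewrite -!big_split; apply: eq_bigr => d _; rewrite /= !in_set.
  case: (boolP (d \in D)) => //= dD; case: (boolP (lone P d)) => /=.
    by case: (deg34 d dD) => ->; rewrite /= ?addn0 ?add0n.
  by case/lonePn=> b db; rewrite (pair_deg oDP db) /= !addn0.
have cD : #|D| = #|P| + #|lone3| + #|Q4| by rewrite -sum1_card split3 !sum1_card cM.
have vD : vol D setT = 3 * #|P| + 3 * #|lone3| + 4 * #|Q4|.
  rewrite /vol split3 -cM 3!(mulnC _ #|_|) -!sum_nat_const; congr (_ + _ + _).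
  - by apply: eq_bigr => d /setIdP[_ /lonePn[b db]]; exact: (pair_deg oDP db).
  - by apply: eq_bigr => d /lone3P[].
  - by apply: eq_bigr => d /Q4P[].
have vT : vol setT setT + vol D D = vol F F + 2 * vol D setT.
  have e X : vol X setT = vol X D + vol X F.
    by rewrite (vol_dgD m X (subsetT D)) setTD.
  rewrite volC e (volC m _ D) (volC m _ F) !e (volC m F D); lia_num.
move: star; rewrite cD; move: vT; rewrite volDD vD; lia_num.
Qed.

End Opt.
End Total.

(** * Removing a quartic cell with two free ends *)

Section Reduce.
Variables (W : finType) (m : web W).
Let m_sym := web_sym m.
Let m_irr := web_irr m.
Implicit Types (D X A B : {set W}) (P : {set W * W}) (a c q u x y z : W).
Variables (d h h' s s' : W).
Hypotheses (d4 : deg m d = 4) (hh : flank m h) (hh' : flank m h') (nhh : h != h').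
Hypotheses (mdh : 0 < m d h) (mdh' : 0 < m d h') (nsd : s != d) (ns'd : s' != d).
Hypotheses (mhs : 0 < m h s) (mhs' : 0 < m h' s').
Hypotheses (nss : s != s') (mss : m s s' = 0) (nsh' : s != h').

Let h3 : deg m h = 3 := flank_deg hh.
Let h'3 : deg m h' = 3 := flank_deg hh'.
Let mdh2 : m d h = 2 := adj4E mdh d4 h3.
Let mdh'2 : m d h' = 2 := adj4E mdh' d4 h'3.

Lemma d_nbr z : 0 < m d z -> z = h \/ z = h'.
Proof. by apply: nbrs_all2 => //; rewrite mdh2 mdh'2 d4. Qed.

Lemma end_nbr k t : flank m k -> m d k = 2 -> 0 < m k t -> t != d ->
  [/\ deg m t = 3, m k t = 1 & forall z, 0 < m k z -> z = d \/ z = t].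
Proof.
move=> hk mdk mkt ntd; have [q [t' [q4 t'3 mq mt al]]] := flankP hk.
have qd : d = q by apply: (flank_quartic hk) => //; [rewrite mdk | rewrite m_sym mq].
by case: (al _ mkt) => e; subst; [rewrite eqxx in ntd | split].
Qed.

Let endh := end_nbr hh mdh2 mhs nsd.
Let endh' := end_nbr hh' mdh'2 mhs' ns'd.

Lemma ns'h : s' != h.
Proof.
apply/eqP=> e; have [_ _ al] := endh; rewrite -e in al.
move: mhs'; rewrite m_sym => /al[|] e2; last by move: nsh'; rewrite e2 eqxx.
by move: h'3; rewrite e2 d4.
Qed.

Definition removed := [set d; h; h'].

Lemma removedP x : reflect [\/ x = d, x = h | x = h'] (x \in removed).
Proof.
rewrite !in_setU !in_set1 -orbA.
by apply: (iffP or3P) => [[]/eqP|[]->]; rewrite ?eqxx; [apply: Or31|apply: Or32|apply: Or33|apply: Or31|apply: Or32|apply: Or33].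
Qed.

Lemma s_kept : s \notin removed.
Proof.
apply/removedP=> [[e|e|e]]; first by move: nsd; rewrite e eqxx.
  by move: mhs; rewrite e m_irr.
by move: nsh'; rewrite e eqxx.
Qed.

Lemma s'_kept : s' \notin removed.
Proof.
apply/removedP=> [[e|e|e]]; first by move: ns'd; rewrite e eqxx.
  by have := ns'h; rewrite e eqxx.
by move: mhs'; rewrite e m_irr.
Qed.

(** The only edges that leave the three removed cells are those at [s] and [s']. *)
Lemma dg_removed x : x \notin removed -> dg m removed x = (x == s) + (x == s').
Proof.
move=> xK; have ndk k : deg m k = 3 -> d != k by move=> k3; apply/eqP=> e; rewrite -e d4 in k3.
have -> : dg m removed x = m x d + m x h + m x h'.
  by rewrite /removed -setUA dgU1 ?dgU1 ?dg1 ?addnA // !inE ?negb_or ?ndk.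
have -> : m x d = 0.
  case: (posnP (m x d)) => //; rewrite m_sym => /d_nbr[] e; case/removedP: xK; rewrite e.
    by apply: Or32.
  by apply: Or33.
have [s3 ms alh] := endh; have [s'3 ms' alh'] := endh'.
congr (_ + _).
  case: eqP => [->|ne]; first by rewrite m_sym ms.
  case: (posnP (m x h)) => //; rewrite m_sym => /alh[] // e; case/removedP: xK; rewrite e.
  exact: Or31.
case: eqP => [->|ne]; first by rewrite m_sym ms'.
case: (posnP (m x h')) => //; rewrite m_sym => /alh'[] // e; case/removedP: xK; rewrite e.
exact: Or31.
Qed.

Definition newlink x y := (x == s) && (y == s') || (x == s') && (y == s).
(** The three cells become isolated and one new edge joins the far ends, which keep
    their degrees. *)
Definition rmult x y :=
  if (x \in removed) || (y \in removed) then 0 else m x y + newlink x y.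

Lemma newlink_sym x y : newlink x y = newlink y x.
Proof. by rewrite /newlink orbC; congr (_ || _); rewrite andbC. Qed.

Lemma rmult_sym x y : rmult x y = rmult y x.
Proof. by rewrite /rmult orbC m_sym newlink_sym. Qed.

Lemma rmult_irr x : rmult x x = 0.
Proof.
rewrite /rmult m_irr /newlink; case: ifP => // _; case: eqP => [->|_] /=.
  by rewrite (negPf nss).
by rewrite andbF.
Qed.

Lemma rdeg_removed x : x \in removed -> deg rmult x = 0.
Proof. by move=> xK; apply: big1 => y _; rewrite /rmult xK. Qed.

Lemma rdeg x : x \notin removed -> deg rmult x = deg m x.
Proof.
move=> xK; rewrite /deg (dgD m x (subsetT removed)) setTD.
have -> : dg rmult setT x = \sum_(y in ~: removed) (m x y + newlink x y).
  rewrite /dg big_mkcond [RHS]big_mkcond; apply: eq_bigr => y _.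
  by rewrite !in_setT in_setC /rmult (negPf xK) /=; case: (y \in removed).
rewrite big_split addnC; congr (_ + _); rewrite dg_removed //.
have -> : \sum_(y in ~: removed) newlink x y
    = \sum_(y in ~: removed) ((x == s) * (y == s') + (x == s') * (y == s)).
  apply: eq_bigr => y _; rewrite /newlink; case: (eqVneq x s) => [->|_] /=.
    by rewrite (negPf nss) /= orbF addn0 mul1n.
  by rewrite mul0n add0n mulnb.
have one t : t \notin removed -> \sum_(y in ~: removed) (y == t) = 1.
  move=> tK; rewrite (big_setD1 t) ?in_setC //= eqxx big1 // => y /setD1P[nyt _].
  by rewrite (negPf nyt).
by rewrite big_split -!big_distrr /= !one ?s_kept ?s'_kept // !muln1.
Qed.

Lemma rdeg_le x : deg rmult x <= 4.
Proof.
by case: (boolP (x \in removed)) => [/rdeg_removed->//|/rdeg->]; apply: deg_le.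
Qed.

Lemma rmult_gt0 x y : 0 < rmult x y ->
  [/\ x \notin removed, y \notin removed & rmult x y = m x y \/ newlink x y /\ rmult x y = 1].
Proof.
rewrite /rmult; case: (boolP (x \in removed)) => //= xK; case: (boolP (y \in removed)) => //= yK mxy.
split=> //; case: (boolP (newlink x y)) => [/[dup] nw|_]; last by left; rewrite addn0.
by case/orP=> /andP[/eqP-> /eqP->]; right; split; rewrite // ?mss // m_sym mss.
Qed.

Lemma rdeg_adj x y : 0 < rmult x y -> deg rmult x + deg rmult y = 5 + rmult x y.
Proof.
move=> mxy; have [xK yK [e|[nw ->]]] := rmult_gt0 mxy.
  by rewrite !rdeg // e; apply: deg_adj; rewrite -e.
have [s3 _ _] := endh; have [s'3 _ _] := endh'; rewrite !rdeg //.
by case/orP: nw => /andP[/eqP-> /eqP->]; rewrite s3 s'3.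
Qed.

Definition reduced : web W := Web rmult_sym rmult_irr rdeg_le rdeg_adj.
Local Notation r := reduced.

Lemma le_rmult x y : x \notin removed -> y \notin removed -> m x y <= r x y.
Proof. by rewrite /= /rmult => /negPf-> /negPf->; apply: leq_addr. Qed.

Lemma rvol : vol m setT setT = vol r setT setT + 10.
Proof.
rewrite /vol (big_setID removed) /= setTI setTD [in RHS](big_setID removed) /= setTI setTD.
rewrite [X in _ = X + _ + _]big1; last by move=> x xK; apply: rdeg_removed.
rewrite add0n addnC; congr (_ + _).
  by apply: eq_bigr => x; rewrite in_setC => xK; rewrite -/(deg r x) rdeg.
have ndk k : deg m k = 3 -> d != k by move=> k3; apply/eqP=> e; rewrite -e d4 in k3.
rewrite /removed -setUA big_setU1 /=; last by rewrite !inE negb_or !ndk.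
by rewrite big_setU1 /= ?inE // big_set1 -!/(deg m _) d4 h3 h'3.
Qed.

(** A set closed for the new adjacency becomes closed for the old one by deciding on
    the three removed cells according to [s]. *)
Lemma rlinked : linked m -> linked r.
Proof.
move=> lnk A c x cA dc cl dx.
have nK z : 0 < deg r z -> z \notin removed.
  by move=> dz; apply/negP=> zK; rewrite /= rdeg_removed in dz.
have [cK xK] := (nK c dc, nK x dx).
have rss : 0 < r s s' by rewrite /= /rmult (negPf s_kept) (negPf s'_kept) /newlink !eqxx addn1.
have s'A : s \in A -> s' \in A by move=> sA; apply: cl sA rss.
have sA : s' \in A -> s \in A by move=> s'A'; apply: cl s'A' _; rewrite web_sym.
pose B := [set z | if z \in removed then s \in A else z \in A].
have BE z : (z \in B) = if z \in removed then s \in A else z \in A by rewrite [LHS]in_set.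
have BK z : z \notin removed -> (z \in B) = (z \in A) by rewrite BE => /negPf->.
rewrite -BK //; apply: (lnk _ c) => //; rewrite ?BK //.
- by move: dc; rewrite /= rdeg.
- move=> y z; rewrite !BE; have [s3 _ alh] := endh; have [s'3 _ alh'] := endh'.
  case: (boolP (y \in removed)) => [yK sA1 myz|yK yA myz].
    case: (boolP (z \in removed)) => // zK; case/removedP: yK => e; subst y.
    + by case: (d_nbr myz) => e; case/removedP: zK; rewrite e; [apply: Or32 | apply: Or33].
    + by case: (alh _ myz) => e; [case/removedP: zK; rewrite e; apply: Or31 | rewrite e].
    + by case: (alh' _ myz) => e; [case/removedP: zK; rewrite e; apply: Or31 | rewrite e s'A].
  case: (boolP (z \in removed)) => [zK|zK]; last by apply: cl yA (leq_trans myz _); apply: le_rmult.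
  have : 0 < dg m removed y by apply: leq_trans myz (m_le_dg m y zK).
  rewrite dg_removed //; case: (eqVneq y s) => [<-//|_]; case: (eqVneq y s') => [e|//] _.
  by apply: sA; rewrite -e.
by move: dx; rewrite /= rdeg.
Qed.

Lemma lift_matching D D' P : matching r D' P -> (s, s') \notin P -> D' :\: removed \subset D ->
  matching m D P.
Proof.
move=> /matchingP[h1 h2] nP sub; apply/matchingP; split=> // a b ab.
have [ba aD bD mab] := h1 _ _ ab; have [aK bK e] := rmult_gt0 mab.
split=> //; [apply: (subsetP sub); exact/setDP..|].
case: e => [<-//|[nw _]]; case/orP: nw => /andP[/eqP e1 /eqP e2].
  by rewrite e1 e2 (negPf nP) in ab.
by rewrite e1 e2 (negPf nP) in ba.
Qed.

(** A fat set cannot use a flank without [d], nor [d] without one of its flanks, so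
    the removed cells lie on no cycle. *)
Lemma lift_acyc D D' : acyc r D' -> D' :\: removed \subset D -> d \in D \/ h \in D /\ h' \in D ->
  acyc m D.
Proof.
move=> /acycP ac sub dD; apply/acycP=> X c fX XD cX.
have nm x : x \in D -> x \notin X.
  by move=> xD; apply/negP=> /XD; rewrite xD.
have XK x : x \in X -> x \notin removed.
  case: dD => [dD|[hD h'D]] xX; apply/removedP=> e.
  - have dX := nm _ dD.
    have hX k : deg m k = 3 -> m d k = 2 -> k \notin X.
      move=> k3 mk; apply: contra dX => kX; apply: fat_drop fX kX _.
      by rewrite m_sym mk k3.
    by case: e xX => ->; apply/negP=> //; apply: hX.
  - have hX := nm _ hD; have h'X := nm _ h'D.
    case: e xX => ->; apply/negP=> //; apply/negP=> dX.
    case: (fat_drop2 fX dX nhh); rewrite ?mdh2 ?mdh'2 ?d4 //; exact/negP.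
apply: (ac X c) => //.
  apply/fatP=> x xX; apply: leq_trans (elimT (fatP _ _) fX x xX) _.
  by apply: leq_sum => y yX; apply: le_rmult; apply: XK.
move=> x xX; apply/negP=> xD'; have := XD x xX.
by rewrite (subsetP sub) //; apply/setDP; split=> //; apply: XK.
Qed.

(** If the new edge is a pair, its ends are paired with the flanks instead, at the
    cost of two picks and one more pair; otherwise [d] is picked. *)
Lemma lift_valid D' P' : valid r D' P' -> exists D P,
  valid m D P /\ 2 * #|D| + #|P'| <= 2 * #|D'| + 2 + #|P|.
Proof.
case/andP=> ac mt; have [h1 h2] := elimT (matchingP _ _ _) mt.
have c0 : #|D' :\: removed| <= #|D'| by apply/subset_leq_card/subsetDl.
case: (boolP ((s, s') \in P')) => [ss|nss']; last first.
  exists (d |: (D' :\: removed)), P'; split.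
    apply/andP; split; first by apply: (lift_acyc ac); [apply: subsetUr | left; apply: setU11].
    by apply: (lift_matching mt) => //; apply: subsetUr.
  have : #|d |: (D' :\: removed)| <= 1 + #|D'| by rewrite cardsU1 leq_add // leq_b1.
  lia_num.
have [mt1 cP1] := matching_del mt ss (subD1set _ _).
set P1 := delp s s' P' in mt1 cP1; pose D := h |: (h' |: (D' :\: removed)).
have sub : D' :\: removed \subset D by apply: subset_trans (subsetUr _ _) (subsetUr _ _).
have mtD : matching m D P1.
  apply: (lift_matching mt1); first by rewrite !in_setD1 eqxx andbF.
  by [].
have inP1 p : p \in P1 -> p \in P' by rewrite !in_setD1 => /and3P[].
have ls : lone P1 s.
  apply/loneP=> b; apply/negP=> /[dup] sb /inP1 sb'.
  by move: sb; rewrite (h2 _ _ _ sb' ss) !in_setD1 eqxx andbF.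
have [s's sD' s'D' _] := h1 _ _ ss.
have ls' : lone P1 s'.
  apply/loneP=> b; apply/negP=> /[dup] sb /inP1 sb'.
  by move: sb; rewrite (h2 _ _ _ sb' s's) !in_setD1 eqxx.
have lK k : k \in removed -> lone P1 k.
  move=> kK; apply/loneP=> b; apply/negP=> /inP1/h1[_ _ _ /rmult_gt0[]].
  by rewrite kK.
have hK : h \in removed by apply/removedP/Or32.
have h'K : h' \in removed by apply/removedP/Or33.
have nsh : s != h by apply/eqP=> e; have := s_kept; rewrite e hK.
have ns'h' : s' != h' by apply/eqP=> e; have := s'_kept; rewrite e h'K.
have hD : h \in D by apply: setU11.
have h'D : h' \in D by apply/setU1P; right; apply: setU11.
have sD : s \in D by apply: (subsetP sub); apply/setDP; rewrite s_kept.
have s'D : s' \in D by apply: (subsetP sub); apply/setDP; rewrite s'_kept.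
have ladd x : lone P1 x -> x != s -> x != h -> lone (addp s h P1) x.
  move=> /loneP lx nx nx'; apply/loneP=> b; rewrite /addp !in_setU1 !xpair_eqE.
  by rewrite (negPf nx) (negPf nx') /= lx.
have ls'2 : lone (addp s h P1) s' by apply: ladd => //; [rewrite eq_sym | exact: ns'h].
have lh'2 : lone (addp s h P1) h'.
  by apply: ladd; rewrite ?lK // eq_sym.
exists D, (addp s' h' (addp s h P1)); split.
  apply/andP; split; first by apply: (lift_acyc ac sub); right.
  apply: matching_add => //; last by rewrite m_sym.
  apply: matching_add => //; by [rewrite m_sym | apply: lK].
have e1 : #|addp s h P1| = #|P1| + 2 by apply: card_addp => //; apply: lK.
have e2 : #|addp s' h' (addp s h P1)| = #|addp s h P1| + 2 by apply: card_addp.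
rewrite e2 e1 -cP1.
have : #|D| <= 2 + #|D'|.
  have cU x (S : {set W}) : #|x |: S| <= 1 + #|S| by rewrite cardsU1 leq_add2r leq_b1.
  apply: leq_trans (cU _ _) _; rewrite -(addn1 1) -addnA leq_add2l.
  by apply: leq_trans (cU _ _) _; rewrite leq_add2l.
lia_num.
Qed.

End Reduce.

(** Each reduction lowers the volume, and irreducible webs are settled by
    [web_count]. *)
Theorem web_bound W (m : web W) : linked m -> exists D P,
  valid m D P /\ 10 * #|D| <= vol m setT setT + 2 + 5 * #|P|.
Proof.
have [n] := ubnP (vol m setT setT); elim: n m => // n IH m; rewrite ltnS => le lnk.
pose ok d h h' s s' := [&& deg m d == 4, flank m h, flank m h', h != h' & [&& 0 < m d h,
  0 < m d h', s != d, s' != d & [&& 0 < m h s, 0 < m h' s', s != s', m s s' == 0 & s != h']]].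
case: (pickP [pred p : W * W * W * W * W | ok p.1.1.1.1 p.1.1.1.2 p.1.1.2 p.1.2 p.2]).
  case=> [[[[d h] h'] s] s'] /= /and5P[/eqP d4 hh hh' nhh] /and5P[mdh mdh' nsd ns'd].
  case/and5P=> mhs mhs' nss /eqP mss nsh'.
  pose r := reduced d4 hh hh' nhh mdh mdh' nsd ns'd mhs mhs' nss mss nsh'.
  have rv : vol m setT setT = vol r setT setT + 10 by apply: rvol.
  have [||D' [P' [v le']]] := IH r.
  - by move: le; rewrite rv; lia_num.
  - exact: rlinked.
  have [D [P [vD leD]]] := lift_valid v; exists D, P; split=> //.
  by move: leD le'; rewrite rv; move: (vol r _ _) #|D| #|D'| #|P| #|P'| => *; lia_num.
move=> np; have [D [P [oDP minflanked]]] := opt_exists m.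
exists D, P; split; first by case: oDP.
apply: (web_count oDP minflanked) => // d h h' s s' d4 hh hh' nhh mdh mdh' nsd ns'd mhs mhs'.
have := np (d, h, h', s, s'); rewrite /= /ok d4 eqxx hh hh' nhh mdh mdh' nsd ns'd mhs mhs' /=.
case: (eqVneq s s') => [e _|_]; first by apply: Or31.
case: (posnP (m s s')) => [_|mss _]; last by apply: Or32.
by case: (eqVneq s h') => // e _; apply: Or33.
Qed.

(** * From a system of cells to a power dominating set *)

Section Observation.
Variable G : sgraph.
Implicit Types (S O : {set G}) (u v w x : G).

Definition obs S : {set G} := observed_after #|G| S.

Lemma init_after S i : initially_observed S \subset observed_after i S.
Proof.
by elim: i => // i IH; apply: subset_trans IH (sub_propagate _).
Qed.

Lemma obs_nbh S x : x \in S -> closed_nbh x \subset obs S.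
Proof.
by move=> xS; apply: subset_trans (init_after S _); apply: bigcup_sup xS.
Qed.

Lemma obs_force S v u : v \in obs S -> adj v u ->
  (forall w, adj v w -> w != u -> w \in obs S) -> u \in obs S.
Proof.
move=> vO vu al; apply/negPn/negP=> uO; case/negP: (uO).
rewrite -[obs S]observed_after_stable in_setU; apply/orP; right; rewrite in_set.
apply/exists_inP; exists v => //; apply/eqP/setP=> w.
rewrite in_setD in_set1 in_set; case: (eqVneq w u) => [->|nwu].
  by rewrite vu uO.
by case: (boolP (adj v w)) => [vw|]; rewrite ?andbF // (al _ vw nwu).
Qed.

Lemma nbhP v x : reflect (x = v \/ adj v x) (x \in closed_nbh v).
Proof. by rewrite /closed_nbh in_setU1 in_set; apply: (iffP orP) => [[/eqP|]|[->|]]; auto. Qed.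

Lemma gamma_le S : obs S = setT -> power_domination_number G <= #|S|.
Proof. by move=> E; have [_] := power_domination_numberP G; apply; apply/eqP. Qed.

Lemma connected_closed (A : {set G}) v : connected G -> v \in A ->
  (forall x y, x \in A -> adj x y -> y \in A) -> A = [set: G].
Proof.
case=> _ con vA cl; apply/setP=> u; rewrite in_setT.
case/connectP: (con v u) => p; elim: p v vA => [v vA _ ->//|y p IH v vA /= /andP[vy]].
by apply: IH; apply: cl vA vy.
Qed.

End Observation.

Section CellSystem.
Variables (G : sgraph) (C : {set {set G}}).
Hypotheses (reg : regular 4 G) (con : connected G).
Hypothesis cells : forall x : G, exists c1 c2, [/\ c1 != c2, c1 \in C, c2 \in C,
  c1 :|: c2 = closed_nbh x & forall c, c \in C -> (x \in c) = (c == c1) || (c == c2)].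
Hypothesis C4 : forall c, c \in C -> #|c| <= 4.
Implicit Types (S : {set G}) (u v w x : G) (c : {set G}) (X D : {set {set G}}).

Lemma nbh5 x : #|closed_nbh x| = 5.
Proof. by rewrite /closed_nbh cardsU1 (reg x) in_set adj_irrefl. Qed.

(** Sets that are not cells are isolated. *)
Definition cmult c c' := if [&& c \in C, c' \in C & c != c'] then #|c :&: c'| else 0.

Lemma cmult_sym c c' : cmult c c' = cmult c' c.
Proof. by rewrite /cmult andbCA eq_sym setIC. Qed.

Lemma cmult_irr c : cmult c c = 0.
Proof. by rewrite /cmult eqxx !andbF. Qed.

Definition others c x := [set c' in C | (c' != c) && (x \in c')].

Lemma other_cell c x : c \in C -> x \in c ->
  exists c', [/\ others c x = [set c'], c' != c, c' \in C, x \in c' & c :|: c' = closed_nbh x].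
Proof.
move=> cC xc; have [c1 [c2 [n12 c1C c2C U al]]] := cells x.
have x1 : x \in c1 by rewrite al // eqxx.
have x2 : x \in c2 by rewrite al // eqxx orbT.
have := xc; rewrite al // => /orP[]/eqP e; subst c; [exists c2 | exists c1].
  split; rewrite // 1?eq_sym //; apply/setP=> c'; rewrite in_set in_set1.
  case: (boolP (c' \in C)) => [c'C|]; last by move=> nC; apply/esym; apply: contraNF nC => /eqP->.
  rewrite al //=; case: (eqVneq c' c1) => [->|_] //=.
  by rewrite (negPf n12).
split; rewrite // 1?setUC //; apply/setP=> c'; rewrite in_set in_set1.
case: (boolP (c' \in C)) => [c'C|]; last by move=> nC; apply/esym; apply: contraNF nC => /eqP->.
rewrite al //= andb_orr andNb orbF andbC; case: (eqVneq c' c1) => [->|_] //=.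
Qed.

Lemma cmult_sum X c : c \in C ->
  dg cmult X c = \sum_(x in c) #|X :&: others c x|.
Proof.
move=> cC; rewrite /dg.
under eq_bigr => c' _.
  have -> : cmult c c' = \sum_(x in c) (c' \in others c x).
    rewrite /cmult cC /=; under eq_bigr do rewrite in_set eq_sym.
    case: ifP => [/andP[-> ->]|nc] /=.
      rewrite -sum1_card big_mkcond [RHS]big_mkcond; apply: eq_bigr => x _.
      by rewrite in_setI; case: (x \in c); case: (x \in c').
    by rewrite big1 // => x _; rewrite andbA nc.
  over.
rewrite exchange_big; apply: eq_bigr => x _.
rewrite -sum1_card big_mkcond [RHS]big_mkcond; apply: eq_bigr => c' _.
by rewrite in_setI; case: (c' \in X); case: (c' \in others c x).
Qed.

Lemma cmult_deg c : c \in C -> deg cmult c = #|c|.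
Proof.
move=> cC; rewrite /deg cmult_sum // -sum1_card; apply: eq_bigr => x xc.
by have [c' [E _ _ _ _]] := other_cell cC xc; rewrite setTI E cards1.
Qed.

Lemma cmult_deg0 c : c \notin C -> deg cmult c = 0.
Proof. by move=> cC; apply: big1 => c' _; rewrite /cmult (negPf cC). Qed.

Lemma cmult_deg_le c : deg cmult c <= 4.
Proof.
by case: (boolP (c \in C)) => [cC|/cmult_deg0->//]; rewrite cmult_deg ?C4.
Qed.

Lemma cmult_gt0 c c' : 0 < cmult c c' ->
  [/\ c \in C, c' \in C, c != c' & cmult c c' = #|c :&: c'|].
Proof. by rewrite /cmult; case: ifP => // /and3P[]. Qed.

Lemma cmultI c c' x : c \in C -> c' \in C -> c != c' -> x \in c -> x \in c' -> 0 < cmult c c'.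
Proof.
move=> cC c'C n xc xc'; rewrite /cmult cC c'C n; apply/card_gt0P; exists x.
by rewrite in_setI xc.
Qed.

Lemma cell_nbh c c' x : c \in C -> c' \in C -> c != c' -> x \in c -> x \in c' ->
  c :|: c' = closed_nbh x.
Proof.
move=> cC c'C ncc' xc xc'; have [c0 [E _ _ _ <-]] := other_cell cC xc.
have : c' \in others c x by rewrite in_set c'C eq_sym ncc'.
by rewrite E => /set1P->.
Qed.

Lemma cmult_adj c c' : 0 < cmult c c' ->
  deg cmult c + deg cmult c' = 5 + cmult c c'.
Proof.
move=> /[dup] mcc /cmult_gt0[cC c'C ncc e]; rewrite !cmult_deg // e.
move: mcc; rewrite e => /card_gt0P[x]; rewrite in_setI => /andP[xc xc'].
by rewrite -cardsUI (cell_nbh cC c'C ncc xc xc') nbh5.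
Qed.

Definition cweb : web {set G} := Web cmult_sym cmult_irr cmult_deg_le cmult_adj.

Lemma cweb_vol : vol cweb setT setT = 2 * #|G|.
Proof.
rewrite /vol (big_setID C) /= setTI setTD [X in _ + X]big1; last first.
  by move=> c; rewrite in_setC => /cmult_deg0.
rewrite addn0.
transitivity (\sum_(c in C) \sum_(x : G) (x \in c)).
  by apply: eq_bigr => c cC; rewrite -/(deg _ c) /= cmult_deg // -sum1_card big_mkcond.
rewrite exchange_big mulnC -sum_nat_const; apply: eq_bigr => x _ /=.
have [c1 [c2 [n12 c1C c2C _ al]]] := cells x.
transitivity (\sum_(c in C) ((c == c1) + (c == c2))).
  apply: eq_bigr => c cC; rewrite al //; case: (eqVneq c c1) => [->|]//=.
  by rewrite (negPf n12).
have one c0 : c0 \in C -> \sum_(c in C) (c == c0) = 1.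
  move=> c0C; rewrite (big_setD1 c0) //= eqxx big1 // => c /setD1P[n _].
  by rewrite (negPf n).
by rewrite big_split /= !one.
Qed.

(** Every vertex of [G] lies in two cells, which meet there, so connectedness carries
    over from the vertices to the cells. *)
Lemma cweb_linked : linked cweb.
Proof.
move=> A c c0 cA dc cl dc0.
have inC k : 0 < deg cweb k -> k \in C /\ exists x, x \in k.
  case: (boolP (k \in C)) => kC /=; last by rewrite cmult_deg0.
  by rewrite cmult_deg // => /card_gt0P[x xk]; split=> //; exists x.
have [cC [x xc]] := inC _ dc; have [c0C [y yc0]] := inC _ dc0.
pose V := [set v | [exists k in A, (k \in C) && (v \in k)]].
have allA v k : v \in V -> k \in C -> v \in k -> k \in A.
  rewrite in_set => /exists_inP[k' k'A /andP[k'C vk']] kC vk.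
  case: (eqVneq k' k) => [<-//|n]; apply: cl k'A _; exact: cmultI vk' vk.
apply: (allA y) => //; have -> : V = setT; last by rewrite in_setT.
apply: (connected_closed con (v := x)).
  by rewrite in_set; apply/exists_inP; exists c; rewrite ?cC.
move=> v u vV vu; have [c1 [c2 [n12 c1C c2C U al]]] := cells v.
have uN : u \in c1 :|: c2 by rewrite U; apply/nbhP; right.
rewrite in_set; apply/exists_inP; case/setUP: uN => [u1|u2].
  by exists c1; rewrite ?c1C // (allA v) // al // eqxx.
by exists c2; rewrite ?c2C // (allA v) // al // eqxx orbT.
Qed.

Lemma cell_sub c x : c \in C -> x \in c -> c \subset closed_nbh x.
Proof. by move=> cC xc; have [c' [_ _ _ _ <-]] := other_cell cC xc; apply: subsetUl. Qed.

(** Picks meeting every chosen cell dominate: the last cells that are not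
    observed contain one with a single link to the others. *)
Lemma picks_dominate D S : acyc cweb D ->
  (forall c, c \in C -> c \in D -> c != set0 -> exists2 x, x \in S & x \in c) ->
  obs S = setT.
Proof.
move=> ac meets; pose X := [set c in C | ~~ (c \subset obs S)].
have XD c : c \in X -> c \notin D.
  case/setIdP=> cC ncO; apply: contra ncO => cD.
  case: (eqVneq c set0) => [->|nc]; first exact: sub0set.
  have [x xS xc] := meets c cC cD nc.
  exact: subset_trans (cell_sub cC xc) (obs_nbh xS).
case: (set_0Vmem X) => [X0|[c0 c0X]].
  apply/setP=> x; rewrite in_setT; have [c1 [c2 [_ c1C _ _ al]]] := cells x.
  have : c1 \notin X by rewrite X0 in_set0.
  rewrite in_set c1C negbK => /subsetP; apply; by rewrite al // eqxx.
exfalso; case: (boolP (fat cweb X)) => [fX|].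
  by apply: (elimT (acycP _ _) ac X c0 fX).
rewrite negb_forall_in => /exists_inP[c cX]; rewrite -ltnNge ltnS => le1.
have [cC /subsetPn[v vc vO]] := setIdP cX.
have XO k : k \in C -> k \notin X -> k \subset obs S by move=> kC; rewrite in_set kC negbK.
have [c' [Ev nc' c'C vc' Uv]] := other_cell cC vc.
have c'X : c' \in X by rewrite in_set c'C; apply/subsetPn; exists v.
have no w : w \in c -> w != v -> X :&: others c w = set0.
  move=> wc nwv; apply/eqP; rewrite -cards_eq0 -leqn0 -ltnS.
  apply: leq_trans le1; rewrite cmult_sum // (big_setD1 v) //= Ev.
  have -> : X :&: [set c'] = [set c'] by apply/setIidPr; rewrite sub1set.
  rewrite cards1 ltnS (big_setD1 w) ?in_setD1 ?nwv //=.
  exact: leq_addr.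
have seen w : w \in c -> w != v -> closed_nbh w \subset v |: obs S.
  move=> wc nwv; have [k [Ew nk kC wk <-]] := other_cell cC wc.
  have kX : k \notin X by apply/negP=> kX; have /setP/(_ k) := no w wc nwv; rewrite in_setI kX Ew in_set0 set11.
  have kO := XO k kC kX; rewrite subUset; apply/andP; split; last first.
    by apply: subset_trans kO (subsetUr _ _).
  apply/subsetP=> z zc; rewrite in_setU1; case: (eqVneq z v) => //= nzv.
  have [kz [Ez nkz kzC zkz _]] := other_cell cC zc.
  have kzX : kz \notin X by apply/negP=> kzX; have /setP/(_ kz) := no z zc nzv; rewrite in_setI kzX Ez in_set0 set11.
  exact: (subsetP (XO kz kzC kzX)).
have [w wc wc'] : exists2 w, w \in c & w \notin c'.
  apply/subsetPn; apply/negP=> sub; have := C4 c'C.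
  by rewrite -(setUidPr sub) Uv nbh5.
have nwv : w != v by apply: contra wc' => /eqP->.
have wO : w \in obs S.
  have /subsetP/(_ w) := seen w wc nwv; rewrite in_setU1 (negPf nwv) /=; apply.
  by apply/nbhP; left.
case/negP: vO; apply: (obs_force wO).
  have /subsetP/(_ v vc) /nbhP[e|//] := cell_sub cC wc.
  by rewrite e eqxx in nwv.
move=> z wz nzv; have /subsetP/(_ z) := seen w wc nwv; rewrite in_setU1 (negPf nzv) /=; apply.
by apply/nbhP; right.
Qed.

(** Paired cells choose the same common vertex. *)
Lemma pick_vertices D P : matching cweb D P -> exists S, 2 * #|S| + #|P| <= 2 * #|D| /\
  forall c, c \in C -> c \in D -> c != set0 -> exists2 x, x \in S & x \in c.
Proof.
move=> /matchingP[mt1 mt2].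
pose f c := if [pick b | (c, b) \in P] is Some b then [pick x in c :&: b] else [pick x in c].
have fP a b : (a, b) \in P -> f a = [pick x in a :&: b].
  move=> ab; rewrite /f; case: pickP => [b' ab'|/(_ b)]; last by rewrite ab.
  by rewrite (mt2 _ _ _ ab ab').
pose M := [set c in D | ~~ lone P c].
have cM : #|M| = #|P|.
  rewrite -(card_in_imset (f := fst) (D := P)); last first.
    by move=> [a b] [a' b'] p1 p2 /= e; rewrite -e in p2 *; rewrite (mt2 _ _ _ p1 p2).
  apply: eq_card => d; rewrite in_set; apply/andP/imsetP => [[dD]|[[a b] ab ->]].
    by case/lonePn=> b db; exists (d, b).
  have [_ aD _ _] := mt1 _ _ ab; split=> //.
  by apply/negP=> /loneP/(_ b); rewrite ab.
have fM : 2 * #|f @: M| <= #|P|.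
  rewrite -cM mulnC -sum_nat_const -[#|M|]sum1_card.
  rewrite (partition_big f (mem (f @: M))) /=; last by move=> c cM'; apply: imset_f.
  apply: leq_sum => _ /imsetP[a aM ->]; have [aD /lonePn[b ab]] := setIdP aM.
  have [ba _ bD mab] := mt1 _ _ ab.
  have nab : a != b by apply: adj_neq mab.
  have bM : b \in M by rewrite in_set bD; apply/negP=> /loneP/(_ a); rewrite ba.
  rewrite (bigD1 a) /=; last by rewrite aM eqxx.
  rewrite (bigD1 b) /=; last by rewrite bM (fP _ _ ab) (fP _ _ ba) setIC eqxx eq_sym.
  by rewrite addnA leq_addr.
exists [set x | Some x \in f @: D]; split.
  have : #|[set x | Some x \in f @: D]| <= #|f @: D|.
    have si : injective (@Some G) by move=> x y [].
    rewrite -(card_imset _ si); apply/subset_leq_card/subsetP=> _ /imsetP[x xS ->].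
    by rewrite in_set in xS.
  have : #|f @: D| <= #|f @: M| + #|D :\: M|.
    have -> : D = M :|: (D :\: M).
      by apply/setP=> c; rewrite in_setU in_setD [c \in M]in_set; case: (lone P c); case: (c \in D).
    rewrite imsetU setDUl setDv set0U setDDl setUid.
    by apply: leq_trans (leq_card_setU _ _) _; rewrite leq_add2l leq_imset_card.
  have : #|M| + #|D :\: M| = #|D|.
    by rewrite -(cardsID M D) (setIidPr _) //; apply/subsetP=> c /setIdP[].
  rewrite cM; move: fM; lia_num.
move=> c cC cD nc; suff [x fx xc] : exists2 x, f c = Some x & x \in c.
  by exists x => //; rewrite in_set -fx imset_f.
rewrite /f; case: pickP => [b cb|_].
  case: pickP => [x|no]; first by rewrite in_setI => /andP[xc _]; exists x.
  have [_ _ _ /cmult_gt0[_ _ _ e]] := mt1 _ _ cb.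
  have [_ _ _] := mt1 _ _ cb; rewrite /= e => /card_gt0P[x xI].
  by have := no x; rewrite /= xI.
case: pickP => [x xc|no]; first by exists x.
by case/set0Pn: nc => x xc; have := no x; rewrite /= xc.
Qed.

Theorem cells_bound : 5 * power_domination_number G <= #|G| + 1.
Proof.
have [D [P [/andP[ac mt] le]]] := web_bound cweb_linked.
have [S [leS meets]] := pick_vertices mt.
have gle := gamma_le (picks_dominate ac meets).
move: le; rewrite cweb_vol; move: leS gle.
move: #|D| #|P| #|S| (power_domination_number G) #|G| => *; lia_num.
Qed.

End CellSystem.

(** * Cells of a claw-free quartic graph *)

Section ClawFree.
Variable G : sgraph.
Implicit Types (u v w x y z a b c d : G) (K : {set G}).

Lemma adj_ne u v : adj u v -> u != v.
Proof. by apply: contraL => /eqP->; rewrite adj_irrefl. Qed.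

Lemma adjC u v : adj u v = adj v u. Proof. exact: adj_sym. Qed.

(** Numbers the vertices of the claw, the centre being [0]. *)
Definition star_vertex (n : nat) : 'I_1 + 'I_3 := if n is k.+1 then inr (inord k) else inl ord0.

Lemma no_claw v x y z : claw_free G -> adj v x -> adj v y -> adj v z ->
  x != y -> x != z -> y != z -> [|| adj x y, adj x z | adj y z].
Proof.
move=> cf vx vy vz nxy nxz nyz; apply/negPn/negP; rewrite !negb_or => /and3P[xy xz yz].
pose s := [:: v; x; y; z]; pose S := [set u in s].
have us : uniq s by rewrite /= !inE !negb_or nxy nxz nyz !(adj_ne vx, adj_ne vy, adj_ne vz).
have iS (u : {u : G | u \in S}) : val u \in s by have := valP u; rewrite inE.
pose f (u : induced S) := star_vertex (index (val u) s).
have fi : injective f.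
  move=> u w e; apply: val_inj; rewrite -(nth_index v (iS u)) -[RHS](nth_index v (iS w)).
  congr nth; have := iS u; have := iS w; rewrite -!index_mem.
  move: e; rewrite /f; move: (index _ s) (index _ s) => k l.
  case: k l => [|k] [|l] //= e l1 l2.
  by case: e => /(congr1 val); rewrite /= !inordK // => ->.
apply: (cf S); exists f.
  apply: inj_card_bij fi _; rewrite card_sum !card_ord.
  by rewrite (eq_card (B := {: {u : G | u \in S}})) // card_sig cardsE; move/card_uniqP: us => ->.
have ad k l : k < 4 -> l < 4 ->
    adj (star_vertex k : Kmn 1 3) (star_vertex l : Kmn 1 3) = adj (nth v s k) (nth v s l).
  case: k => [|[|[|[|k]]]]; case: l => [|[|[|[|l]]]] //= _ _;
  by rewrite ?adj_irrefl // ?vx ?vy ?vz ?(negPf xy) ?(negPf xz) ?(negPf yz) //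
    adj_sym ?vx ?vy ?vz ?(negPf xy) ?(negPf xz) ?(negPf yz).
move=> u w; rewrite /f ad ?nth_index ?index_mem //; exact: iS.
Qed.

Lemma nbr4 v a b c d z : regular 4 G -> uniq [:: a; b; c; d] ->
  adj v a -> adj v b -> adj v c -> adj v d -> adj v z -> [\/ z = a, z = b, z = c | z = d].
Proof.
move=> reg u va vb vc vd vz; have : z \in [set x in [:: a; b; c; d]].
  suff -> : [set x in [:: a; b; c; d]] = open_nbh v by rewrite inE.
  apply/eqP; rewrite eqEcard reg cardsE; move/card_uniqP: u => ->; rewrite leqnn andbT.
  by apply/subsetP=> x; rewrite !inE => /or4P[]/eqP->.
by rewrite !inE => /or4P[]/eqP->; [apply: Or41|apply: Or42|apply: Or43|apply: Or44].
Qed.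

Lemma fourth v a b c : regular 4 G -> exists z, [/\ adj v z, z != a, z != b & z != c].
Proof.
move=> reg; have : ~~ (open_nbh v \subset [set x in [:: a; b; c]]).
  apply/negP=> /subset_leq_card; rewrite reg cardsE.
  by move/leq_trans/(_ (card_size _)).
case/subsetPn=> z; rewrite !inE !negb_or => vz /and3P[? ? ?]; by exists z.
Qed.

Definition clique K := [forall x in K, forall y in K, (x != y) ==> adj x y].

Lemma cliqueP K : reflect {in K &, forall x y, x != y -> adj x y} (clique K).
Proof.
apply: (iffP forall_inP) => [h x y xK yK|h x xK]; first exact/implyP/(forall_inP (h x xK)).
by apply/forall_inP=> y yK; apply/implyP; apply: h.
Qed.

Definition sun K := (#|K| == 3) && [forall x in K, forall y in K, (x != y) ==>
  [exists z, [&& z \notin K, adj z x & adj z y]]].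

Lemma sunE K x y : sun K -> x \in K -> y \in K -> x != y ->
  exists z, [/\ z \notin K, adj z x & adj z y].
Proof.
case/andP=> _ /forall_inP h xK yK n; have /existsP[z /and3P[? ? ?]] :=
  implyP (forall_inP (h x xK) y yK) n.
by exists z.
Qed.

Definition tri x y z : {set G} := [set x; y; z].

Lemma triP x y z u : reflect [\/ u = x, u = y | u = z] (u \in tri x y z).
Proof.
rewrite !in_setU !in_set1 -orbA; apply: (iffP or3P) => [[]/eqP->|[]->]; rewrite ?eqxx;
by [apply: Or31|apply: Or32|apply: Or33].
Qed.

Lemma tri_in x y z u : (u \in tri x y z) = [|| u == x, u == y | u == z].
Proof. by rewrite !in_setU !in_set1 -orbA. Qed.

Lemma tri_clique x y z : adj x y -> adj x z -> adj y z -> clique (tri x y z).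
Proof.
move=> xy xz yz; apply/cliqueP=> u w /triP[]-> /triP[]-> //; rewrite ?eqxx //;
by rewrite 1?adjC.
Qed.

Lemma card_tri x y z : adj x y -> adj x z -> adj y z -> #|tri x y z| = 3.
Proof.
move=> /adj_ne xy /adj_ne xz /adj_ne yz.
by rewrite /tri setUC cardsU1 cards2 !inE negb_or !(eq_sym z) xy xz yz.
Qed.

Lemma sunI x y z p q r : adj x y -> adj x z -> adj y z ->
  [/\ adj p x, adj p y & p != z] -> [/\ adj q x, adj q z & q != y] ->
  [/\ adj r y, adj r z & r != x] -> sun (tri x y z).
Proof.
move=> xy xz yz [px py pz] [qx qz qy] [ry rz rx].
have out t : t != x -> t != y -> t != z -> t \notin tri x y z.
  by move=> h1 h2 h3; apply/triP=> -[] e; [rewrite e eqxx in h1|rewrite e eqxx in h2|rewrite e eqxx in h3].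
have pK : p \notin tri x y z by apply: out => //; apply: adj_ne.
have qK : q \notin tri x y z by apply: out => //; apply: adj_ne.
have rK : r \notin tri x y z by apply: out => //; apply: adj_ne.
apply/andP; split; first by rewrite card_tri.
apply/forall_inP=> u uK; apply/forall_inP=> w wK; apply/implyP.
case/triP: uK => ->; case/triP: wK => ->; rewrite ?eqxx // => _; apply/existsP;
solve [by exists p; rewrite pK px py | by exists q; rewrite qK qx qz | by exists r; rewrite rK ry rz].
Qed.

(** A certificate that [c1] and [c2] are the two cells at [v]: every clique at [v]
    extends into one of them or into a sun. *)
Definition two_cells v (c1 c2 : {set G}) :=
  [/\ [/\ clique c1, clique c2, ~~ sun c1 & ~~ sun c2], v \in c1 /\ v \in c2,
      c1 :|: c2 = closed_nbh v, ~~ (c1 \subset c2) /\ ~~ (c2 \subset c1) &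
      forall K, clique K -> v \in K -> [\/ K \subset c1, K \subset c2 |
        exists K', [/\ K \subset K', clique K', sun K',
          ~~ (c1 \subset K') & ~~ (c2 \subset K')]]].

Definition graph_cells := [set K | maxset clique K && ~~ sun K].

Lemma two_cellsP v (c1 c2 : {set G}) : two_cells v c1 c2 ->
  [/\ c1 != c2, c1 \in graph_cells, c2 \in graph_cells, c1 :|: c2 = closed_nbh v &
      forall c : {set G}, c \in graph_cells -> (v \in c) = (c == c1) || (c == c2)].
Proof.
case=> [[q1 q2 s1 s2] [v1 v2] U [n12 n21] al].
have max1 : maxset clique c1.
  apply/maxsetP; split=> // B qB sB.
  case: (al B qB (subsetP sB _ v1)) => [h|h|[K' [h _ _ nK _]]].
  - by apply/eqP; rewrite eqEsubset h.
  - by rewrite (subset_trans sB h) in n12.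
  - by rewrite (subset_trans sB h) in nK.
have max2 : maxset clique c2.
  apply/maxsetP; split=> // B qB sB.
  case: (al B qB (subsetP sB _ v2)) => [h|h|[K' [h _ _ _ nK]]].
  - by rewrite (subset_trans sB h) in n21.
  - by apply/eqP; rewrite eqEsubset h.
  - by rewrite (subset_trans sB h) in nK.
split=> //; first by apply: contra n12 => /eqP->.
- by rewrite in_set max1.
- by rewrite in_set max2.
move=> c; rewrite in_set => /andP[/maxsetP[qc mc] sc].
apply/idP/orP => [vc|[]/eqP->//].
case: (al c qc vc) => [h|h|[K' [h qK sK _ _]]].
- by left; rewrite (mc _ q1 h).
- by right; rewrite (mc _ q2 h).
- by rewrite -(mc _ qK h) sK in sc.
Qed.

(** Four neighbours that induce a path or, if also [adj a d], a cycle. *)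
Definition path4 v a b c d :=
  [/\ [/\ adj v a, adj v b, adj v c & adj v d], [/\ adj a b, adj b c & adj c d],
      a != c /\ ~~ adj a c & b != d /\ ~~ adj b d].

Lemma path4_rev v a b c d : path4 v a b c d -> path4 v d c b a.
Proof. by case=> [[va vb vc vd] [ab bc cd] [n1 m1] [n2 m2]]; split; split; rewrite // 1?adjC // eq_sym. Qed.

Lemma path4_uniq v a b c d : path4 v a b c d -> uniq [:: a; b; c; d].
Proof.
case=> [_ [ab bc cd] [nac mac] [nbd mbd]]; rewrite /= !inE !negb_or nac nbd.
rewrite !(adj_ne ab, adj_ne bc, adj_ne cd) /= !andbT.
by apply/eqP=> ad; subst d; rewrite adjC cd in mac.
Qed.

Section Regular.
Hypotheses (cf : claw_free G) (reg : regular 4 G) (con : connected G).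

Lemma path4_nbr v a b c d z : path4 v a b c d -> adj v z -> [\/ z = a, z = b, z = c | z = d].
Proof.
move=> /[dup] /path4_uniq u [[va vb vc vd] _ _ _]; exact: nbr4.
Qed.

(** Without an induced path or cycle on four neighbours, two non-adjacent
    neighbours split the neighbourhood into two cliques. *)
Lemma split_nbh v : ~ (exists a b c d, path4 v a b c d) -> ~~ clique (closed_nbh v) ->
  exists c1 c2 : {set G}, two_cells v c1 c2.
Proof.
move=> np; rewrite negb_forall_in => /exists_inP[a aN].
rewrite negb_forall_in => /exists_inP[c cN]; rewrite negb_imply => /andP[nac mac].
have [va vc] : adj v a /\ adj v c.
  case/nbhP: aN => [e|va]; case/nbhP: cN => [e'|vc]; subst => //.
  - by rewrite eqxx in nac.
  - by rewrite vc in mac.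
  - by rewrite adjC va in mac.
pose A := fun k : G => v |: [set x | adj v x && ((x == k) || adj x k)].
have AP k x : reflect (x = v \/ adj v x /\ (x = k \/ adj x k)) (x \in A k).
  rewrite in_setU1 in_set; apply: (iffP orP) => -[|]; auto.
  - by move/eqP; auto.
  - by case/andP=> vx /orP[/eqP|]; auto.
  - by move->; left.
  - by case=> -> [->|->]; rewrite ?eqxx ?orbT; auto.
have cl k l : adj v k -> adj v l -> k != l -> ~~ adj k l -> clique (A k).
  move=> vk vl nkl mkl; apply/cliqueP=> x y /AP[->|[vx xk]] /AP[->|[vy yk]] nxy //.
  - by rewrite eqxx in nxy.
  - by rewrite adjC.
  case: xk => [e|xk].
    by case: yk => [e'|yk]; [rewrite e e' eqxx in nxy | rewrite e adjC].
  case: yk => [->//|yk]; apply/negPn/negP=> mxy.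
  have nl z : adj z k -> z != l.
    by move=> zk; apply: contraNN mkl => /eqP<-; rewrite adjC.
  have : [|| adj x y, adj x l | adj y l] by apply: (no_claw cf vx vy vl) => //; apply: nl.
  rewrite (negPf mxy) /= => /orP[xl|yl]; apply: np.
    by exists y, k, x, l; split=> //; split=> //; rewrite 1?adjC // eq_sym.
  by exists x, k, y, l; split=> //; split=> //; rewrite 1?adjC.
have mca : ~~ adj c a by rewrite adjC.
have nca : c != a by rewrite eq_sym.
have q1 := cl _ _ va vc nac mac; have q2 := cl _ _ vc va nca mca.
have vA k : v \in A k by apply/AP; left.
have an2 : a \notin A c.
  apply/AP=> -[e|[_ [e|e]]]; first by rewrite e adj_irrefl in va.
    by rewrite e eqxx in nac.
  by rewrite e in mac.
have cn1 : c \notin A a.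
  apply/AP=> -[e|[_ [e|e]]]; first by rewrite e adj_irrefl in vc.
    by rewrite e eqxx in nac.
  by rewrite e in mca.
have aA : a \in A a by apply/AP; auto.
have cA : c \in A c by apply/AP; auto.
have near x : adj v x -> x = a \/ x = c \/ adj x a \/ adj x c.
  move=> vx; case: (eqVneq x a) => [|nxa]; first by auto.
  case: (eqVneq x c) => [|nxc]; first by auto.
  have := no_claw cf va vc vx nac; rewrite !(eq_sym _ x) nxa nxc (negPf mac) !(adjC _ x) => /(_ isT isT).
  by rewrite /= => /orP[]; auto.
have U : A a :|: A c = closed_nbh v.
  apply/setP=> x; apply/setUP/nbhP => [[]/AP[|[]]|[->|vx]]; auto.
  by case: (near x vx) => [e|[e|[e|e]]]; [left|right|left|right]; apply/AP; auto.
have inA K k : clique K -> v \in K -> k \in K -> k \notin [set v] -> K \subset A k.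
  move=> /cliqueP qK vK kK nk; apply/subsetP=> x xK; apply/AP.
  case: (eqVneq x v) => [|nxv]; first by auto.
  right; split; first by apply: qK; rewrite // eq_sym.
  by case: (eqVneq x k) => [|nxk]; [auto | right; apply: qK].
have two K : clique K -> v \in K -> K \subset A a \/ K \subset A c.
  move=> qK vK; case: (boolP (K \subset A a)) => [|/subsetPn[x xK xa]]; first by auto.
  case: (boolP (K \subset A c)) => [|/subsetPn[y yK yc]]; first by auto.
  have xN z k : z \in K -> z \notin A k -> [/\ adj v z, z != k & ~~ adj z k].
    move=> zK zk; have vz : adj v z.
      apply: (cliqueP _ qK) => //; apply: contra zk => /eqP<-; exact: vA.
    split=> //; first by apply: contra zk => /eqP e; apply/AP; auto.
    by apply: contra zk => h; apply/AP; auto.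
  have [vx nxa mxa] := xN _ _ xK xa; have [vy nyc myc] := xN _ _ yK yc.
  have inK k : adj v k -> k \in K -> K \subset A k.
    move=> vk kK; apply: inA => //; rewrite in_set1; apply/eqP=> e.
    by rewrite e adj_irrefl in vk.
  have naK : a \notin K by apply/negP=> /(inK a va)/subsetP/(_ x xK); rewrite (negPf xa).
  have ncK : c \notin K by apply/negP=> /(inK c vc)/subsetP/(_ y yK); rewrite (negPf yc).
  have nxc : x != c by apply: contraNneq ncK => <-.
  have nya : y != a by apply: contraNneq naK => <-.
  have xc : adj x c.
    by case: (near x vx) => [e|[e|[|//]]]; [rewrite e eqxx in nxa|rewrite e eqxx in nxc|rewrite (negPf mxa)].
  have ya : adj y a.
    by case: (near y vy) => [e|[e|[//|]]]; [rewrite e eqxx in nya|rewrite e eqxx in nyc|rewrite (negPf myc)].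
  have nxy : x != y by apply/eqP=> e; rewrite e ya in mxa.
  have xy := cliqueP _ qK x y xK yK nxy.
  case: np; exists a, y, x, c; split=> //; split=> //; rewrite 1?adjC // eq_sym //.
have nosun k : adj v k -> ~~ sun (A k).
  move=> vk; apply/negP=> sk; have kA : k \in A k by apply/AP; auto.
  have [z [zA zv zk]] := sunE sk (vA k) kA (adj_ne vk).
  by case/AP: zA; right; rewrite adjC; auto.
exists (A a), (A c); split.
- by split=> //; apply: nosun.
- by split.
- exact: U.
- by split; apply/subsetPn; [exists a | exists c].
by move=> K qK vK; case: (two K qK vK); [apply: Or31 | apply: Or32].
Qed.

Lemma nbh_path v a b c d : path4 v a b c d -> closed_nbh v = [set x in [:: v; a; b; c; d]].
Proof.
move=> p; have [[va vb vc vd] _ _ _] := p; apply/setP=> x; rewrite [RHS]in_set !inE; apply/idP/idP.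
  case/orP=> [->//|/(path4_nbr p)[]->]; by rewrite eqxx ?orbT.
by case/or4P=> [->//|/eqP->|/eqP->|/orP[]/eqP->]; rewrite ?va ?vb ?vc ?vd orbT.
Qed.

Lemma no_sun K x y : x \in K -> y \in K -> x != y ->
  (forall t, t \notin K -> adj t x -> adj t y -> False) -> ~~ sun K.
Proof. by move=> xK yK nxy no; apply/negP=> s; have [t []] := sunE s xK yK nxy; apply: no. Qed.

Lemma tri_sub x y z x' y' z' w : w \in tri x y z -> w \notin tri x' y' z' ->
  ~~ (tri x y z \subset tri x' y' z').
Proof. by move=> h1 h2; apply/subsetPn; exists w. Qed.

(** The middle triangle, and the fourth one in case of a cycle, are suns. *)
Lemma path_cells v a b c d : path4 v a b c d -> sun (tri v b c) ->
  ~~ sun (tri v a b) -> ~~ sun (tri v d c) -> (adj a d -> sun (tri v a d)) ->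
  exists c1 c2 : {set G}, two_cells v c1 c2.
Proof.
move=> p sbc nab ncd sad; have [[va vb vc vd] [ab bc cd] [nac mac] [nbd mbd]] := p.
have ba : adj b a by rewrite adjC.
have dc : adj d c by rewrite adjC.
have u := path4_uniq p; have nad : a != d.
  by move: u; rewrite /= !inE !negb_or => /and3P[/and3P[]].
have nva := adj_ne va; have nvb := adj_ne vb; have nvc := adj_ne vc; have nvd := adj_ne vd.
have nab' := adj_ne ab; have nbc' := adj_ne bc; have ncd' := adj_ne cd.
have tN w x y z : w != x -> w != y -> w != z -> w \notin tri x y z.
  by move=> h1 h2 h3; apply/triP=> -[] e; [rewrite e eqxx in h1|rewrite e eqxx in h2|rewrite e eqxx in h3].
have t1 x y z : x \in tri x y z by apply/triP/Or31.
have t2 x y z : y \in tri x y z by apply/triP/Or32.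
have t3 x y z : z \in tri x y z by apply/triP/Or33.
have nvs x : adj v x -> x != v by rewrite eq_sym => /adj_ne.
exists (tri v a b), (tri v d c); split.
- by split; rewrite ?tri_clique.
- by split; apply: t1.
- rewrite (nbh_path p); apply/setP=> x; rewrite [RHS]in_set in_setU !tri_in !in_cons in_nil.
  by case: (x == v) (x == a) (x == b) (x == c) (x == d) => [] [] [] [] [].
- split; [apply: (@tri_sub _ _ _ _ _ _ a) | apply: (@tri_sub _ _ _ _ _ _ d)] => //.
    by apply: tN; rewrite // nvs.
  by apply: tN; rewrite 1?eq_sym // nvs.
move=> K /cliqueP qK vK.
have KN x : x \in K -> [\/ x = v, x = a | [\/ x = b, x = c | x = d]].
  move=> xK; case: (eqVneq x v) => [->|nxv]; first exact: Or31.
  have vx : adj v x by apply: qK; rewrite // eq_sym.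
  by case: (path4_nbr p vx) => ->; [exact: Or32| apply: Or33; exact: Or31|apply: Or33; exact: Or32|apply: Or33; exact: Or33].
have nAC : a \in K -> c \notin K.
  by move=> aK; apply/negP=> cK; rewrite (qK a c) in mac.
have nBD : b \in K -> d \notin K.
  by move=> bK; apply/negP=> dK; rewrite (qK b d) in mbd.
have nC w x : w \in K -> x \notin K -> w != x by move=> wK; apply: contraNneq => <-.
have out w : w \in K -> forall y z, (a \in K) ==> (a \in [:: y; z]) ->
    (b \in K) ==> (b \in [:: y; z]) -> (c \in K) ==> (c \in [:: y; z]) ->
    (d \in K) ==> (d \in [:: y; z]) -> w \in tri v y z.
  have aux k y z : k \in K -> (k \in K) ==> (k \in [:: y; z]) -> k \in tri v y z.
    by move=> -> /=; rewrite tri_in !inE => ->; rewrite orbT.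
  by move=> wK y z h1 h2 h3 h4; case: (KN w wK) => [->//||[]] e; rewrite e in wK *; apply: aux.
have sub y z : (a \in K) ==> (a \in [:: y; z]) ->
    (b \in K) ==> (b \in [:: y; z]) -> (c \in K) ==> (c \in [:: y; z]) ->
    (d \in K) ==> (d \in [:: y; z]) -> K \subset tri v y z.
  by move=> h1 h2 h3 h4; apply/subsetP=> w wK; apply: out.
case: (boolP (a \in K)) => aK.
  have /negPf cK := nAC aK; case: (boolP (b \in K)) => bK.
    have /negPf dK := nBD bK; apply: Or31; apply: sub;
      by rewrite ?cK ?dK ?aK ?bK /= ?inE ?eqxx ?orTb ?orbT ?implybT.
  case: (boolP (d \in K)) => dK; last first.
    apply: Or31; apply: sub;
      by rewrite ?cK ?(negPf dK) ?aK ?(negPf bK) /= ?inE ?eqxx ?orTb ?orbT ?implybT.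
  have ad : adj a d by apply: qK.
  apply: Or33; exists (tri v a d); split; [|exact: tri_clique|exact: sad|..].
  - by apply: sub; rewrite ?cK ?dK ?aK ?(negPf bK) /= ?inE ?eqxx ?orTb ?orbT ?implybT.
  - by apply: (@tri_sub _ _ _ _ _ _ b) => //; apply: tN; rewrite 1?nvs // eq_sym.
  - by apply: (@tri_sub _ _ _ _ _ _ c) => //; apply: tN; rewrite 1?nvs // eq_sym.
case: (boolP (b \in K)) => bK.
  have /negPf dK := nBD bK; apply: Or33; exists (tri v b c); split=> //.
  - by apply: sub; rewrite ?dK ?bK ?(negPf aK) /= ?inE ?eqxx ?orTb ?orbT ?implybT.
  - exact: tri_clique.
  - by apply: (@tri_sub _ _ _ _ _ _ a) => //; apply: tN; rewrite 1?nvs.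
  - by apply: (@tri_sub _ _ _ _ _ _ d) => //; apply: tN; rewrite 1?nvs // eq_sym.
apply: Or32; apply: sub; by rewrite ?(negPf aK) ?(negPf bK) /= ?inE ?eqxx ?orTb ?orbT ?implybT.
Qed.

Lemma in_tri x y z : [/\ x \in tri x y z, y \in tri x y z & z \in tri x y z].
Proof. by split; apply/triP; [apply: Or31 | apply: Or32 | apply: Or33]. Qed.

(** The third common neighbour makes the middle triangle a sun. *)
Lemma p4_cells v a b c d z : path4 v a b c d -> ~~ adj a d ->
  adj z b -> adj z c -> z != v -> exists c1 c2 : {set G}, two_cells v c1 c2.
Proof.
move=> p mad zb zc nzv; have [[va vb vc vd] [ab bc cd] [nac mac] [nbd mbd]] := p.
apply: (path_cells p).
- by apply: (sunI (p := a) (q := d) (r := z)) => //; split; rewrite // 1?adjC // eq_sym.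
- have [i1 i2 i3] := in_tri v a b; apply: (no_sun i1 i2 (adj_ne va)) => t tK tv ta.
  rewrite adjC in tv; case: (path4_nbr p tv) => e; subst t.
  + by rewrite i2 in tK.
  + by rewrite i3 in tK.
  + by rewrite adjC ta in mac.
  + by rewrite adjC ta in mad.
- have [i1 i2 i3] := in_tri v d c; apply: (no_sun i1 i2 (adj_ne vd)) => t tK tv td.
  rewrite adjC in tv; case: (path4_nbr p tv) => e; subst t.
  + by rewrite td in mad.
  + by rewrite td in mbd.
  + by rewrite i3 in tK.
  + by rewrite i2 in tK.
- by rewrite (negPf mad).
Qed.

(** The octahedron: one pick observes five vertices and then the last one. *)
Lemma octahedron v a b c d z : path4 v a b c d -> adj a d -> z != v -> ~~ adj v z ->
  adj z a -> adj z b -> adj z c -> obs [set v] = setT.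
Proof.
move=> p ad nzv mvz za zb zc; have [[va vb vc vd] [ab bc cd] [nac mac] [nbd mbd]] := p.
have zN x : adj v x -> z != x by move=> vx; apply: contraNneq mvz => ->.
have aN t : adj a t -> [\/ t = v, t = b, t = d | t = z].
  apply: nbr4 => //; rewrite 1?adjC //.
  by rewrite /= !inE !negb_or nbd (adj_ne vb) (adj_ne vd) !(eq_sym _ z) nzv !zN.
have cN t : adj c t -> [\/ t = v, t = b, t = d | t = z].
  apply: nbr4 => //; rewrite 1?adjC //.
  by rewrite /= !inE !negb_or nbd (adj_ne vb) (adj_ne vd) !(eq_sym _ z) nzv !zN.
have [d' [dd' nd'v nd'a nd'c]] := fourth d v a c reg.
have zd : adj z d.
  have : [|| adj a c, adj a d' | adj c d'].
    by apply: (no_claw cf (v := d)) => //; rewrite 1?adjC // 1?eq_sym // adjC.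
  rewrite (negPf mac) /= => /orP[h|h]; [case: (aN _ h)|case: (cN _ h)] => e; subst d';
  by [rewrite eqxx in nd'v | rewrite adjC dd' in mbd | rewrite adj_irrefl in dd' | rewrite adjC].
have N4 x y k l t : adj x v -> adj x y -> adj x k -> adj x l -> y != k -> adj v y -> adj v k ->
    y != l -> k != l -> v != l -> adj x t -> [\/ t = v, t = y, t = k | t = l].
  move=> xv xy xk xl nyk vy vk nyl nkl nvl; apply: nbr4 => //.
  by rewrite /= !inE !negb_or nyk (adj_ne vy) (adj_ne vk) nyl nkl nvl.
have nvz : v != z by rewrite eq_sym.
have nN x : adj v x -> x != z by move=> vx; rewrite eq_sym zN.
have bN t : adj b t -> [\/ t = v, t = a, t = c | t = z].
  by apply: N4 => //; rewrite 1?adjC // nN.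
have dN t : adj d t -> [\/ t = v, t = a, t = c | t = z].
  by apply: N4 => //; rewrite 1?adjC // nN.
have zN4 t : adj z t -> [\/ t = a, t = b, t = c | t = d].
  by apply: nbr4 => //; apply: path4_uniq p.
pose B := [set x in [:: v; a; b; c; d; z]].
have BP x : x \in B -> [\/ x = v, x = a | [\/ x = b, x = c | [\/ x = d | x = z]]].
  rewrite in_set !inE => /or4P[/eqP->|/eqP->|/eqP->|/or3P[]/eqP->]; auto.
  - exact: Or31.
  - exact: Or32.
  - by apply: Or33; apply: Or31.
  - by apply: Or33; apply: Or32.
  - by apply: Or33; apply: Or33; left.
  - by apply: Or33; apply: Or33; right.
have inB : [/\ v \in B, a \in B & [/\ b \in B, c \in B & d \in B /\ z \in B]].
  by rewrite !in_set !inE !eqxx !orbT.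
have [vB aB [bB cB [dB zB]]] := inB.
have BT : B = setT.
  apply: (connected_closed con vB) => x y /BP[->|->|[->|->|[->|->]]] xy.
  - by case: (path4_nbr p xy) => ->.
  - by case: (aN _ xy) => ->.
  - by case: (bN _ xy) => ->.
  - by case: (cN _ xy) => ->.
  - by case: (dN _ xy) => ->.
  - by case: (zN4 _ xy) => ->.
have seen x : x = v \/ adj v x -> x \in obs [set v].
  by move=> h; apply: (subsetP (obs_nbh (set11 v))); apply/nbhP.
apply/setP=> x; rewrite in_setT; have : x \in B by rewrite BT in_setT.
case/BP=> [->|->|[->|->|[->|->]]]; try by apply: seen; auto.
apply: (@obs_force _ _ a); [by apply: seen; right | by rewrite adjC |].
by move=> w /aN[] -> nz; try (by apply: seen; auto); rewrite eqxx in nz.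
Qed.

(** At each of the four neighbours, claw-freeness makes the fourth neighbour common
    with one of the two next to it on the cycle. Unless all four agree, which gives
    the octahedron, the one of [a] and [b] forces another one for [c] and [d], and the
    suns are the two opposite triangles on these edges. *)
Lemma c4_cells v a b c d z : obs [set v] <> setT -> path4 v a b c d -> adj a d ->
  adj z a -> adj z b -> z != v -> ~~ adj v z -> exists c1 c2 : {set G}, two_cells v c1 c2.
Proof.
move=> nod p ad za zb nzv mvz; have [[va vb vc vd] [ab bc cd] [nac mac] [nbd mbd]] := p.
have p' : path4 v d a b c by split; split; rewrite // 1?adjC // 1?eq_sym // adjC.
have mzc : ~~ adj z c by apply/negP=> zc; apply: nod; apply: octahedron p ad nzv mvz za zb zc.
have mzd : ~~ adj z d.
  by apply/negP=> zd; apply: nod; apply: octahedron p' _ nzv mvz zd za zb; rewrite adjC.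
have zN x : adj v x -> x != z by move=> vx; apply: contraNneq mvz => <-.
have nvz : v != z by rewrite eq_sym.
have aN t : adj a t -> [\/ t = v, t = b, t = d | t = z].
  apply: nbr4 => //; rewrite 1?adjC //.
  by rewrite /= !inE !negb_or nbd (adj_ne vb) (adj_ne vd) nvz !zN.
have bN t : adj b t -> [\/ t = v, t = a, t = c | t = z].
  apply: nbr4 => //; rewrite 1?adjC //.
  by rewrite /= !inE !negb_or nac (adj_ne va) (adj_ne vc) nvz !zN.
have [e [de nev nea nec]] := fourth d v a c reg.
have ec : adj e c.
  have : [|| adj a c, adj a e | adj c e].
    by apply: (no_claw cf (v := d)) => //; rewrite 1?adjC // 1?eq_sym // adjC.
  rewrite (negPf mac) /= => /orP[h|]; last by rewrite adjC.
  case: (aN _ h) => E; subst e; first by rewrite eqxx in nev.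
  - by rewrite adjC de in mbd.
  - by rewrite adj_irrefl in de.
  - by rewrite adjC de in mzd.
apply: (path_cells p').
- by apply: (sunI (p := d) (q := c) (r := z)) => //; split; rewrite // 1?adjC // eq_sym.
- have [i1 i2 i3] := in_tri v d a.
  apply: (no_sun i2 i3) => [|t tK td ta]; first by rewrite adj_ne // adjC.
  rewrite adjC in ta; case: (aN _ ta) => E; subst t.
  + by rewrite i1 in tK.
  + by rewrite td in mbd.
  + by rewrite i2 in tK.
  + by rewrite td in mzd.
- have [i1 i2 i3] := in_tri v c b.
  apply: (no_sun i2 i3) => [|t tK tc tb]; first by rewrite adj_ne // adjC.
  rewrite adjC in tb; case: (bN _ tb) => E; subst t.
  + by rewrite i1 in tK.
  + by rewrite tc in mac.
  + by rewrite i2 in tK.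
  + by rewrite tc in mzc.
- move=> dc; apply: (sunI (p := a) (q := b) (r := e)) => //; split; rewrite // 1?adjC //.
Qed.

Lemma path_split v a b c d : obs [set v] <> setT -> path4 v a b c d ->
  (adj a d = false -> exists z, [/\ adj z b, adj z c & z != v]) ->
  exists c1 c2 : {set G}, two_cells v c1 c2.
Proof.
move=> nod p ex; have [[va vb vc vd] [ab bc cd] [nac mac] [nbd mbd]] := p.
case: (boolP (adj a d)) => [ad|/[dup] mad /negPf/ex[z [zb zc nzv]]]; last first.
  exact: p4_cells p mad zb zc nzv.
have [e [ae nev neb ned]] := fourth a v b d reg.
have mve : ~~ adj v e.
  apply/negP=> ve; case: (path4_nbr p ve) => E; subst e.
  - by rewrite adj_irrefl in ae.
  - by rewrite eqxx in neb.
  - by rewrite ae in mac.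
  - by rewrite eqxx in ned.
have : [|| adj b d, adj b e | adj d e].
  by apply: (no_claw cf (v := a)) => //; rewrite 1?eq_sym.
rewrite (negPf mbd) /= => /orP[be|de].
  by apply: c4_cells nod p ad _ _ nev mve; rewrite adjC.
have p' : path4 v a d c b by split; split; rewrite // 1?adjC // 1?eq_sym // adjC.
by apply: c4_cells nod p' ab _ _ nev mve; rewrite adjC.
Qed.

(** The neighbourhood of a vertex in a long squared cycle: the middle edge of the path
    lies in no other triangle. *)
Definition strip v a b c d :=
  [/\ path4 v a b c d, ~~ adj a d & forall z, adj z b -> adj z c -> z = v].

Lemma strip_rev v a b c d : strip v a b c d -> strip v d c b a.
Proof.
case=> p mad un; split; [exact: path4_rev | by rewrite adjC |].
by move=> z zc zb; apply: un.
Qed.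

Lemma strip_nbr v a b c d z : strip v a b c d -> adj b z -> z != v -> z != c ->
  z = a \/ adj a z.
Proof.
case=> p mad un bz nzv nzc; have [[va vb vc vd] [ab bc cd] [nac mac] [nbd mbd]] := p.
case: (eqVneq z a) => [|nza]; [by left | right].
have : [|| adj a c, adj a z | adj c z].
  by apply: (no_claw cf (v := b)) => //; rewrite 1?eq_sym // adjC.
rewrite (negPf mac) /= => /orP[//|cz].
by rewrite (un z) ?eqxx // adjC in nzv *.
Qed.

(** The fourth neighbour of [b] is adjacent to [a] by claw-freeness. *)
Lemma strip_mid v a b c d : strip v a b c d -> exists e, strip b e a v c.
Proof.
move=> s; have [p mad un] := s; have [[va vb vc vd] [ab bc cd] [nac mac] [nbd mbd]] := p.
have [e [be nev nea nec]] := fourth b v a c reg.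
have ae : adj a e by case: (strip_nbr s be nev nec) => // E; rewrite E eqxx in nea.
exists e; split.
- split; split; rewrite // 1?adjC //.
  apply/negP=> ve; case: (path4_nbr p ve) => E; subst e.
  + by rewrite eqxx in nea.
  + by rewrite adj_irrefl in be.
  + by rewrite eqxx in nec.
  + by rewrite be in mbd.
- by apply: contra nev => ec; apply/eqP/un; rewrite // adjC.
move=> z za zv; rewrite adjC in zv; case: (path4_nbr p zv) => E //; subst z.
- by rewrite adj_irrefl in za.
- by rewrite adjC za in mac.
- by rewrite adjC za in mad.
Qed.

(** The property passes to both middle neighbours, and, applied twice, to the outer
    ones; connectedness does the rest. *)
Lemma strip_all v a b c d x : strip v a b c d -> exists e f g h, strip x e f g h.
Proof.
pose str y := [exists a, exists b, exists c, exists d,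
  [&& [&& adj y a, adj y b, adj y c & adj y d], [&& adj a b, adj b c & adj c d],
      (a != c) && ~~ adj a c, (b != d) && ~~ adj b d & ~~ adj a d &&
      [forall z, adj z b && adj z c ==> (z == y)]]].
have strP y : reflect (exists a b c d, strip y a b c d) (str y).
  apply: (iffP existsP) => -[k].
    case/existsP=> l /existsP[q] /existsP[r] /and5P[/and4P[? ? ? ?] /and3P[? ? ?]].
    move=> /andP[? ?] /andP[? ?] /andP[? /forallP un]; exists k, l, q, r; split=> // z zl zq.
    by apply/eqP; have := un z; rewrite zl zq.
  case=> l [q [r [[[? ? ? ?] [? ? ?] [? ?] [? ?]] ? un]]]; exists k.
  apply/existsP; exists l; apply/existsP; exists q; apply/existsP; exists r.
  do !(apply/andP; split => //); apply/forallP=> z; apply/implyP=> /andP[zl zq].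
  by apply/eqP/un.
move=> s; apply/strP; suff E : [set y | str y] = setT.
  by have := in_setT x; rewrite -E in_set.
apply: (connected_closed con (v := v)).
  by rewrite in_set; apply/strP; exists a, b, c, d.
move=> y z; rewrite !in_set => /strP[k [l [q [r sy]]]] yz; apply/strP.
have [e se] := strip_mid sy; have [f sf] := strip_mid (strip_rev sy).
have [p _ _] := sy; case: (path4_nbr p yz) => ->.
- by have [g sg] := strip_mid se; exists g, e, l, y.
- by exists e, k, y, q.
- by exists f, r, y, l.
- by have [g sg] := strip_mid sf; exists g, f, q, y.
Qed.

(** An observed vertex lies in a fully observed closed neighbourhood: that of the
    picked vertex, or of the vertex that forced it. *)
Lemma observed_witness (S : {set G}) i x : x \in observed_after i S ->
  exists2 w, x \in closed_nbh w & closed_nbh w \subset observed_after i S.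
Proof.
elim: i x => [|i IH] x.
  by case/bigcupP=> w wS xw; exists w => //; apply: bigcup_sup wS.
rewrite /observed_after /= -/(observed_after i S); set O := observed_after i S in IH *.
case/setUP=> [/IH[w xw wO]|].
  by exists w => //; apply: subset_trans wO (sub_propagate _).
move=> xP; have xO : x \in propagate O by rewrite in_setU xP orbT.
move: xP; rewrite in_set => /exists_inP[w wO /eqP E].
have : x \in open_nbh w :\: O by rewrite E set11.
rewrite in_setD [x \in open_nbh w]in_set => /andP[_ wx].
exists w; first by apply/nbhP; right.
apply/subsetP=> z /nbhP[->|wz]; first exact: (subsetP (sub_propagate _)).
case: (boolP (z \in O)) => [|zO]; first exact: (subsetP (sub_propagate _)).
have : z \in open_nbh w :\: O by rewrite in_setD zO in_set.
by rewrite E => /set1P->.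
Qed.

(** Once the neighbourhood of [a] is observed, [b] has no unobserved neighbour but
    [c], and then [v] none but [d]. *)
Lemma strip_force S v a b c d y : strip v a b c d -> v \in obs S ->
  closed_nbh a \subset obs S \/ closed_nbh b \subset obs S -> adj v y -> y \in obs S.
Proof.
move=> s vO h vy; have [p mad un] := s; have [[va vb vc vd] [ab bc cd] [nac mac] [nbd mbd]] := p.
have [aO bO cO] : [/\ a \in obs S, b \in obs S & c \in obs S].
  case: h => /subsetP h.
    have aO : a \in obs S by apply: h; apply/nbhP; left.
    have bO : b \in obs S by apply: h; apply/nbhP; right.
    split=> //; apply: (obs_force bO bc) => w bw nwc.
    case: (eqVneq w v) => [->//|nwv]; apply: h; apply/nbhP.
    by case: (strip_nbr s bw nwv nwc); auto.
  by split; apply: h; apply/nbhP; auto; right; rewrite adjC.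
have dO : d \in obs S.
  by apply: (obs_force vO vd) => w /(path4_nbr p)[]-> //; rewrite eqxx.
by case: (path4_nbr p vy) => ->.
Qed.

(** By [observed_witness] every observed vertex has a neighbour for which
    [strip_force] applies, on one side or on the other. *)
Lemma strip_dom v a b c d : strip v a b c d -> obs [set v] = setT.
Proof.
move=> s; apply: (connected_closed con (v := v)).
  by apply: (subsetP (obs_nbh (set11 v))); apply/nbhP; left.
move=> x y xO xy; have [w /nbhP[e|wx] wO] := observed_witness xO.
  by apply: (subsetP wO); apply/nbhP; right; rewrite -e.
have [k [l [q [r sx]]]] := strip_all x s; have [p _ _] := sx.
rewrite adjC in wx; have sx' := strip_rev sx.
case: (path4_nbr p wx) => E; subst w.
- by apply: (strip_force sx xO) => //; left.
- by apply: (strip_force sx xO) => //; right.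
- by apply: (strip_force sx' xO) => //; right.
- by apply: (strip_force sx' xO) => //; left.
Qed.

(** All closed neighbourhoods have five vertices, so this one is closed. *)
Lemma clique_dom v : clique (closed_nbh v) -> obs [set v] = setT.
Proof.
move=> q; have E : closed_nbh v = setT; last first.
  by apply/eqP; rewrite -subTset -E; apply: obs_nbh; apply: set11.
have vN : v \in closed_nbh v by apply/nbhP; left.
apply: (connected_closed con vN) => x y xN xy.
have sub : closed_nbh v \subset closed_nbh x.
  apply/subsetP=> z zN; apply/nbhP; case: (eqVneq x z) => [|n]; first by left.
  by right; apply: (cliqueP _ q).
have -> : closed_nbh v = closed_nbh x; last by apply/nbhP; right.
by apply/eqP; rewrite eqEcard sub !nbh5.
Qed.

Lemma cells_at v : (forall x, obs [set x] <> setT) ->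
  exists c1 c2 : {set G}, two_cells v c1 c2.
Proof.
move=> nod; have nq : ~~ clique (closed_nbh v) by apply/negP=> /clique_dom/nod.
pose pt (t : G * G * G * G) := let: (a, b, c, d) := t in
  [&& [&& adj v a, adj v b, adj v c & adj v d], [&& adj a b, adj b c & adj c d],
      (a != c) && ~~ adj a c & (b != d) && ~~ adj b d].
case: (pickP pt) => [[[[a b] c] d]|np].
  case/and4P=> /and4P[? ? ? ?] /and3P[? ? ?] /andP[? ?] /andP[? ?].
  have p : path4 v a b c d by [].
  apply: (path_split (nod v) p) => mad.
  case: (pickP [pred z | [&& adj z b, adj z c & z != v]]) => [z /and3P[? ? ?]|un].
    by exists z.
  case: (nod v); apply: (@strip_dom v a b c d); split=> //; first by rewrite mad.
  by move=> z zb zc; apply/eqP/negPn/negP=> nz; have := un z; rewrite /= zb zc nz.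
apply: split_nbh => // -[a [b [c [d [[va vb vc vd] [ab bc cd] [nac mac] [nbd mbd]]]]]].
by have := np (a, b, c, d); rewrite /pt va vb vc vd ab bc cd nac mac nbd mbd.
Qed.

Lemma cell_size K : (forall x, obs [set x] <> setT) -> K \in graph_cells -> #|K| <= 4.
Proof.
move=> nod; rewrite in_set => /andP[/maxsetP[q _] _].
case: (set_0Vmem K) => [->|[x xK]]; first by rewrite cards0.
have sub : K \subset closed_nbh x.
  apply/subsetP=> z zK; apply/nbhP; case: (eqVneq x z) => [|n]; first by left.
  by right; apply: (cliqueP _ q).
rewrite -ltnS -(nbh5 reg x); apply: proper_card; rewrite properEneq sub andbT.
by apply/eqP=> e; apply: (nod x); apply: clique_dom; rewrite -e.
Qed.

Theorem upper_bound : 5 * power_domination_number G <= #|G| + 1.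
Proof.
case: (pickP [pred x : G | obs [set x] == setT]) => [x /eqP E|no].
  have := gamma_le E; rewrite cards1 => le1.
  have : 5 <= #|G| by rewrite -(nbh5 reg x) max_card.
  by move: le1; move: (power_domination_number G) #|G| => *; lia_num.
have nod x : obs [set x] <> setT by move=> E; have := no x; rewrite /= E eqxx.
apply: (@cells_bound G graph_cells) => //; last by move=> K; apply: cell_size.
move=> x; have [c1 [c2 h]] := cells_at x nod; exists c1, c2; exact: two_cellsP.
Qed.

End Regular.
End ClawFree.

(** * The rook graph of order nine *)

Definition rook_adj : rel ('I_3 * 'I_3) :=
  fun u v => (u != v) && ((u.1 == v.1) || (u.2 == v.2)).

Lemma rook_sym : symmetric rook_adj.
Proof. by move=> u v; rewrite /rook_adj eq_sym (eq_sym u.1) (eq_sym u.2). Qed.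

Lemma rook_irrefl : irreflexive rook_adj.
Proof. by move=> u; rewrite /rook_adj eqxx. Qed.

Definition rook : sgraph := SGraph rook_sym rook_irrefl.

Lemma rook_card : #|rook| = 9.
Proof. by rewrite card_prod !card_ord. Qed.

Lemma rook_connected : connected rook.
Proof.
split; first by rewrite rook_card.
move=> [i j] [k l]; apply: (connect_trans (y := (i, l) : rook)).
  case: (eqVneq j l) => [->|n]; first exact: connect0.
  by apply: connect1; rewrite /= /rook_adj xpair_eqE eqxx n.
case: (eqVneq i k) => [->|n]; first exact: connect0.
by apply: connect1; rewrite /= /rook_adj xpair_eqE eqxx (negPf n) orbT.
Qed.

Lemma rook_regular : regular 4 rook.
Proof.
case=> i j; have -> : open_nbh ((i, j) : rook) = setX [set i] [set~ j] :|: setX [set~ i] [set j].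
  apply/setP=> -[k l]; rewrite in_set in_setU !in_setX !in_setC !in_set1 /= /rook_adj xpair_eqE /=.
  rewrite (eq_sym i) (eq_sym j); by case: (k == i); case: (l == j).
rewrite cardsU !cardsX !cards1 !cardsC1 card_ord.
suff -> : setX [set i] [set~ j] :&: setX [set~ i] [set j] = set0 by rewrite cards0.
apply/setP=> -[k l]; rewrite in_setI !in_setX !in_setC !in_set1 in_set0.
by case: (k == i); rewrite ?andbF.
Qed.

(** Each leaf of a claw shares the row or the column of its centre, so two of the
    three share the same one and are adjacent. *)
Lemma rook_claw_free : claw_free rook.
Proof.
move=> S [f [g fg gf] fadj].
have gadj u v : adj (val (g u)) (val (g v)) = adj u v.
  by rewrite -[LHS]/(adj (g u) (g v)) -fadj !gf.
pose t : rook := val (g (inl ord0)); pose x i : rook := val (g (inr i)).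
pose r i := (x i).1 == t.1.
have tx i : rook_adj t (x i) by apply: (gadj (inl ord0) (inr i)).
have xx i j : rook_adj (x i) (x j) = false by apply: (gadj (inr i) (inr j)).
have /leq_card : injective r.
  move=> i j e; suff : g (inr i) = g (inr j) by move/(can_inj gf) => -[].
  apply: val_inj; apply/eqP; rewrite -/(x i) -/(x j); move: (xx i j) (tx i) (tx j) e.
  rewrite /rook_adj /r; case: (x i) (x j) (t) => [a b] [c d] [k l] /=.
  rewrite !xpair_eqE /=; case: (eqVneq a k) => [ak|nak]; case: (eqVneq c k) => [ck|nck] //.
    by subst; rewrite !eqxx /= andbT => /negbFE.
  rewrite /= => h /eqP e1 /eqP e2 _.
  by move: h; rewrite -e1 -e2 eqxx orbT andbT => /negbFE.
by rewrite card_bool card_ord.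
Qed.

Lemma third (i j : 'I_3) : exists k, k != i /\ k != j.
Proof.
have /subsetPn[k _] : ~~ ([set: 'I_3] \subset [set i; j]).
  apply/negP=> /subset_leq_card; rewrite cardsT card_ord cards2.
  by case: (i != j).
by rewrite !inE negb_or => /andP[]; exists k.
Qed.

Lemma rook_nbhP (u v : rook) :
  reflect (u.1 = v.1 \/ u.2 = v.2) (u \in closed_nbh v).
Proof.
rewrite /closed_nbh in_setU1 in_set /= /rook_adj (eq_sym v).
apply: (iffP idP) => [/orP[/eqP->|/andP[_ /orP[]/eqP->]]|h]; auto.
case: (eqVneq u v) => //= _; by case: h => ->; rewrite eqxx ?orbT.
Qed.

(** A square in line with [v] sees exactly two squares outside, and these stay
    unobserved together. *)
Lemma rook_stuck (v : rook) (O : {set rook}) : O \subset closed_nbh v -> propagate O \subset closed_nbh v.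
Proof.
move=> sO; apply/subsetP=> u /setUP[uO|]; first exact: (subsetP sO).
rewrite in_set => /exists_inP[x xO /eqP E]; apply/negPn/negP=> uN.
have : u \in open_nbh x :\: O by rewrite E set11.
rewrite in_setD in_set => /andP[_ xu].
have key y : y \notin closed_nbh v -> adj x y -> y = u.
  move=> yN xy; apply/eqP; rewrite -in_set1 -E in_setD in_set xy andbT.
  by apply: contra yN; apply: (subsetP sO).
have [w1 [n1 m1]] := third u.1 v.1; have [w2 [n2 m2]] := third u.2 v.2.
have nu1 : u.1 != v.1 by apply: contra uN => /eqP e; apply/rook_nbhP; left.
have nu2 : u.2 != v.2 by apply: contra uN => /eqP e; apply/rook_nbhP; right.
have out (a b : 'I_3) : a != v.1 -> b != v.2 -> ((a, b) : rook) \notin closed_nbh v.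
  by move=> h1 h2; apply/rook_nbhP=> -[] /= e; [rewrite e eqxx in h1 | rewrite e eqxx in h2].
move: xu; rewrite /= /rook_adj => /andP[_ xu].
case/rook_nbhP: (subsetP sO x xO) => e; move: xu.
  rewrite e eq_sym (negPf nu1) /= => /eqP e2; have := key (w1, u.2) (out _ _ m1 nu2).
  rewrite /= /rook_adj -e2 eqxx orbT andbT => k; apply: (negP n1).
  have nx : x != (w1, x.2) by apply: contra m1 => /eqP xe; rewrite -e xe.
  by rewrite -(k nx).
rewrite e orbC eq_sym (negPf nu2) /= => /eqP e2; have := key (u.1, w2) (out _ _ nu1 m2).
rewrite /= /rook_adj -e2 eqxx /= andbT => k; apply: (negP n2).
have nx : x != (x.1, w2) by apply: contra m2 => /eqP xe; rewrite -e xe.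
by rewrite -(k nx).
Qed.

Lemma rook_gamma : power_domination_number rook = 2.
Proof.
apply/eqP; rewrite eqn_leq; apply/andP; split.
  have := upper_bound rook_claw_free rook_regular rook_connected.
  by rewrite rook_card; move: (power_domination_number _) => *; lia_num.
have [[S dS <-] _] := power_domination_numberP rook; rewrite ltnNge; apply/negP=> le1.
have [v Sv] : exists v, S \subset [set v].
  case: (set_0Vmem S) => [->|[v vS]]; first by exists (ord0, ord0); apply: sub0set.
  exists v; apply/subsetP=> u uS; rewrite in_set1; apply/eqP; exact: (card_le1_eqP le1).
have sub i : observed_after i S \subset closed_nbh v.
  elim: i => [|i IH]; last exact: rook_stuck IH.
  by apply/bigcupsP=> u /(subsetP Sv)/set1P->.
have [w1 [n1 _]] := third v.1 v.1; have [w2 [n2 _]] := third v.2 v.2.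
have : (w1, w2) \in closed_nbh v by apply: (subsetP (sub #|rook|)); rewrite (eqP dS) in_setT.
by case/rook_nbhP=> /= e; [rewrite e eqxx in n1 | rewrite e eqxx in n2].
Qed.

Import GRing.Theory Num.Theory.
Local Open Scope ring_scope.

Theorem theorem2p2 :
  (forall G : sgraph, connected G -> claw_free G -> regular 4 G ->
     (power_domination_number G)%:R <= (#|G|%:R + 1) / 5%:R :> rat) /\
  (exists G : sgraph, [/\ connected G, claw_free G, regular 4 G &
     (power_domination_number G)%:R = (#|G|%:R + 1) / 5%:R :> rat]).
Proof.
split=> [G con cf reg|].
  rewrite ler_pdivlMr ?ltr0n // natr1 -natrM ler_nat mulnC -[X in (_ <= X)%N]addn1.
  exact: upper_bound.
exists rook; split; [exact: rook_connected | exact: rook_claw_free | exact: rook_regular |].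
rewrite rook_gamma rook_card natr1; apply: (canRL (mulfK _)); first by rewrite pnatr_eq0.
by rewrite -natrM.
Qed.
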